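(* Let $\beta>1$ be a Pisot number and let $m>\beta$ be an integer. Then there is a constant $D_{\beta,m}$ with $1\le D_{\beta,m}<\log_\beta m$ such that for Lebesgue-a.e. $x\in I_\beta$ the local dimension $d(\mu_{\beta,m},x)$ exists and equals $D_{\beta,m}$. Moreover, $D_{\beta,m}>1$ unless $\beta$ is an integer dividing $m$.
   Context: A Pisot number is an algebraic integer $\beta>1$ all of whose other Galois conjugates have modulus strictly less than $1$ (rational integers $\beta\ge2$ are included). For a real $\beta>1$ and an integer $m>\beta$, put $I_\beta=[0,\frac{m-1}{\beta-1}]$. The measure $\mu_{\beta,m}$ is the Borel probability measure on $\mathbb R$ given by $\mu_{\beta,m}(E)=\mathbb P\{(\varepsilon_1,\varepsilon_2,\dots)\in\{0,1,\dots,m-1\}^{\mathbb N}:\sum_{k=1}^\infty\varepsilon_k\beta^{-k}\in E\}$, where $\mathbb P$ is the infinite product of the uniform probability measures $\{1/m,\dots,1/m\}$ on $\{0,\dots,m-1\}$. The local dimension of $\mu$ at $x$ is $d(\mu,x)=\lim_{r\to0}\frac{\log\mu([x-r,x+r])}{\log r}$, provided the limit exists. *)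

(* Defs.v *)
From HB Require Import structures.
From mathcomp Require Import all_boot all_order all_algebra.
From mathcomp Require Import mathcomp_extra boolp classical_sets functions.
From mathcomp Require Import cardinality reals ereal.
From mathcomp Require Import topology normedtype sequences exp measure.
From mathcomp Require Import lebesgue_measure measurable_realfun.
From mathcomp Require Import lebesgue_integral.
From mathcomp Require Import mxpoly complex.

Set Implicit Arguments.
Unset Strict Implicit.
Unset Printing Implicit Defensive.

Import Order.TTheory GRing.Theory Num.Theory.
Import numFieldNormedType.Exports.

Local Open Scope classical_set_scope.
Local Open Scope ring_scope.

(* z is a root in C = R[i] of the minimal polynomial of x over Q *)
Definition galois_conjugate (R : realType) (x : R) (z : R[i]) : Prop :=
  exists p : {poly rat},
    [/\ p \is monic, irreducible_poly p,
        root (map_poly (ratr : rat -> R) p) x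
      & root (map_poly (ratr : rat -> R[i]) p) z].

Definition pisot (R : realType) (beta : R) : Prop :=
  [/\ 1 < beta, integralOver (intr : int -> R) beta
    & forall z : R[i], galois_conjugate beta z ->
        z != beta%:C%C -> `|z| < 1].

HB.instance Definition _ n := isPointed.Build 'I_n.+1 ord0.

(* 'I_m.-1.+1 is {0, ..., m-1} for m > 0; the successor only serves to make it
   nonempty for every m. *)
Definition coordinate_events (m : nat) : set (set (nat -> 'I_m.-1.+1)) :=
  [set A | exists k a, A = [set w | w k = a]].

Arguments coordinate_events : clear implicits.

(* {0, ..., m-1}^N with its product sigma-algebra. Indices start at 0: the digit
   w k carries the weight beta^-(k+1) in digit_sum. *)
Definition digit_seq (m : nat) := g_sigma_algebraType (coordinate_events m).

HB.instance Definition _ m := Measurable.on (digit_seq m).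

Definition cylinder (m n : nat) (a : nat -> 'I_m.-1.+1) : set (digit_seq m) :=
  [set w | forall i, (i < n)%N -> w i = a i].

(* The cylinder events form a pi-system generating the sigma-algebra, so at most
   one probability measure satisfies this. *)
Definition is_uniform_product (R : realType) (m : nat)
    (P : probability (digit_seq m) R) : Prop :=
  forall n (a : nat -> 'I_m.-1.+1),
    P (cylinder n a) = ((m.-1.+1%:R^-1) ^+ n)%:E.

Lemma measurable_cylinder m n (a : nat -> 'I_m.-1.+1) : measurable (cylinder n a).
Proof.
rewrite (_ : cylinder _ _ =
  \bigcap_(i in [set i | (i < n)%N]) [set w : digit_seq m | w i = a i]).
  by apply: bigcap_measurableType => k _; apply: sub_gen_smallest; exists k, (a k).
by apply/seteqP; split.
Qed.

Section uniform_product_existence.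
Context (R : realType) (m : nat).
Let b := m.-1.+1.
Let T (k : nat) (x : R) : nat := Num.truncn (b%:R ^+ k * x).
Let D (x : R) : digit_seq m := fun k => inord (T k.+1 x %% b).

Let b_gt0 k : 0 < b%:R ^+ k :> R. Proof. by rewrite exprn_gt0. Qed.

Let measurable_T k (S : set nat) : measurable (T k @^-1` S).
Proof.
have -> : T k @^-1` S = \bigcup_(j in S) (T k @^-1` [set j]).
  by apply/seteqP; split=> [x Sx|x [j Sj /= Tj]]; [exists (T k x)|rewrite /= Tj].
apply: bigcup_measurable => j _.
have mf : measurable_fun setT (fun x : R => b%:R ^+ k * x).
  exact: measurable_funM.
suff mt : measurable ((@Num.truncn R) @^-1` [set j]).
  by rewrite -[X in measurable X]setTI; exact: (mf measurableT _ mt).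
case: j => [|j].
  rewrite (_ : _ @^-1` _ = [set` `]-oo, (1:R)[]); first exact: measurable_itv.
  apply/seteqP; split=> x /=; rewrite in_itv/=.
    by move/eqP; rewrite -leqn0 real_truncn_le_nat// num_real.
  by move=> x1; apply/eqP; rewrite -leqn0 real_truncn_le_nat// num_real.
rewrite (_ : _ @^-1` _ = [set` `[(j.+1%:R:R), j.+2%:R[]).
  exact: measurable_itv.
apply/seteqP; split=> x /=; rewrite in_itv/=.
  move=> xj; rewrite -xj; apply: truncn_itv; rewrite leNgt; apply/negP => x0.
  by move: xj; rewrite truncn_floor leNgt x0.
exact: truncn_def.
Qed.

Let measurable_D : measurable_fun [set: R] D.
Proof.
refine (@measurability _ _ _ _ setT D (coordinate_events m) erefl _).
move=> _ [_ [k [a ->]] <-].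
rewrite setTI.
rewrite (_ : _ @^-1` _ = T k.+1 @^-1` [set j | inord (j %% b) = a]) //.
Qed.

(* Law of the base-m digits of a uniform point of [0, 1); only used to prove
   existence. *)
Definition expansion_law (A : set (digit_seq m)) : \bar R :=
  lebesgue_measure (D @^-1` A `&` `[0, 1[).

Let law_0 : expansion_law set0 = 0%E.
Proof. by rewrite /expansion_law preimage_set0 set0I measure0. Qed.

Let law_ge0 A : (0 <= expansion_law A)%E.
Proof. exact: measure_ge0. Qed.

Let law_sigma_additive : semi_sigma_additive expansion_law.
Proof.
move=> F mF tF mUF; rewrite /expansion_law preimage_bigcup setI_bigcupl.
have mDF i : measurable (D @^-1` F i `&` `[0, 1[).
  apply: measurableI; last exact: measurable_itv.
  by rewrite -[X in measurable X]setTI; exact: measurable_D.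
apply: measure_semi_sigma_additive => //; last exact: bigcupT_measurable.
apply/trivIsetP => i j _ _ ij; rewrite setIACA -preimage_setI.
by move/trivIsetP : tF => ->//; rewrite preimage_set0 set0I.
Qed.

HB.instance Definition _ :=
  isMeasure.Build _ _ _ expansion_law law_0 law_ge0 law_sigma_additive.

Let law_setT : expansion_law setT = 1%E.
Proof.
by rewrite /expansion_law preimage_setT setTI lebesgue_measure_itv/= lte01 oppr0 adde0.
Qed.

HB.instance Definition _ := Measure_isProbability.Build _ _ _ expansion_law law_setT.

Let N (a : nat -> 'I_b) := fix N n : nat :=
  if n is n'.+1 then (N n' * b + a n')%N else 0%N.

Let N_lt a n : (N a n < b ^ n)%N.
Proof.
elim: n => //= n IH; rewrite expnSr.
apply: (@leq_trans ((N a n).+1 * b)%N); last by rewrite leq_pmul2r.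
by rewrite mulSn addnC ltn_add2r.
Qed.

Let T_div n x : 0 <= x -> (T n.+1 x %/ b)%N = T n x.
Proof.
move=> x0; have Tx k : 0 <= b%:R ^+ k * x by rewrite mulr_ge0// ltW.
apply/esym/truncn_def; have /andP[l u] := truncn_itv (Tx n.+1).
have e : b%:R ^+ n.+1 * x = b%:R ^+ n * x * b%:R.
  by rewrite exprSr mulrAC.
have b0 : 0 < b%:R :> R by rewrite ltr0n.
rewrite -(ler_pM2r b0) -(ltr_pM2r b0) -!e -!natrM; apply/andP; split.
  by apply: le_trans l; rewrite ler_nat leq_divM.
by apply: lt_le_trans u _; rewrite ler_nat -/(T n.+1 x) ltn_ceil.
Qed.

Let cylinderE n (a : nat -> 'I_m.-1.+1) x : 0 <= x < 1 ->
  (forall i, (i < n)%N -> D x i = a i) <-> T n x = N a n.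
Proof.
move=> /andP[x0 x1]; elim: n => [|n IH].
  by split=> // _; rewrite /T expr0 mul1r; apply: truncn_def; rewrite x0.
have TE := divn_eq (T n.+1 x) b; rewrite T_div// in TE.
have Da : (D x n = a n) <-> (T n.+1 x %% b = a n)%N.
  rewrite /D; split=> [<-|->]; last exact: inord_val.
  by rewrite inordK// ltn_mod.
split=> [Dxa|/= TN].
  rewrite TE (proj1 Da) ?Dxa//=; congr (_ * _ + _)%N.
  by apply/IH => i ni; apply: Dxa; rewrite ltnS ltnW.
have Tn : T n x = N a n.
  by rewrite -(T_div _ x0) TN divnMDl// divn_small ?addn0.
have Tm : (T n.+1 x %% b)%N = a n by rewrite TN modnMDl modn_small.
move=> i; rewrite ltnS leq_eqVlt => /predU1P[->|]; first exact/Da.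
by move: i; exact/IH.
Qed.

Lemma uniform_product_exists :
  exists P : probability (digit_seq m) R, is_uniform_product P.
Proof.
exists expansion_law => n a; rewrite /= /expansion_law.
have bn : 0 < b%:R ^+ n :> R by [].
have NbE : (N a n).+1%:R <= b%:R ^+ n :> R by rewrite -natrX ler_nat.
rewrite (_ : _ `&` _ =
    [set` `[(N a n)%:R / b%:R ^+ n, (N a n).+1%:R / b%:R ^+ n[]).
  rewrite lebesgue_measure_itv/= lte_fin ltr_pM2r ?invr_gt0// ltr_nat ltnSn.
  by rewrite -EFinB -mulrBl -natrB// subSnn mul1r exprVn.
apply/seteqP; split=> x /=; rewrite !in_itv/= ler_pdivrMr// ltr_pdivlMr//.
  move=> [Dxa /[dup] x01 /andP[x0 _]].
  have /(cylinderE n a x01) <- := Dxa.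
  by rewrite mulrC; apply: truncn_itv; rewrite mulr_ge0// ltW.
move=> Nx; have /truncn_def TN : (N a n)%:R <= b%:R ^+ n * x < (N a n).+1%:R.
  by rewrite mulrC.
have x01 : 0 <= x < 1.
  case/andP : Nx => l u; apply/andP; split.
    by rewrite -(pmulr_lge0 _ bn) (le_trans _ l).
  by rewrite -(ltr_pM2r bn) mul1r (lt_le_trans u).
by split=> //; apply/cylinderE.
Qed.

End uniform_product_existence.

Definition uniform_product (R : realType) (m : nat) :
  probability (digit_seq m) R := sval (cid (uniform_product_exists R m)).

Lemma uniform_productP (R : realType) (m : nat) :
  is_uniform_product (uniform_product R m).
Proof. exact: svalP (cid _). Qed.

(* The series converges when 1 < beta (is_cvg_digit_sum) and is then a measurable
   function of the digits (measurable_digit_sum), so that bernoulli_convolution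
   is a Borel probability measure. *)
Definition digit_sum (R : realType) (beta : R) (m : nat) (w : digit_seq m) : R :=
  limn (series (fun k => (w k)%:R * beta ^- k.+1)).
Arguments digit_sum : clear implicits.

Lemma is_cvg_digit_sum (R : realType) (beta : R) (m : nat) (w : digit_seq m) :
  1 < beta -> cvgn (series (fun k => (w k)%:R * beta ^- k.+1)).
Proof.
move=> beta1; have beta0 : 0 < beta by apply: lt_trans beta1.
apply: (@series_le_cvg _ _ (geometric (m.-1%:R / beta) beta^-1)) => [k|k|k|].
- by rewrite mulr_ge0// invr_ge0 exprn_ge0// ltW.
- by rewrite /= !mulr_ge0// ?exprn_ge0// ?invr_ge0 ltW.
- rewrite /= -mulrA -exprVn -exprS ler_wpM2r ?exprn_ge0 ?invr_ge0 ?(ltW beta0)//.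
  by rewrite ler_nat -ltnS.
- by apply: is_cvg_geometric_series; rewrite gtr0_norm ?invr_gt0// invf_lt1.
Qed.

Lemma measurable_digit_sum (R : realType) (beta : R) (m : nat) :
  1 < beta -> measurable_fun [set: digit_seq m] (digit_sum R beta m).
Proof.
move=> beta1.
pose S n (w : digit_seq m) := series (fun k => (w k)%:R * beta ^- k.+1) n.
apply/measurable_EFinP; apply: (emeasurable_fun_cvg (fun n => EFin \o S n)).
  move=> n; apply/measurable_EFinP; rewrite /S /series/=.
  apply: measurable_sum => k.
  apply: measurable_funM => //.
  move=> _ Y mY; rewrite setTI.
  rewrite (_ : _ @^-1` Y = \bigcup_(a in [set a : 'I_m.-1.+1 | Y a%:R])
             [set w : digit_seq m | w k = a]).
    apply: fin_bigcup_measurable => // a _.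
    by apply: sub_gen_smallest; exists k, a.
  by apply/seteqP; split=> [w Yw|w [a Ya /= wk]]; [exists (w k)|rewrite /= wk].
by move=> w _; apply: cvg_EFin; [exact: nearW|exact: is_cvg_digit_sum].
Qed.

Definition bernoulli_convolution (R : realType) (beta : R) (m : nat) :
    set R -> \bar R :=
  pushforward (uniform_product R m) (digit_sum R beta m).

(* The logarithm lne is extended-real valued with lne 0 = -oo, hence the quotient
   is +oo (not 0) at radii 0 < r < 1 for which the interval is mu-null. *)
Definition is_local_dimension (R : realType) (mu : set R -> \bar R) (x : R)
    (d : \bar R) : Prop :=
  (fun r : R => lne (mu [set` `[x - r, x + r]%R]) * ((ln r)^-1)%:E)%E @ 0^'+ --> d.

(* Main.v *)
Require Import Defs.
From HB Require Import structures.
From mathcomp Require Import all_boot all_order all_algebra.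
From mathcomp Require Import mathcomp_extra boolp classical_sets functions.
From mathcomp Require Import reals ereal topology normedtype.
From mathcomp Require Import sequences derive realfun exp trigo measure.
From mathcomp Require Import lebesgue_measure measurable_realfun numfun.
From mathcomp Require Import lebesgue_integral ftc.
From mathcomp Require Import complex ring lra zify.

Set Implicit Arguments.
Unset Strict Implicit.
Unset Printing Implicit Defensive.

Import Order.TTheory GRing.Theory Num.Theory.
Import numFieldNormedType.Exports.

Local Open Scope classical_set_scope.
Local Open Scope ring_scope.

(** A word $\varepsilon_1\dots\varepsilon_n$ has an integer part
    $s=\sum_k\varepsilon_k\beta^{n-k}$, and it begins an expansion of x exactly when its
    remainder $\beta^nx-s$ lies in $I_\beta=[0,\kappa]$. Let $N_n(x)$ be the number of such
    words ([prefixes]). An interval of radius about $\beta^{-n}$ around x has mass about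
    $m^{-n}N_n(x)$, so that the local dimension at x is $(\ln m-\gamma)/\ln\beta$ whenever
    $N_n(x)$ grows like $e^{\gamma n}$ ([local_dimension_of_growth]). What has to be shown is
    that the growth rate exists, is almost surely constant, and satisfies
    $0<\gamma\le\ln(m/\beta)$, with strict inequality unless $\beta$ is a divisor of m.

    Existence. By Garsia's lemma ([garsia_separation]) different integer parts of the same
    length are at distance at least some $\delta>0$. Hence a point has at most C different
    remainders in $I_\beta$ at each level, and following the most frequent one makes
    $\ln N_n$ superadditive up to the constant $\ln C$ ([superadditive_ln_prefixes]). Also,
    there are at most $C\beta^n$ different integer parts, so that passing to remainders
    multiplies Lebesgue measure by at most C ([leb_hits]). With a zero-one law proved by
    density points ([zero_one_law]), this replaces an invariant measure: blocks on which
    $\ln N_n$ grows at nearly its limit superior rate can be concatenated with rare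
    interruptions, so that the limit inferior is the same ([superadditive_ergodic]).

    Positivity. Since $m>\beta$, two digits are possible on an interval of positive length,
    and the zero-one law doubles the number of prefixes again and again
    ([prefixes_unbounded]). Concatenation turns this into exponential growth
    ([prefixes_exponential]).

    Upper bound. The half moment $h_n=\beta^{-n}\sum_s\sqrt{c_n(s)}$, where $c_n(s)$ is the
    number of words with integer part s, satisfies $h_n^2\le C(m/\beta)^n$ by
    Cauchy--Schwarz, and controls the measure of the points with many prefixes; this gives
    $\gamma\le\ln(m/\beta)$. As $h_n$ is submultiplicative, the inequality is strict once
    $h_k^2<(m/\beta)^k$ for one k ([prefixes_growth_rate]).

    Strictness. If $\beta$ is not an integer dividing m, the Fourier transform of the law of
    the integer parts does not decay along the powers of $\beta$ ([fourier_lower_bound]). An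
    average of N cosines with these lacunary frequencies is small in mean square for
    Lebesgue measure, hence also over the separated set of integer parts
    ([sum_sqr_lacunary]). So a fixed proportion of the words has its integer parts in a set
    of size $o(\beta^k)$ ([pisot_concentrated]). Juxtaposing independent blocks brings the
    proportion near 1 ([concentrated_double]), and Cauchy--Schwarz on this set and on its
    complement makes $h_k^2$ smaller than $(m/\beta)^k$ ([half_moment_concentrated]). *)

(** * Characteristic polynomials and monic factors *)

Lemma horner_char_poly (F : comNzRingType) n (A : 'M[F]_n) mu :
  (char_poly A).[mu] = \det (mu%:M - A).
Proof.
rewrite /char_poly -/(horner_eval mu _) -det_map_mx; congr (\det _).
apply/matrixP => i j; rewrite !mxE /= /horner_eval.
by rewrite hornerD hornerN hornerC hornerMn hornerX.
Qed.

(** Both sides are multiplicative in q, which splits into linear factors; for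
    $q = X-\mu$ the claim is the evaluation of the characteristic polynomial at $\mu$. *)
Lemma det_horner_mx (F : closedFieldType) n (A : 'M[F]_n.+1) (rs : seq F)
    (q : {poly F}) :
  char_poly A = \prod_(z <- rs) ('X - z%:P) ->
  \det (horner_mx A q) = \prod_(z <- rs) q.[z].
Proof.
move=> cpA.
have srs : size rs = n.+1.
  have := congr1 (fun p : {poly F} => size p) cpA.
  by rewrite size_char_poly size_prod_XsubC => -[].
have [mus ->] := closed_field_poly_normal q.
rewrite linearZ /= detZ rmorph_prod /=.
have detP (s : seq F) (G : F -> 'M[F]_n.+1) :
    \det (\prod_(z <- s) G z) = \prod_(z <- s) \det (G z).
  by elim: s => [|a s IH]; rewrite ?big_nil ?det1// !big_cons det_mulmx IH.
rewrite detP.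
under eq_bigr => mu _.
  have -> : \det (horner_mx A ('X - mu%:P)) = \prod_(z <- rs) (z - mu).
    rewrite rmorphB /= horner_mx_X horner_mx_C -opprB -scaleN1r detZ.
    rewrite -horner_char_poly cpA horner_prod -srs.
    elim: (rs) => [|z s IHs]; first by rewrite !big_nil mulr1.
    rewrite !big_cons -IHs exprS hornerXsubC /= mulN1r.
    by rewrite mulNr mulrCA -mulNr opprB.
  over.
rewrite exchange_big /= -srs.
transitivity (\prod_(z <- rs) (lead_coef q * \prod_(mu <- mus) (z - mu))).
  rewrite big_split /= big_const_seq count_predT; congr (_ * _).
  by elim: (size rs) => //= k IH; rewrite exprS IH.
apply: eq_bigr => z _; rewrite hornerZ horner_prod; congr (_ * _).
by apply: eq_bigr => mu _; rewrite hornerXsubC.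
Qed.

(** By Gauss's lemma, a factor over $\mathbb Q$ of a monic integer polynomial can be
    rescaled to a monic integer polynomial; descend to a factor of least degree that
    vanishes at $\beta$. *)
Lemma monic_irreducible_factor (R : realType) (beta : R) :
  integralOver (intr : int -> R) beta ->
  exists p : {poly int}, [/\ p \is monic, irreducible_poly (map_poly (intr : int -> rat) p)
    & root (map_poly (intr : int -> R) p) beta].
Proof.
case=> p0 p0m p0r; move: {2}(size p0) (leqnn (size p0)) => n.
elim: n p0 p0m p0r => [|n IH] p pm pr.
  by rewrite leqn0 size_poly_eq0 => /eqP p0; move: pm; rewrite p0 monicE lead_coef0.
move=> sp.
have sp1 : (1 < size p)%N.
  rewrite ltn_neqAle size_poly_gt0 monic_neq0// andbT eq_sym.
  apply/negP => /size_poly1P [c c0 pc]; move: pr.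
  by rewrite pc map_polyC /= rootC intr_eq0; apply/negP.
have [irr|nirr] := pselect (irreducible_poly (map_poly (intr : int -> rat) p)).
  by exists p.
have [d [sd dp nd]] : exists d : {poly rat}, [/\ size d != 1%N,
    d %| map_poly (intr : int -> rat) p & ~~ (d %= map_poly (intr : int -> rat) p)].
  apply: contrapT => H; apply: nirr; split; first by rewrite size_rat_int_poly.
  by move=> d d1 dp; apply: contrapT => /negP nd; apply: H; exists d.
have [p1 [a a0 dE] [r pE]] := dvdpP_rat_int dp.
have lc : lead_coef p1 * lead_coef r = 1.
  by rewrite -lead_coefM -pE; apply/eqP.
have p10 : p1 != 0 by apply/eqP => h; move: lc; rewrite h lead_coef0 mul0r.
have r0 : r != 0 by apply/eqP => h; move: lc; rewrite h lead_coef0 mulr0.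
have szE : size p = (size p1 + size r).-1 by rewrite pE size_mul.
move: sd; rewrite dE size_scale// size_rat_int_poly => sd.
have s1 : (0 < size p1)%N by rewrite size_poly_gt0.
have s2 : (0 < size r)%N by rewrite size_poly_gt0.
have sr1 : size r != 1%N.
  apply/negP => /size_poly1P [c c0 rc]; move/negP: nd; apply.
  rewrite dE pE rc rmorphM /= map_polyC /= mulrC mul_polyC /eqp.
  by rewrite !(dvdpZl, dvdpZr) ?dvdpp ?intr_eq0.
have unitlc (x y : int) : x * y = 1 -> x * x = 1.
  move=> xy; have : absz (x * y) = 1%N by rewrite xy.
  rewrite abszM => /eqP; rewrite muln_eq1 => /andP[/eqP x1 _].
  by have [->|->] : x = 1 \/ x = -1 by lia.
have gt1 k : (0 < k)%N -> k != 1%N -> (1 < k)%N by case: k => [|[]].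
have [le1 le2] : (size p1 <= n)%N /\ (size r <= n)%N.
  move: sp (gt1 _ s1 sd) (gt1 _ s2 sr1); rewrite szE.
  by move: (size p1) (size r) => u v; lia.
have := pr; rewrite pE rmorphM rootM /= => /orP [] rt.
  apply: (IH (lead_coef p1 *: p1)).
  - by rewrite monicE lead_coefZ (unitlc _ _ lc).
  - by rewrite map_polyZ /= rootZ// intr_eq0 lead_coef_eq0.
  - by rewrite size_scale ?lead_coef_eq0.
apply: (IH (lead_coef r *: r)).
- by rewrite monicE lead_coefZ (unitlc _ (lead_coef p1)) 1?mulrC.
- by rewrite map_polyZ /= rootZ// intr_eq0 lead_coef_eq0.
- by rewrite size_scale ?lead_coef_eq0.
Qed.

(** * Conjugates of a Pisot number *)

Lemma irreducible_root_dvdp (F K : fieldType) (f : {rmorphism F -> K})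
    (p q : {poly F}) x :
  irreducible_poly p -> root (map_poly f p) x -> root (map_poly f q) x -> p %| q.
Proof.
move=> pirr px qx; have [cop|ncop] := boolP (coprimep p q).
  have [[u v] /= uv] := Bezout_eq1_coprimepP _ _ cop.
  have : (map_poly f (u * p + v * q)).[x] = 0.
    by rewrite rmorphD !rmorphM hornerD !hornerM /= (rootP px) (rootP qx) !mulr0 addr0.
  by rewrite uv rmorph1 hornerE => /eqP; rewrite oner_eq0.
have /andP[_] := pirr _ ncop (dvdp_gcdl p q).
by move=> pg; exact: dvdp_trans pg (dvdp_gcdr _ _).
Qed.

Lemma root_dvdp_map (F K : fieldType) (f : {rmorphism F -> K})
    (p q : {poly F}) x :
  p %| q -> root (map_poly f p) x -> root (map_poly f q) x.
Proof.
by move=> /dvdpP [r ->] pz; rewrite rmorphM /= rootM pz orbT.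
Qed.

(** A is the companion matrix of the minimal polynomial. Being integral, it makes the
    norms and traces of elements of $\mathbb Z[\beta]$ visibly integers. The minimal
    polynomial is separable, so that $\beta$ does not recur among its other roots rs,
    and irreducible, so that these satisfy the same integer relations as $\beta$. *)
Lemma pisot_conjugates (R : realType) (beta : R) : pisot beta ->
  exists n (A : 'M[int]_n.+1) (rs : seq R[i]),
  [/\ char_poly (map_mx intr A) = \prod_(z <- beta%:C%C :: rs) ('X - z%:P),
      {in rs, forall z, `|z| < 1}
    & forall q : {poly int}, {in rs, forall z : R[i], z != beta%:C%C /\
       (root (map_poly intr q) z -> root (map_poly (intr : int -> R) q) beta) /\
       (root (map_poly (intr : int -> R) q) beta -> root (map_poly intr q) z)}].
Proof.
case=> beta1 /monic_irreducible_factor [p [pm pirr pr]] conj.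
have ratE (q : {poly int}) : map_poly (intr : int -> R) q =
    map_poly (ratr : rat -> R) (map_poly intr q).
  by rewrite -map_poly_comp; apply: eq_map_poly => z /=; rewrite ratr_int.
have ratC (q : {poly int}) : map_poly (intr : int -> R[i]) q =
    map_poly (ratr : rat -> R[i]) (map_poly intr q).
  by rewrite -map_poly_comp; apply: eq_map_poly => z /=; rewrite ratr_int.
have RC (q : {poly int}) : map_poly (intr : int -> R[i]) q =
    map_poly (real_complex R) (map_poly intr q).
  by rewrite -map_poly_comp; apply: eq_map_poly => z /=; rewrite rmorph_int.
set P := map_poly (intr : int -> rat) p in pirr.
have sp : (1 < size p)%N by have [+ _] := pirr; rewrite size_rat_int_poly.
have [n [A pA]] : exists n (A : 'M[int]_n.+1), char_poly A = p.
  have := companionmxK pm; move: (companionmx p).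
  by case: (size p) sp => [|[|n]] //= _ A AE; exists n, A.
have [rs0 prs0] := closed_field_poly_normal (map_poly (intr : int -> R[i]) p).
have lc1 : lead_coef (map_poly (intr : int -> R[i]) p) = 1.
  by apply/monicP; rewrite monic_map.
rewrite lc1 scale1r in prs0.
have brs : beta%:C%C \in rs0.
  by rewrite -root_prod_XsubC -prs0 RC rmorph_root.
have pE := perm_to_rem brs.
set rs := rem _ rs0 in pE.
have prs : map_poly (intr : int -> R[i]) p = \prod_(z <- beta%:C%C :: rs) ('X - z%:P).
  by rewrite prs0; exact: perm_big.
have rootrs z : z \in rs -> root (map_poly ratr P) z.
  by move=> zrs; rewrite -ratC prs root_prod_XsubC inE zrs orbT.
have rootb : root (map_poly ratr P) beta by rewrite -ratE.
have nb z : z \in rs -> z != beta%:C%C.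
  move=> zrs; apply/negP => /eqP zb; rewrite zb in zrs.
  have : root (map_poly ratr P^`()) beta.
    have : root (map_poly (intr : int -> R[i]) p)^`() beta%:C%C.
      rewrite prs big_cons (perm_big _ (perm_to_rem zrs)) big_cons /=.
      rewrite mulrA derivM !derivM /root !hornerE subrr.
      by rewrite !(mul0r, mulr0, addr0).
    by rewrite !deriv_map -ratE RC fmorph_root.
  move=> /(irreducible_root_dvdp pirr rootb) /dvdp_leq.
  have P0 : P^`() != 0.
    apply/eqP => /(congr1 (fun q : {poly rat} => q`_(size P).-2)).
    rewrite coef_deriv coef0 size_rat_int_poly => /eqP.
    rewrite mulrn_eq0 /= prednK; last by case: (size p) sp => [|[]].
    have -> : P`_(size p).-1 = lead_coef P by rewrite /lead_coef size_rat_int_poly.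
    by rewrite lead_coef_eq0 -size_poly_eq0 size_rat_int_poly; case: (size p) sp.
  move=> /(_ P0); rewrite leqNgt lt_size_deriv// -size_poly_eq0.
  by rewrite size_rat_int_poly; case: (size p) sp.
exists n, A, rs; split.
- by rewrite -map_char_poly pA.
- move=> z zrs; apply: conj (nb _ zrs); exists P; split => //.
  + by rewrite monic_map.
  + exact: rootrs.
move=> q z zrs; split; [exact: nb|split] => rt.
  rewrite ratE; apply: root_dvdp_map rootb.
  by apply: irreducible_root_dvdp pirr (rootrs _ zrs) _; rewrite -ratC.
rewrite ratC; apply: root_dvdp_map (rootrs _ zrs).
by apply: irreducible_root_dvdp pirr rootb _; rewrite -ratE.
Qed.

(** * Garsia separation and powers of a Pisot number *)

Lemma geometric_sum_le (R : realFieldType) (r : R) n : 0 <= r < 1 ->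
  \sum_(i < n) r ^+ i <= (1 - r)^-1.
Proof.
move=> /andP[r0 r1]; rewrite -(ler_pM2l (_ : 0 < 1 - r)) ?subr_gt0//.
rewrite mulfV ?gt_eqF ?subr_gt0// -opprB mulNr -subrX1 opprB.
by rewrite lerBlDr lerDl exprn_ge0.
Qed.

Section Pisot_arithmetic.
Context (R : realType).

Let cabs (z : R[i]) : R := Num.sqrt (complex.Re z ^+ 2 + complex.Im z ^+ 2).

Let cabsE (z : R[i]) : `|z| = (cabs z)%:C%C.
Proof. by rewrite normc_def. Qed.

Let cabs_ge0 z : 0 <= cabs z. Proof. exact: sqrtr_ge0. Qed.

Let cabsR (x : R) : cabs x%:C%C = `|x|.
Proof. by rewrite /cabs /= expr0n /= addr0 sqrtr_sqr. Qed.

Let cabsM : {morph cabs : x y / x * y}.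
Proof. by move=> x y; apply: complexI; rewrite rmorphM /= -!cabsE normrM. Qed.

Let cabsX n : {morph cabs : x / x ^+ n}.
Proof. by move=> x; apply: complexI; rewrite rmorphXn /= -!cabsE normrX. Qed.

Let cabs_sum (I : Type) (s : seq I) (F : I -> R[i]) :
  cabs (\sum_(i <- s) F i) <= \sum_(i <- s) cabs (F i).
Proof.
rewrite -lecR -cabsE rmorph_sum /=; apply: le_trans (ler_norm_sum _ _ _) _.
by apply: ler_sum => i _; rewrite cabsE.
Qed.

Lemma bounded_away_from_1 (s : seq R[i]) : {in s, forall z, `|z| < 1} ->
  exists2 r : R, 0 <= r < 1 & {in s, forall z, cabs z <= r}.
Proof.
elim: s => [_|a s IH H]; first by exists 0; rewrite ?lexx ?ltr01.
have [z zs|r /andP[r0 r1] rP] := IH; first by apply: H; rewrite inE zs orbT.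
exists (Num.max (cabs a) r).
  rewrite le_max r0 orbT gt_max r1 andbT/= -ltcR -cabsE rmorph1.
  by apply: H; rewrite mem_head.
move=> z; rewrite inE le_max => /predU1P[->|/rP ->]; rewrite ?lexx ?orbT//.
Qed.

(** Garsia's separation lemma. The norm of $q(\beta)$ is a nonzero integer, and
    the factors other than $|q(\beta)|$ are bounded in terms of $m$ alone because
    the other conjugates lie inside the unit disc. *)
Lemma garsia_separation (beta : R) (m : nat) : pisot beta ->
  exists2 delta : R, 0 < delta & forall q : {poly int},
    (forall i, `|q`_i| <= m%:Z) -> (map_poly intr q).[beta] != 0 ->
    delta <= `|(map_poly intr q).[beta]|.
Proof.
move=> /pisot_conjugates [n [A [rs [cpA rs1 conj]]]].
have [r /andP[r0 r1] rP] := bounded_away_from_1 rs1.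
pose B : R := (1 + m%:R / (1 - r)).
have B0 : 0 < B by rewrite ltr_pwDl// divr_ge0// subr_ge0 ltW.
exists (B ^- size rs); first by rewrite invr_gt0 exprn_gt0.
move=> q qm qb.
have Bq z : z \in rs -> cabs (map_poly intr q).[z] <= B.
  move=> zrs; rewrite horner_coef; apply: le_trans (cabs_sum _ _) _.
  have -> : B = 1 + m%:R * (1 - r)^-1 by [].
  apply: (@le_trans _ _ (\sum_(i < size (map_poly (intr : int -> R[i]) q)) m%:R * r ^+ i)).
    apply: ler_sum => i _; rewrite cabsM cabsX coef_map /=.
    apply: ler_pM => //; first exact: exprn_ge0.
      rewrite -(rmorph_int (real_complex R)) cabsR -intr_norm.
      by rewrite (pmulrn 1) ler_int; exact: qm.
    by rewrite lerXn2r// ?nnegrE// rP.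
  rewrite -mulr_sumr; apply: (@le_trans _ _ (m%:R * (1 - r)^-1)); last by rewrite lerDr.
  by rewrite ler_wpM2l// geometric_sum_le// r0 r1.
have detE : (\det (horner_mx A q))%:~R = (map_poly intr q).[beta%:C%C] *
    \prod_(z <- rs) (map_poly intr q).[z] :> R[i].
  by rewrite -det_map_mx map_horner_mx (det_horner_mx _ cpA) big_cons.
have qbE : (map_poly intr q).[beta%:C%C] = ((map_poly intr q).[beta])%:C%C :> R[i].
  rewrite -horner_map -map_poly_comp; congr (_.[_]).
  by apply: eq_map_poly => z /=; rewrite rmorph_int.
have det1 : 1 <= `|\det (horner_mx A q)|.
  rewrite -gtz0_ge1 normr_gt0; apply/negP => /eqP d0; move: detE.
  rewrite d0 => /esym/eqP; rewrite mulf_eq0 qbE => /orP[/eqP/complexI|].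
    by apply/eqP.
  rewrite prodf_seq_eq0 => /hasP[z zrs /= qz]; move/negP : qb; apply.
  by have [_ [+ _]] := conj q z zrs; apply.
have : 1 <= `|(map_poly intr q).[beta]| * cabs (\prod_(z <- rs) (map_poly intr q).[z]).
  rewrite -cabsR -cabsM -qbE -detE -(rmorph_int (real_complex R)) cabsR -intr_norm.
  by rewrite -[leLHS]/(1%:~R) ler_int.
have : cabs (\prod_(z <- rs) (map_poly intr q).[z]) <= B ^+ size rs.
  elim: (rs) Bq => [_|z s IH H]; first by rewrite big_nil (cabsR 1) normr1.
  rewrite big_cons cabsM exprS ler_pM//; first by apply: H; rewrite mem_head.
  by apply: IH => y ys; apply: H; rewrite inE ys orbT.
move=> leB le1; rewrite -(ler_pM2r (_ : 0 < B ^+ size rs)) ?exprn_gt0//.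
rewrite mulVf ?gt_eqF ?exprn_gt0//; apply: le_trans le1 _.
by rewrite ler_wpM2l.
Qed.

(** The trace of $\beta^l$ is an integer, and differs from $\beta^l$ by the sum
    of the $l$-th powers of the other conjugates. *)
Lemma pisot_powers_near_integers (beta : R) : pisot beta ->
  exists D r : R, [/\ 0 <= D, 0 <= r < 1 &
    forall l, exists z : int, `|beta ^+ l - z%:~R| <= D * r ^+ l].
Proof.
move=> /pisot_conjugates [n [A [rs [cpA rs1 _]]]].
have [r r01 rP] := bounded_away_from_1 rs1.
exists (size rs)%:R, r; split => // l.
set AC := map_mx _ A in cpA.
exists (\tr (A ^+ l)).
(* Both sides agree at every natural number, by det_horner_mx. *)
have cpE : char_poly (AC ^+ l) =
    \prod_(z <- [seq z ^+ l | z <- beta%:C%C :: rs]) ('X - z%:P).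
  apply/eqP; rewrite -subr_eq0; apply/negPn/negP => nz.
  pose s : seq R[i] := [seq i%:R | i <- iota 0 (size (char_poly (AC ^+ l) -
    \prod_(z <- [seq z ^+ l | z <- beta%:C%C :: rs]) ('X - z%:P)))].
  suff sroot : all (root (char_poly (AC ^+ l) -
      \prod_(z <- [seq z ^+ l | z <- beta%:C%C :: rs]) ('X - z%:P))) s.
    have su : uniq s.
      by rewrite map_inj_uniq ?iota_uniq// => i j /eqP; rewrite eqr_nat => /eqP.
    by have := max_poly_roots nz sroot su; rewrite size_map size_iota ltnn.
  apply/allP => _ /mapP[i _ ->]; rewrite /root hornerD hornerN subr_eq0.
  rewrite horner_char_poly horner_prod big_map.
  have -> : i%:R%:M - AC ^+ l = horner_mx AC (i%:R%:P - 'X^l).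
    by rewrite rmorphB /= rmorphXn /= horner_mx_X horner_mx_C.
  rewrite (det_horner_mx _ cpA); apply/eqP; apply: eq_bigr => z _.
  by rewrite !hornerE.
have szrs : size rs = n.
  have := congr1 (fun p : {poly R[i]} => size p) cpA.
  by rewrite size_char_poly size_prod_XsubC => -[].
have trE : \tr (AC ^+ l) = beta%:C%C ^+ l + \sum_(z <- rs) z ^+ l.
  apply: oppr_inj; rewrite -char_poly_trace//= cpE.
  have <- : (size [seq z ^+ l | z <- beta%:C%C :: rs]).-1 = n by rewrite size_map /= szrs.
  by rewrite coefPn_prod_XsubC//= big_cons big_map.
rewrite -cabsR rmorphB rmorphXn /= rmorph_int.
have -> : (\tr (A ^+ l))%:~R = \tr (AC ^+ l).
  by rewrite -rmorphXn /= trace_map_mx.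
rewrite trE opprD addrA subrr add0r.
have -> : cabs (- \sum_(z <- rs) z ^+ l) = cabs (\sum_(z <- rs) z ^+ l).
  by apply: complexI; rewrite -!cabsE normrN.
apply: le_trans (cabs_sum _ _) _.
rewrite mulr_natl -[leRHS]iter_addr_0 -count_predT -big_const_seq /=.
rewrite !big_seq; apply: ler_sum => z zrs; rewrite cabsX.
by case/andP: r01 => r0 r1; rewrite lerXn2r ?nnegrE// rP.
Qed.

(** A conjugate of $\beta$ satisfies the same relation $b\beta^l = a$ over the
    integers; its modulus being smaller than 1 while $\beta > 1$, only $b = 0$
    is possible, unless $\beta$ has no conjugate. *)
Lemma pisot_power_irrational (beta : R) : pisot beta ->
  ~ (exists b : nat, beta = b%:R) ->
  forall l (a b : int), (0 < l)%N -> b != 0 -> b%:~R * beta ^+ l != a%:~R.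
Proof.
move=> pb nb l a b l0 b0; apply/negP => /eqP bE.
have [beta1 _ _] := pb.
have [n [A [rs [cpA rs1 conj]]]] := pisot_conjugates pb.
case: rs cpA rs1 conj => [|z rs] cpA rs1 conj.
  apply: nb; have := congr1 (fun p : {poly R[i]} => size p) cpA.
  rewrite size_char_poly size_prod_XsubC => -[n0]; subst n.
  have : (char_poly (map_mx intr A)).[beta%:C%C] = 0 :> R[i].
    by rewrite cpA big_seq1 !hornerE subrr.
  rewrite horner_char_poly det_mx11 !mxE mulr1n => /eqP.
  rewrite subr_eq0 -(rmorph_int (real_complex R)) => /eqP/complexI bA.
  exists (absz (A ord0 ord0)); rewrite bA pmulrn; congr (_%:~R).
  rewrite gez0_abs// -(ler_int R) -bA; exact: ltW (lt_trans ltr01 beta1).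
have := conj (b%:P * 'X^l - a%:P) z (mem_head _ _) => -[_ [_]].
rewrite !rmorphB !rmorphM /= !map_polyC /= !map_polyXn /root !hornerE.
rewrite bE subrr eqxx => /(_ erefl); rewrite subr_eq0 => /eqP zE.
have : `|b%:~R * z ^+ l| = (`|b%:~R * beta ^+ l|)%:C%C :> R[i].
  by rewrite zE bE -(rmorph_int (real_complex R)) cabsE cabsR.
rewrite normrM normrX -[b%:~R](rmorph_int (real_complex R)) !cabsE cabsR.
rewrite -rmorphXn -rmorphM /= => /complexI; rewrite normrM normrX.
have nb0 : `|b%:~R : R| != 0 by rewrite normr_eq0 intr_eq0.
move=> /(mulfI nb0) zb.
have : cabs z ^+ l < 1.
  rewrite exprn_ilt1 ?cabs_ge0 -?lt0n// -ltcR -cabsE.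
  exact: rs1 (mem_head _ _).
rewrite zb ltNge gtr0_norm ?(lt_trans ltr01)// => /negP; apply.
by rewrite exprn_ege1// ltW.
Qed.

End Pisot_arithmetic.

(** * Digit sums and prefixes of expansions *)

(** Two points of s in one interval $[a+i\delta,a+(i+1)\delta)$ would be too close. *)
Lemma separated_size_le (R : realType) (delta a b : R) (s : seq R) :
  0 < delta -> a <= b -> uniq s -> {in s, forall x, a <= x <= b} ->
  {in s &, forall x y, x != y -> delta <= `|x - y|} ->
  (size s)%:R <= (b - a) / delta + 1.
Proof.
move=> d0 ab us sab sd.
pose f x := Num.truncn ((x - a) / delta).
have fx x : x \in s -> (f x)%:R <= (x - a) / delta < (f x).+1%:R.
  by move=> /sab /andP[ax _]; rewrite truncn_itv// divr_ge0 ?subr_ge0// ltW.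
have finj : {in s &, injective f}.
  move=> x y xs ys fxy; apply/eqP/negP => /negP /(sd _ _ xs ys).
  have := fx _ xs; have := fx _ ys; rewrite fxy.
  rewrite !ler_pdivlMr// !ltr_pdivrMr// -!natr1 !mulrDl !mul1r.
  by move=> /andP[? ?] /andP[? ?]; apply/negP; rewrite -ltNge ltr_norml; lra.
have : (size [seq f x | x <- s] <= size (iota 0 (f b).+1))%N.
  apply: uniq_leq_size; first by rewrite map_inj_in_uniq.
  move=> _ /mapP[x xs ->]; rewrite mem_iota add0n ltnS /=.
  by have /andP[_ xb] := sab x xs; rewrite le_truncn// ler_pM2r ?invr_gt0// lerB.
rewrite size_map size_iota -(ler_nat R) => /le_trans; apply.
rewrite -natr1 lerD2r.
have ba : 0 <= (b - a) / delta by rewrite divr_ge0 ?subr_ge0// ltW.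
by have /andP[] := truncn_itv ba.
Qed.

(** The integer parts $\sum_{k=1}^n\varepsilon_k\beta^{n-k}$ of the $m^n$ words of
    length n. A list keeps their multiplicities, which are what matters. *)
Fixpoint digit_sums (R : realType) (beta : R) (m n : nat) : seq R :=
  if n is n'.+1 then
    [seq beta * s + i%:R | s <- digit_sums beta m n', i <- iota 0 m]
  else [:: 0].

Section digit_sums.
Context (R : realType) (beta : R) (m : nat).

Local Notation X := (digit_sums beta m).

Lemma size_digit_sums n : size (X n) = (m ^ n)%N.
Proof.
by elim: n => //= n IH; rewrite size_allpairs IH size_iota expnSr.
Qed.

Lemma digit_sumsD n k :
  X (n + k) = [seq beta ^+ k * s + t | s <- X n, t <- X k].
Proof.
elim: k => [|k IH].
  rewrite addn0 /=; elim: (X n) => //= s l <-.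
  by rewrite expr0 mul1r addr0.
rewrite addnS /= IH; elim: (X n) => //= s l IHl.
rewrite allpairs_cat IHl; congr (_ ++ _).
elim: (X k) => //= t l' IHl'.
rewrite map_cat -IHl'; congr (_ ++ _).
by rewrite -[RHS]map_comp; apply: eq_map => i /=; rewrite mulrDr mulrA exprS addrA.
Qed.

Lemma big_digit_sumsD (T : Type) (idx : T) (op : Monoid.law idx) n k (F : R -> T) :
  \big[op/idx]_(u <- X (n + k)) F u =
  \big[op/idx]_(s <- X n) \big[op/idx]_(t <- X k) F (beta ^+ k * s + t).
Proof. by rewrite digit_sumsD big_allpairs_dep. Qed.

Lemma mem_digit_sumsD n k s t :
  s \in X n -> t \in X k -> beta ^+ k * s + t \in X (n + k).
Proof.
move=> sX tX; rewrite digit_sumsD.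
exact: (allpairs_f (fun s t => beta ^+ k * s + t)).
Qed.

Lemma mem_digit_sums1 i : (i < m)%N -> i%:R \in X 1.
Proof.
move=> im; rewrite /= cats0; apply/mapP; exists i; first by rewrite mem_iota.
by rewrite mulr0 add0r.
Qed.

Lemma digit_sums_poly n s : s \in X n ->
  exists2 q : {poly int}, s = (map_poly intr q).[beta] &
    forall i, 0 <= q`_i <= m%:Z.
Proof.
elim: n s => [|n IH] s /=.
  rewrite inE => /eqP ->; exists 0; first by rewrite rmorph0 horner0.
  by move=> i; rewrite coef0.
move=> /allpairsP[[t i] /= [/IH [q -> qP]]]; rewrite mem_iota add0n => /= im ->.
exists (q * 'X + i%:Z%:P).
  by rewrite rmorphD rmorphM /= map_polyX map_polyC !hornerE mulrC pmulrn.
move=> [|j]; rewrite coefD coefMX coefC /= ?add0r ?addr0//.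
by rewrite lez_nat ltnW.
Qed.

Hypotheses (beta1 : 1 < beta) (betam : beta < m%:R).

Let beta0 : 0 < beta. Proof. exact: lt_trans beta1. Qed.

Definition I_len := (m%:R - 1) / (beta - 1).
Local Notation kap := I_len.

Lemma I_len_gt1 : 1 < kap.
Proof. by rewrite ltr_pdivlMr ?subr_gt0// mul1r ltrD2r. Qed.

Lemma I_len_gt0 : 0 < kap. Proof. exact: lt_trans I_len_gt1. Qed.

Lemma I_lenE : beta * kap = kap + (m%:R - 1).
Proof.
rewrite /kap; have : beta - 1 != 0 by rewrite gt_eqF// subr_gt0.
by move=> b; field.
Qed.

Definition inI (x : R) : bool := 0 <= x <= kap.

Lemma digit_sums_itv n s : s \in X n -> 0 <= s <= kap * (beta ^+ n - 1).
Proof.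
elim: n s => [|n IH] s /=; first by rewrite inE => /eqP ->; rewrite expr0 subrr mulr0 lexx.
move=> /allpairsP[[t i] /= [/IH /andP[t0 tk]]]; rewrite mem_iota add0n => /= im ->.
rewrite addr_ge0 ?mulr_ge0 ?(ltW beta0)//= exprS.
have -> : kap * (beta * beta ^+ n - 1) = beta * (kap * (beta ^+ n - 1)) + (m%:R - 1).
  by move: I_lenE => E; ring: E.
by rewrite lerD ?ler_pM2l// lerBrDr natr1 ler_nat.
Qed.

Lemma inI_digit x : inI x -> exists2 i, (i < m)%N & inI (beta * x - i%:R).
Proof.
move=> /andP[x0 xk].
have m0 : (0 < m)%N by rewrite -(ltr_nat R); apply: lt_trans betam.
have [lt|ge] := ltP (beta * x) (m%:R).
  have bx0 : 0 <= beta * x by rewrite mulr_ge0// ltW.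
  have /andP[l u] := truncn_itv bx0.
  exists (Num.truncn (beta * x)); first by rewrite -(ltr_nat R) (le_lt_trans l).
  rewrite /inI subr_ge0 l /= lerBlDr (le_trans (ltW u))// -natr1 addrC lerD2r.
  exact: ltW I_len_gt1.
exists m.-1; first by rewrite prednK.
have -> : m.-1%:R = m%:R - 1 :> R by rewrite -subn1 natrB.
rewrite /inI; apply/andP; split; first by lra.
by rewrite lerBlDr -I_lenE ler_pM2l.
Qed.

Lemma inI_of_digit x i : (i < m)%N -> inI (beta * x - i%:R) -> inI x.
Proof.
move=> im /andP[x0 xk]; apply/andP; split.
  by rewrite -(pmulr_rge0 _ beta0); apply: le_trans (_ : i%:R <= _) => //; lra.
rewrite -(ler_pM2l beta0) I_lenE; have : i%:R <= m%:R - 1 :> R; last by lra.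
by rewrite lerBrDr natr1 ler_nat.
Qed.

Lemma inI_digit_sums n x : inI x -> exists2 s, s \in X n & inI (beta ^+ n * x - s).
Proof.
move=> xI; elim: n => [|n [s sX sI]].
  by exists 0; rewrite ?inE// expr0 mul1r subr0.
have [i im iI] := inI_digit sI; exists (beta * s + i%:R).
  by apply: (allpairs_f (fun s i => beta * s + i%:R)); rewrite ?mem_iota.
by rewrite exprS -mulrA opprD addrA -mulrBr.
Qed.

Lemma inI_of_digit_sums n x s : s \in X n -> inI (beta ^+ n * x - s) -> inI x.
Proof.
elim: n s => [|n IH] s /=; first by rewrite inE => /eqP ->; rewrite expr0 mul1r subr0.
move=> /allpairsP[[t i] /= [tX]]; rewrite mem_iota add0n => /= im ->.
rewrite exprS -mulrA opprD addrA -mulrBr => /(inI_of_digit im); exact: IH.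
Qed.

(** Counts the words that begin an expansion of x: these are the words whose
    remainder $\beta^n x - s$ can be expanded further, that is, lies in $I_\beta$. *)
Definition prefixes n x := count (fun s => inI (beta ^+ n * x - s)) (X n).

Lemma prefixes_gt0 n x : inI x -> (0 < prefixes n x)%N.
Proof. by move=> /(inI_digit_sums n) [s sX sI]; rewrite -has_count; apply/hasP; exists s. Qed.

Lemma prefixesD n k x :
  prefixes (n + k) x = (\sum_(s <- X n) prefixes k (beta ^+ n * x - s))%N.
Proof.
rewrite /prefixes -sum1_count big_mkcond big_digit_sumsD.
apply: eq_bigr => s _; rewrite -sum1_count [RHS]big_mkcond.
apply: eq_bigr => t _; rewrite mulrBr exprD [beta ^+ n * _]mulrC.
by rewrite opprD addrA mulrA.
Qed.

Lemma prefixesS k x i : (i < m)%N ->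
  (prefixes k (beta * x - i%:R) <= prefixes k.+1 x)%N.
Proof.
move=> im; rewrite -add1n prefixesD (big_rem _ (mem_digit_sums1 im)) /= expr1.
exact: leq_addr.
Qed.

Lemma prefixesD_ge n k x s :
  (count_mem s (X n) * prefixes k (beta ^+ n * x - s) <= prefixes (n + k) x)%N.
Proof.
rewrite prefixesD (bigID (fun t => t == s)) /=.
apply: leq_trans (leq_addr _ _).
rewrite -big_filter (eq_big_seq (fun=> prefixes k (beta ^+ n * x - s))); last first.
  by move=> t; rewrite mem_filter => /andP[/eqP ->].
by rewrite big_const_seq count_predT iter_addn addn0 size_filter mulnC.
Qed.

Lemma leq_prefixes n k x : (n <= k)%N -> (prefixes n x <= prefixes k x)%N.
Proof.
move=> /subnKC <-; rewrite prefixesD /prefixes -sum1_count big_mkcond.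
apply: leq_sum => s _; case: ifP => // sI; exact: prefixes_gt0.
Qed.

End digit_sums.

(** * Consequences of separation *)

Lemma exists_seq_max (T : eqType) (f : T -> nat) (s : seq T) : s != [::] ->
  exists2 x, x \in s & {in s, forall y, (f y <= f x)%N}.
Proof.
elim: s => // a [|b s] IH _.
  by exists a; rewrite ?inE// => y; rewrite inE => /eqP ->.
have [//|x xs xmax] := IH.
have [ax|xa] := leqP (f a) (f x).
  exists x; first by rewrite inE xs orbT.
  by move=> y; rewrite inE => /predU1P[->//|/xmax].
exists a; first exact: mem_head.
by move=> y; rewrite inE => /predU1P[->//|/xmax /leq_trans]; apply; exact: ltnW.
Qed.

Lemma big_undup_count (R : nmodType) (T : eqType) (s : seq T) (P : pred T) (F : T -> R) :
  \sum_(x <- s | P x) F x = \sum_(x <- undup s | P x) F x *+ count_mem x s.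
Proof.
rewrite -big_undup_iterop_count; apply: eq_bigr => x _.
by rewrite Monoid.iteropE; elim: (count_mem x s) => // k IH; rewrite mulrS /= IH.
Qed.

Definition sums_separated (R : realType) (beta : R) (m : nat) (delta : R) :=
  forall n, {in digit_sums beta m n &, forall s t, s != t -> delta <= `|s - t|}.

Lemma pisot_separated (R : realType) (beta : R) (m : nat) : pisot beta ->
  exists2 delta : R, 0 < delta & sums_separated beta m delta.
Proof.
move=> /(garsia_separation m) [d d0 dP]; exists d => // n s t.
move=> /digit_sums_poly [p -> pP] /digit_sums_poly [q -> qP].
rewrite -subr_eq0 -hornerN -hornerD -rmorphB => pq; apply: dP => // i.
rewrite coefB ler_norml.
move: (pP i) (qP i); move: (p`_i) (q`_i) => a b /andP[a0 am] /andP[b0 bm].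
apply/andP; split; first by rewrite lerBrDr (le_trans _ a0)// addrC subr_le0.
by rewrite lerBlDr (le_trans am)// lerDl.
Qed.

Section separation.
Context (R : realType) (beta : R) (m : nat) (delta : R).
Hypotheses (beta1 : 1 < beta) (betam : beta < m%:R).
Hypotheses (delta0 : 0 < delta) (sep : sums_separated beta m delta).

Local Notation X := (digit_sums beta m).
Local Notation kap := (I_len beta m).
Local Notation inI := (inI beta m).
Local Notation prefixes := (prefixes beta m).


(** As many points with mutual distances at least delta as a translate of $I_\beta$
    can contain. *)
Definition remainder_bound : R := kap / delta + 1.

Lemma remainder_bound_ge1 : 1 <= remainder_bound.
Proof. by rewrite lerDr divr_ge0 ?ltW// I_len_gt0. Qed.

Lemma size_distinct_sums n : (size (undup (X n)))%:R <= remainder_bound * beta ^+ n.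
Proof.
have bn1 : 1 <= beta ^+ n by rewrite exprn_ege1// ltW.
have k0 := I_len_gt0 beta1 betam.
have r0 : 0 <= kap * (beta ^+ n - 1) by rewrite mulr_ge0 ?subr_ge0// ltW.
apply: le_trans (separated_size_le delta0 r0 (undup_uniq _) _ _) _.
- by move=> x; rewrite mem_undup => /(digit_sums_itv beta1).
- by move=> x y; rewrite !mem_undup => xX yX; exact: (sep xX yX).
rewrite subr0 /remainder_bound mulrDl mul1r lerD// [leRHS]mulrAC ler_pM2r ?invr_gt0//.
by rewrite ler_pM2l// gerBl.
Qed.

Lemma size_remainders n x :
  (size [seq s <- undup (X n) | inI (beta ^+ n * x - s)])%:R <= remainder_bound.
Proof.
have k0 := I_len_gt0 beta1 betam.
have -> : remainder_bound = (beta ^+ n * x - (beta ^+ n * x - kap)) / delta + 1.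
  by rewrite /remainder_bound; congr (_ / _ + _); lra.
apply: separated_size_le => //; first by lra.
- by rewrite filter_uniq// undup_uniq.
- by move=> s; rewrite mem_filter => /andP[/andP[? ?] _]; lra.
move=> s t; rewrite !mem_filter !mem_undup => /andP[_ sX] /andP[_ tX].
exact: (sep sX tX).
Qed.

(** The words counted by [prefixes] have boundedly many different integer parts, so
    that the most frequent one accounts for a fixed proportion of them. *)
Lemma exists_heavy_prefix n x : inI x ->
  exists s, [/\ s \in X n, inI (beta ^+ n * x - s) &
    (prefixes n x)%:R <= remainder_bound * (count_mem s (X n))%:R].
Proof.
move=> xI; pose l := [seq s <- undup (X n) | inI (beta ^+ n * x - s)].
have l0 : l != [::].
  have [s sX sI] := inI_digit_sums beta1 betam n xI.
  apply/eqP => /(congr1 (fun l => s \in l)).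
  by rewrite mem_filter /= sI mem_undup sX.
have [s sl smax] := exists_seq_max (fun s => count_mem s (X n)) l0.
exists s; move: (sl); rewrite mem_filter mem_undup => /andP[sI sX]; split=> //.
apply: le_trans (_ : (size l)%:R * (count_mem s (X n))%:R <= _); last first.
  by rewrite ler_wpM2r// size_remainders.
rewrite -natrM ler_nat /prefixes -sum1_count -big_undup_iterop_count /=.
rewrite (eq_bigr (fun t => count_mem t (X n))); last first.
  by move=> t _; rewrite Monoid.iteropE; elim: (count_mem _ _) => //= k ->.
rewrite -big_filter -/l big_seq.
apply: leq_trans (_ : \sum_(i <- l | i \in l) count_mem s (X n) <= _)%N.
  by apply: leq_sum => t tl; exact: smax.
by rewrite -big_seq big_const_seq count_predT iter_addn addn0 mulnC.
Qed.

End separation.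

(** * Lebesgue measure and remainders *)

Lemma exists_expr_gt (R : realType) (b M : R) : 1 < b -> exists n, M < b ^+ n.
Proof.
move=> b1; have bern n : 1 + n%:R * (b - 1) <= b ^+ n.
  elim: n => [|n IH]; first by rewrite mul0r addr0 expr0.
  rewrite exprS; apply: le_trans (_ : b * (1 + n%:R * (b - 1)) <= _); last first.
    by rewrite ler_wpM2l// ltW// (lt_trans ltr01).
  rewrite -natr1 -subr_ge0.
  have -> : b * (1 + n%:R * (b - 1)) - (1 + (n%:R + 1) * (b - 1)) =
    n%:R * (b - 1) ^+ 2 by ring.
  by rewrite mulr_ge0// sqr_ge0.
exists (Num.truncn (M / (b - 1))).+1; apply: lt_le_trans (bern _).
have b0 : 0 < b - 1 by rewrite subr_gt0.
apply: lt_trans (_ : (Num.truncn (M / (b - 1))).+1%:R * (b - 1) < _).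
  by rewrite -ltr_pdivrMr// truncnS_gt.
by rewrite ltrDr.
Qed.

Lemma measurable_affine_preimage (R : realType) (a b : R) (A : set R) :
  measurable A -> measurable [set x | A (a * x - b)].
Proof.
move=> mA; have mf : measurable_fun setT (fun x : R => a * x - b).
  by apply: measurable_funB => //; exact: measurable_funM.
by rewrite -[X in measurable X]setTI; exact: mf.
Qed.

Lemma lebesgue_measure_affine (R : realType) (a b : R) (A : set R) :
  0 < a -> measurable A ->
  lebesgue_measure [set x | A (a * x - b)] = ((a^-1)%:E * lebesgue_measure A)%E.
Proof.
move=> a0 mA; have mf : measurable_fun setT (fun x : R => a * x - b).
  by apply: measurable_funB => //; exact: measurable_funM.
pose f : measurableTypeR R -> measurableTypeR R := fun x => a * x - b.
pose f' : {mfun (measurableTypeR R) >-> (measurableTypeR R)} :=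
  HB.pack f (isMeasurableFun.Build _ _ _ _ f mf).
rewrite (@lebesgue_measure_unique R
    (mscale (NngNum (ltW a0)) (pushforward (@lebesgue_measure R) f')) _ _ mA).
  rewrite /mscale/= muleA -EFinM mulVf ?gt_eqF// mul1e.
  by [].
move=> _ [[c d] _ <-] /=; rewrite /mscale/= /pushforward.
have -> : f @^-1` `]c, d]%classic = `](c + b) / a, (d + b) / a]%classic.
  apply/seteqP; split=> x /=; rewrite /f !in_itv/= ltr_pdivrMr// ler_pdivlMr//.
    by rewrite ltrBrDr lerBlDr mulrC.
  by rewrite ltrBrDr lerBlDr mulrC.
rewrite !lebesgue_measure_itv/= !lte_fin ltr_pM2r ?invr_gt0// ltrD2r.
case: ifPn => _; last by rewrite mule0.
by rewrite -!EFinB -EFinM; congr (_%:E); field; rewrite gt_eqF.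
Qed.

Section preimages.
Context (R : realType) (beta : R) (m : nat) (delta : R).
Hypotheses (beta1 : 1 < beta) (betam : beta < m%:R).
Hypotheses (delta0 : 0 < delta) (sep : sums_separated beta m delta).

Local Notation X := (digit_sums beta m).
Local Notation kap := (I_len beta m).
Local Notation inI := (inI beta m).
Local Notation leb := (@lebesgue_measure R).
Local Notation C := (remainder_bound beta m delta).

Let beta0 : 0 < beta. Proof. exact: lt_trans beta1. Qed.
Let betan0 n : 0 < beta ^+ n. Proof. exact: exprn_gt0. Qed.
Let kap0 : 0 < kap := I_len_gt0 beta1 betam.

Definition Iset : set R := [set x | inI x].

Lemma IsetE : Iset = `[0, kap]%classic.
Proof. by apply/seteqP; split => x; rewrite /Iset/= in_itv. Qed.

Lemma measurable_Iset : measurable Iset.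
Proof. by rewrite IsetE; exact: measurable_itv. Qed.

Lemma leb_Iset : leb Iset = kap%:E.
Proof. by rewrite IsetE lebesgue_measure_itv/= lte_fin kap0 -EFinB subr0. Qed.

Definition hits n (B : set R) : set R :=
  [set x | exists2 s, s \in X n & B (beta ^+ n * x - s)].

Lemma hitsE n B : hits n B =
  \big[setU/set0]_(s <- undup (X n)) [set x | B (beta ^+ n * x - s)].
Proof.
rewrite -bigcup_seq; apply/seteqP; split=> x [s /= sX Bs].
  by exists s => //=; rewrite mem_undup.
by exists s => //; rewrite mem_undup in sX.
Qed.

Lemma measurable_hits n B : measurable B -> measurable (hits n B).
Proof.
move=> mB; rewrite hitsE; apply: bigsetU_measurable => s _.
exact: measurable_affine_preimage.
Qed.

(** Quasi-invariance of Lebesgue measure: there are at most $C\beta^n$ distinct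
    remainders at level n, each of which expands lengths by $\beta^n$. *)
Lemma leb_hits n B : measurable B -> (leb (hits n B) <= C%:E * leb B)%E.
Proof.
move=> mB; rewrite hitsE.
apply: (@le_trans _ _ (((size (undup (X n)))%:R * (beta ^+ n)^-1)%:E * leb B)%E); last first.
  rewrite lee_wpmul2r// lee_fin ler_pdivrMr//.
  exact: size_distinct_sums.
elim: (undup _) => [|s l IH].
  by rewrite big_nil measure0 mule_ge0// lee_fin mulr_ge0// invr_ge0 ltW.
rewrite big_cons; apply: le_trans (measureU2 _ _ _) _.
- exact: measurable_affine_preimage.
- by apply: bigsetU_measurable => t _; exact: measurable_affine_preimage.
rewrite /= (lebesgue_measure_affine s (betan0 n) mB) -natr1 mulrDl mul1r addeC.
rewrite EFinD ge0_muleDl ?lee_fin.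
- by rewrite leeD2r.
- by rewrite mulr_ge0// invr_ge0 ltW.
- by rewrite invr_ge0 ltW.
Qed.

(** A set closed under the inverse branches $x\mapsto(x+i)/\beta$ contains a copy
    of itself of proportional measure near every point of $I_\beta$ and at every
    scale, so that its complement has no density points. *)
Lemma zero_one_law (E : set R) : measurable E -> E `<=` Iset ->
  (forall x i, (i < m)%N -> E (beta * x - i%:R) -> E x) ->
  leb E != 0%E -> leb (Iset `\` E) = 0%E.
Proof.
move=> mE EI clE E0; set F := _ `\` _.
have mF : measurable F by apply: measurableD => //; exact: measurable_Iset.
have clEn n x s : s \in X n -> E (beta ^+ n * x - s) -> E x.
  elim: n s => [|n IH] s /=; first by rewrite inE => /eqP ->; rewrite expr0 mul1r subr0.
  move=> /allpairsP[[t i] /= [tX]]; rewrite mem_iota add0n => /= im ->.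
  by rewrite exprS -mulrA opprD addrA -mulrBr => /(clE _ _ im); exact: IH.
have Efin : leb E \is a fin_num.
  rewrite ge0_fin_numE//; apply: le_lt_trans (_ : leb Iset < +oo)%E.
    by rewrite le_measure// inE//; exact: measurable_Iset.
  by rewrite leb_Iset ltry.
pose e := fine (leb E).
have eE : leb E = e%:E by rewrite fineK.
have e0 : 0 < e by rewrite -lte_fin -eE lt0e E0 measure_ge0.
pose r n : R := 2 * kap * beta ^- n.
have r0 n : 0 < r n by rewrite /r; apply: mulr_gt0; [exact: mulr_gt0|rewrite invr_gt0].
have lebF n x : F x -> (leb (F `&` ball x (r n)) <= (2 * r n - beta ^- n * e)%:E)%E.
  move=> [xI nEx].
  have [s sX sI] := inI_digit_sums beta1 betam n xI.
  pose E' := [set y | E (beta ^+ n * y - s)].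
  have mE' : measurable E' by exact: measurable_affine_preimage.
  have E'E : E' `<=` E by move=> y; exact: clEn.
  have E'b : E' `<=` ball x (r n).
    move=> y /EI /andP[y0 yk]; case/andP : sI => x0 xk.
    rewrite -ball_normE /ball_/= -(ltr_pM2l (betan0 n)).
    rewrite -[X in X * `|_|]gtr0_norm// -normrM mulrBr.
    have -> : beta ^+ n * r n = 2 * kap by rewrite /r mulrC mulfVK// gt_eqF.
    by rewrite ltr_norml; apply/andP; split; move: kap0 x0 xk y0 yk; lra.
  have := @measureU _ _ _ leb (F `&` ball x (r n)) E'.
  have mFb : measurable (F `&` ball x (r n)) by apply: measurableI => //; exact: measurable_ball.
  move=> /(_ mFb mE') mU.
  have {mU} : (leb ((F `&` ball x (r n)) `|` E') =
     leb (F `&` ball x (r n)) + leb E')%E.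
    by apply: mU; apply/seteqP; split => y //= [[[_ nE] _] /E'E].
  rewrite (lebesgue_measure_affine s (betan0 n) mE) eE -EFinM => mU.
  rewrite EFinB leeBrDr// -mU; apply: le_trans (_ : leb (ball x (r n)) <= _)%E.
    rewrite le_measure ?inE//; [exact: measurableU|exact: measurable_ball|].
    by move=> y [[]//|/E'b].
  rewrite lebesgue_measure_ball; last exact: ltW (r0 n).
  by rewrite mulr_natl.
have [N [mN N0 HN]] := lebesgue_density mF.
apply/eqP; rewrite eq_le measure_ge0 andbT -N0 le_measure ?inE//.
move=> x Fx; apply: HN => /=; rewrite indicE mem_set// => H.
have ru : (forall n, 0 < r n) /\ r n @[n --> \oo] --> (0 : R).
  split=> //; rewrite /r -(mulr0 (2 * kap)); apply: cvgMr.
  have : `|beta^-1| < 1 by rewrite gtr0_norm ?invr_gt0// invf_lt1.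
  move=> /(cvg_geometric 1); apply: cvg_trans; apply: near_eq_cvg.
  by apply: nearW => n; rewrite /geometric/= mul1r exprVn.
have cv := proj1 (cvge_at_rightP _ _ _) H r ru.
have c1 : ((1 : R)%:E <= (1 - e / (4 * kap))%:E)%E.
  rewrite -(cvg_lim _ cv)//; apply: lime_le; first by apply/cvg_ex; exists (1 : R)%:E.
  apply: nearW => n; have := lebF n x Fx.
  rewrite lebesgue_measure_ball; last exact: ltW (r0 n).
  rewrite inver mulrn_eq0 /= gt_eqF// => le.
  apply: le_trans (_ : (2 * r n - beta ^- n * e)%:E * ((r n *+ 2)^-1)%:E <= _)%E.
    by rewrite lee_wpmul2r// lee_fin invr_ge0 mulrn_wge0// ltW.
  rewrite -EFinM lee_fin -(mulr_natl (r n) 2) mulrBl mulfV; last by rewrite gt_eqF// mulr_gt0.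
  rewrite lerB// /r; have bn : beta ^- n != 0 by rewrite invr_eq0 gt_eqF.
  rewrite le_eqVlt; apply/orP; left; apply/eqP; field.
  by rewrite gt_eqF//= gt_eqF.
move: c1; rewrite lee_fin leNgt => /negP; apply.
by rewrite ltrBlDr ltrDl divr_gt0// mulr_gt0.
Qed.

End preimages.

(** * A superadditive ergodic theorem *)

Lemma measurable_ge_set (R : realType) (f : R -> R) (a : R) :
  measurable_fun setT f -> measurable [set x | a <= f x].
Proof.
move=> mf; rewrite (_ : [set x | _] = f @^-1` `[a, +oo[%classic).
  by rewrite -[X in measurable X]setTI; exact: mf.
by apply/seteqP; split=> x /=; rewrite in_itv/= andbT.
Qed.

Lemma indic_le (R : realType) (T U : Type) (A : set T) (B : set U) x y :
  (A x -> B y) -> (\1_A x : R) <= \1_B y.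
Proof.
move=> AB; rewrite !indicE ler_nat.
by case: (boolP (x \in A)) => // /set_mem /AB /mem_set ->.
Qed.

Definition null (R : realType) (A : set R) : Prop :=
  (@lebesgue_measure R).-negligible (A : set (measurableTypeR R)).

Section null_sets.
Context (R : realType).
Implicit Types A B : set R.

Lemma null_sub A B : A `<=` B -> null B -> null A.
Proof. by move=> AB; exact: (@negligibleS _ (measurableTypeR R) R lebesgue_measure B A AB). Qed.

Lemma nullP A : measurable A -> null A <-> @lebesgue_measure R A = 0%E.
Proof. exact: (@negligibleP _ (measurableTypeR R) R lebesgue_measure A). Qed.

Lemma nullU A B : null A -> null B -> null (A `|` B).
Proof. exact: (@negligibleU _ (measurableTypeR R) R lebesgue_measure A B). Qed.

Lemma null_bigcup (F : nat -> set R) : (forall n, null (F n)) -> null (\bigcup_n F n).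
Proof. exact: (@negligible_bigcup _ (measurableTypeR R) R lebesgue_measure F). Qed.

End null_sets.

Section processes.
Context (R : realType) (beta : R) (m : nat) (delta : R).
Hypotheses (beta1 : 1 < beta) (betam : beta < m%:R).
Hypotheses (delta0 : 0 < delta) (sep : sums_separated beta m delta).

Local Notation X := (digit_sums beta m).
Local Notation kap := (I_len beta m).
Local Notation inI := (inI beta m).
Local Notation Iset := (Iset beta m).
Local Notation hits := (hits beta m).
Local Notation leb := (@lebesgue_measure R).
Local Notation C := (remainder_bound beta m delta).

Let beta0 : 0 < beta. Proof. exact: lt_trans beta1. Qed.
Let kap0 : 0 < kap := I_len_gt0 beta1 betam.
Let mI := measurable_Iset beta m.

Definition visits (B : set R) N x : R := \sum_(n < N) \1_(hits n B) x.

Lemma visits_ge0 B N x : 0 <= visits B N x.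
Proof. by apply: sumr_ge0. Qed.

Lemma hitsD B n k x s : s \in X n -> hits k B (beta ^+ n * x - s) -> hits (n + k) B x.
Proof.
move=> sX [t tX Bt]; exists (beta ^+ k * s + t); first exact: mem_digit_sumsD.
by move: Bt; rewrite mulrBr mulrA -exprD opprD addrA addnC.
Qed.

Lemma visitsD B n k x s : s \in X n ->
  visits B n x + visits B k (beta ^+ n * x - s) <= visits B (n + k) x.
Proof.
move=> sX; rewrite /visits big_split_ord /= lerD2l; apply: ler_sum => j _.
by apply: indic_le; exact: hitsD.
Qed.

(** The features shared by the number of visits to a set and by the logarithm of the
    number of prefixes. A point has many remainders, and superadditivity can only be
    asked along one of them, up to the constant c. The third clause transports growth
    to the preimages $(x+i)/\beta$, as the zero-one law requires. *)
Definition superadditive (c : R) (W : nat -> R -> R) := [/\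
  forall n x, inI x -> 0 <= W n x,
  forall n x, inI x -> exists s, [/\ s \in X n, inI (beta ^+ n * x - s) &
    forall k, W n x + W k (beta ^+ n * x - s) - c <= W (n + k)%N x],
  forall k x i, (i < m)%N -> inI (beta * x - i%:R) ->
    W k (beta * x - i%:R) <= W k.+1 x
  & forall k, measurable_fun setT (W k)].

Lemma superadditive_visits (B : set R) : measurable B ->
  superadditive 0 (visits B).
Proof.
move=> mB; split.
- by move=> n x _; exact: visits_ge0.
- move=> n x /(inI_digit_sums beta1 betam n) [s sX sI]; exists s; split=> // k.
  by rewrite subr0; exact: visitsD.
- move=> k x i im yI; rewrite -add1n; apply: le_trans (visitsD _ _ _ (mem_digit_sums1 _ im)).
  by rewrite expr1 lerDr visits_ge0.
- move=> k; apply: measurable_sum => n; apply: measurable_indic.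
  exact: measurable_hits.
Qed.

(** Greedy concatenation of blocks. From a point y outside B follow the remainder
    reached after the block on which W grows at rate t; from a point of B discard
    one digit. The number of discarded digits is at most the number of visits to
    B, and a last incomplete block costs at most K. *)
Lemma superadditive_growth c W (B : set R) t K : superadditive c W -> 0 <= t ->
  (forall y, inI y -> ~ B y -> exists k, [/\ (0 < k)%N, (k <= K)%N &
     t * k%:R + c <= W k y]) ->
  forall N x, inI x -> t * (N%:R - K%:R - visits B N x) <= W N x.
Proof.
move=> [W0 Wsup Wmono _] t0 HB N.
elim/ltn_ind: N => N IH x xI.
have [NK|KN] := leqP N K.
  apply: le_trans (W0 N x xI); rewrite mulr_ge0_le0// lerBlDr add0r.
  by rewrite (le_trans _ (visits_ge0 _ _ _))// subr_le0 ler_nat.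
have [xB|xB] := pselect (B x).
  case: N KN IH => // N KN IH.
  have [i im yI] := inI_digit beta1 betam xI.
  apply: le_trans (Wmono _ _ _ im yI); apply: le_trans (IH N _ _ yI) => //.
  rewrite ler_wpM2l// -natr1.
  have : 1 + visits B N (beta * x - i%:R) <= visits B N.+1 x.
    rewrite -add1n -[beta * x](congr1 (fun z => z * x) (expr1 beta)).
    apply: le_trans (visitsD _ _ _ (mem_digit_sums1 _ im)).
    rewrite lerD2r /visits big_ord1 indicE mem_set//.
    by exists 0; rewrite /= ?inE// expr0 mul1r subr0.
  by lra.
have [k [k0 kK Wk]] := HB x xI xB.
have [s [sX sI Ws]] := Wsup k x xI.
have kN : (k <= N)%N by apply: leq_trans kK (ltnW KN).
have := Ws (N - k)%N; rewrite subnKC// => Ws'.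
have := IH (N - k)%N (_ : (N - k < N)%N) _ sI; rewrite natrB// => IH'.
have {IH'} : t * (N%:R - k%:R - K%:R - visits B (N - k) (beta ^+ k * x - s)) <=
    W (N - k)%N (beta ^+ k * x - s).
  by apply: IH'; rewrite ltn_subLR// addnC -[ltnLHS]addn0 ltn_add2l.
have : t * (N%:R - k%:R - K%:R - visits B N x) <=
    t * (N%:R - k%:R - K%:R - visits B (N - k) (beta ^+ k * x - s)).
  rewrite ler_wpM2l// lerB// -[in leRHS](subnKC kN).
  by apply: le_trans (visitsD _ _ _ sX); rewrite lerDr visits_ge0.
by move: Wk Ws'; rewrite !mulrBr; lra.
Qed.

(** The bounded error a makes this set stable under the inverse branches
    $x\mapsto(x+i)/\beta$, so that the zero-one law applies to it. *)
Definition exceeds (t : R) (W : nat -> R -> R) : set R :=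
  [set x | inI x /\ exists a : nat, forall n, exists2 k, (n <= k)%N & t * k%:R <= W k x + a%:R].

Lemma measurable_exceeds t (W : nat -> R -> R) : (forall k, measurable_fun setT (W k)) ->
  measurable (exceeds t W).
Proof.
move=> mW; rewrite (_ : exceeds t W = Iset `&` \bigcup_a \bigcap_n
    \bigcup_(k in [set k | (n <= k)%N]) [set x | t * k%:R - a%:R <= W k x]).
  apply: measurableI => //; apply: bigcupT_measurable => a.
  apply: bigcapT_measurable => n; apply: bigcup_measurable => k _.
  exact: measurable_ge_set.
apply/seteqP; split=> x [xI].
  move=> [a H]; split=> //; exists a => // n _; have [k nk Hk] := H n.
  by exists k => //=; rewrite lerBlDr.
move=> [a _ H]; split=> //; exists a => n; have [k /= nk Hk] := H n Logic.I.
by exists k => //; rewrite -lerBlDr.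
Qed.

Lemma exceeds_full c t W : superadditive c W -> 0 <= t ->
  leb (exceeds t W) != 0%E -> leb (Iset `\` exceeds t W) = 0%E.
Proof.
move=> [W0 Wsup Wmono mW] t0; apply: (zero_one_law beta1 betam).
- exact: measurable_exceeds.
- by move=> x [].
move=> x i im [yI [a Ha]]; split; first exact: inI_of_digit yI.
exists (a + (Num.truncn t).+1)%N => n; have [k nk Hk] := Ha n.
exists k.+1; first by rewrite ltnW.
have := Wmono k x i im yI; have := truncnS_gt t.
by rewrite natrD -[k.+1%:R]natr1 mulrDr mulr1; lra.
Qed.

Definition slow (t c : R) (W : nat -> R -> R) K : set R :=
  [set y | inI y /\ forall k, (0 < k <= K)%N -> W k y < t * k%:R + c].

Lemma measurable_slow t c (W : nat -> R -> R) K : (forall k, measurable_fun setT (W k)) ->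
  measurable (slow t c W K).
Proof.
move=> mW; rewrite (_ : slow t c W K = Iset `&`
    \bigcap_k (if (0 < k <= K)%N then ~` [set x | t * k%:R + c <= W k x] else setT)).
  apply: measurableI => //; apply: bigcapT_measurable => k; case: ifP => // _.
  by apply: measurableC; exact: measurable_ge_set.
apply/seteqP; split=> x [xI H]; split=> // k.
  by move=> _; case: ifP => // /H; rewrite ltNge => /negP.
by move=> kK; have := H k Logic.I; rewrite kK /= => /negP; rewrite -ltNge.
Qed.

(** Slow points of every K are slow forever, hence lie in the null set N; continuity of
    measure along the decreasing sets of points slow up to K does the rest. *)
Lemma leb_slow t c (W : nat -> R -> R) (N : set R) eps : (forall k, measurable_fun setT (W k)) ->
  measurable N -> leb N = 0%E ->
  (forall y, inI y -> (forall k, (0 < k)%N -> W k y < t * k%:R + c) -> N y) ->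
  0 < eps -> exists2 K, (0 < K)%N & (leb (slow t c W K) < eps%:E)%E.
Proof.
move=> mW mN N0 slowN eps0.
have mS K := measurable_slow t c K mW.
have cv : leb (slow t c W K) @[K --> \oo] --> leb (\bigcap_K slow t c W K).
  apply: nonincreasing_cvg_mu => //.
  - apply: le_lt_trans (_ : leb Iset < +oo)%E; last by rewrite (leb_Iset beta1 betam) ltry.
    by rewrite le_measure ?inE//; [exact: mS|move=> x []].
  - exact: bigcapT_measurable.
  - move=> K L KL; apply/subsetPset => x [xI H]; split=> // k /andP[k0 kK].
    by apply: H; rewrite k0 (leq_trans kK).
have S0 : leb (\bigcap_K slow t c W K) = 0%E.
  apply/eqP; rewrite eq_le measure_ge0 andbT -N0 le_measure ?inE//.
    exact: bigcapT_measurable.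
  move=> x H; apply: slowN => [|k k0]; first by have [] := H 0%N Logic.I.
  by have [_] := H k Logic.I; apply; rewrite k0 leqnn.
rewrite S0 in cv.
have /cv [K0 _ HK] : nbhs (0%E : \bar R) [set y | (y < eps%:E)%E].
  exact: open_ereal_lt'.
exists K0.+1 => //; apply: HK => /=; exact: leqnSn.
Qed.

Lemma integral_visits (B : set R) N : measurable B -> B `<=` Iset ->
  (\int[leb]_(x in Iset) (visits B N x)%:E <= N%:R%:E * (C%:E * leb B))%E.
Proof.
move=> mB BI; under eq_integral do rewrite /visits -sumEFin.
rewrite ge0_integral_sum//=.
- apply: (@le_trans _ _ (\sum_(n < N) (C%:E * leb B))%E).
    apply: lee_sum => n _; rewrite integral_indic//; last exact: measurable_hits.
    apply: le_trans (leb_hits beta1 betam delta0 sep n mB).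
    rewrite le_measure ?inE//; [|exact: measurable_hits].
    by apply: measurableI => //; exact: measurable_hits.
  by rewrite sumr_const card_ord mule_natl.
- by move=> n; apply/measurable_EFinP/measurable_indic; exact: measurable_hits.
Qed.

Lemma fin_num_leb_sub (B : set R) : measurable B -> B `<=` Iset ->
  leb B \is a fin_num.
Proof.
move=> mB BI; rewrite ge0_fin_numE//; apply: le_lt_trans (_ : leb Iset < +oo)%E.
  by rewrite le_measure ?inE.
by rewrite (leb_Iset beta1 betam) ltry.
Qed.

Lemma exceeds_slow c t t' W y : superadditive c W -> 0 <= t' < t -> inI y ->
  (forall k, (0 < k)%N -> W k y < t' * k%:R + c) -> (Iset `\` exceeds t W) y.
Proof.
move=> Wp /andP[t'0 tt'] yI slowy; split=> // -[_ [a /(_ (Num.truncn ((a%:R + c) / (t - t'))).+1)]].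
move=> [k ka]; apply/negP; rewrite -ltNge.
have k0 : (0 < k)%N by apply: leq_trans ka.
have : (a%:R + c) / (t - t') < k%:R.
  by apply: lt_le_trans (truncnS_gt _) _; rewrite ler_nat.
rewrite ltr_pdivrMr ?subr_gt0// mulrBr => H.
by have := slowy k k0; lra.
Qed.

(** The frequency of visits to B is bounded by its expectation: if visits had
    frequency t on a non-null set, they would by the zero-one law have frequency
    nearly t along blocks starting almost anywhere, hence also on average. *)
Lemma exceeds_visits_null (B : set R) t : measurable B -> B `<=` Iset -> 0 < t ->
  (C%:E * leb B < (t * kap)%:E)%E -> leb (exceeds t (visits B)) = 0%E.
Proof.
move=> mB BI t0 Bt; apply: contrapT => /eqP En0.
have Wp := superadditive_visits mB; have [_ _ _ mW] := Wp.
have Bfin := fin_num_leb_sub mB BI.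
have C0 : 0 < C by apply: lt_le_trans (remainder_bound_ge1 beta1 betam delta0).
pose b := fine (leb B); have bE : leb B = b%:E by rewrite fineK.
have b0 : 0 <= b by rewrite -lee_fin -bE.
move: Bt; rewrite bE -EFinM lte_fin -ltr_pdivrMr// => Bt.
have [t1 [bt1 t1t]] : exists t1, C * b / kap < t1 /\ t1 < t.
  by exists ((C * b / kap + t) / 2); split; lra.
have Cb0 : 0 <= C * b / kap by rewrite !mulr_ge0// ?invr_ge0 ltW.
have t10 : 0 < t1 by exact: le_lt_trans bt1.
pose g := (t1 * kap - C * b) / 2.
have g0 : 0 < g by rewrite /g; move: bt1; rewrite ltr_pdivrMr//; lra.
have E0 := exceeds_full Wp (ltW t0) En0.
have [||||K K0 HK] := @leb_slow t1 0 (visits B) (Iset `\` exceeds t (visits B)) (g / (t1 * C)) mW.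
- by apply: measurableD => //; exact: measurable_exceeds.
- exact: E0.
- by move=> y yI; apply: exceeds_slow Wp _ yI; rewrite (ltW t10).
- by rewrite divr_gt0// mulr_gt0.
set B' := slow _ _ _ _ in HK.
have mB' : measurable B' by exact: measurable_slow.
have B'I : B' `<=` Iset by move=> x [].
have B'fin := fin_num_leb_sub mB' B'I.
pose b' := fine (leb B'); have b'E : leb B' = b'%:E by rewrite fineK.
move: HK; rewrite b'E lte_fin ltr_pdivlMr ?mulr_gt0// => HK.
have grow := superadditive_growth (B := B') (K := K) Wp (ltW t10) _.
have {}grow N x : inI x -> t1 * (N%:R - K%:R - visits B' N x) <= visits B N x.
  apply: grow => y yI nB'; apply: contrapT => H; apply: nB'; split=> // k /andP[k0 kK].
  by rewrite ltNge; apply/negP => Wk; apply: H; exists k.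
have key N : (K <= N)%N -> t1 * (N%:R - K%:R) * kap <= N%:R * (C * b) + t1 * (N%:R * (C * b')).
  move=> KN; have NK : 0 <= t1 * (N%:R - K%:R) by rewrite mulr_ge0 ?(ltW t10)// subr_ge0 ler_nat.
  have mV D : measurable D -> measurable_fun Iset (EFin \o visits D N).
    move=> mD; apply/measurable_EFinP; apply: measurable_funS (_ : measurable_fun setT _) => //.
    by have [_ _ _] := superadditive_visits mD.
  have : (\int[leb]_(x in Iset) (cst (t1 * (N%:R - K%:R))%:E) x <=
      \int[leb]_(x in Iset) ((visits B N x)%:E + t1%:E * (visits B' N x)%:E))%E.
    apply: ge0_le_integral => //.
    - by apply: emeasurable_funD; [exact: mV|apply: measurable_funeM; exact: mV].
    - move=> x xI; rewrite -EFinM -EFinD lee_fin.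
      by have := grow N x xI; rewrite mulrBr; lra.
  rewrite integral_cst//= (leb_Iset beta1 betam) ge0_integralD//=; last 4 first.
  - by move=> x _; rewrite lee_fin visits_ge0.
  - exact: mV.
  - by move=> x _; rewrite -EFinM lee_fin mulr_ge0 ?visits_ge0// ltW.
  - by apply: measurable_funeM; exact: mV.
  rewrite ge0_integralZl//=; last 3 first.
  - exact: mV.
  - by move=> x _; rewrite lee_fin visits_ge0.
  - by rewrite lee_fin ltW.
  move=> /le_trans H; rewrite -lee_fin EFinM; apply: H.
  rewrite EFinD !EFinM -bE -b'E; apply: leeD; first exact: integral_visits.
  by rewrite lee_wpmul2l ?lee_fin ?(ltW t10)//; exact: integral_visits.
pose N := (K + Num.truncn (t1 * K%:R * kap / g)).+1.
have KN : (K <= N)%N by rewrite ltnW// ltnS leq_addr.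
have keyN := key N KN; have : t1 * K%:R * kap / g < N%:R.
  by apply: lt_le_trans (truncnS_gt _) _; rewrite ler_nat ltnS leq_addl.
rewrite ltr_pdivrMr// => Ng.
have : N%:R * (b' * (t1 * C)) <= N%:R * g by rewrite ler_wpM2l// ltW.
move: keyN Ng; rewrite /g; lra.
Qed.

(** Blocks of W can be concatenated off a set B of small measure, which is visited
    with frequency less than t2 from almost every point. *)
Lemma superadditive_eventual_growth c W (B : set R) t1 t2 K :
  superadditive c W -> 0 <= t1 -> measurable B -> B `<=` Iset -> 0 < t2 ->
  (C%:E * leb B < (t2 * kap)%:E)%E ->
  (forall y, inI y -> ~ B y -> exists k, [/\ (0 < k)%N, (k <= K)%N &
     t1 * k%:R + c <= W k y]) ->
  null [set x | inI x /\ ~ exists N0, forall N, (N0 <= N)%N ->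
     t1 * (N%:R - K%:R - t2 * N%:R) <= W N x].
Proof.
move=> Wp t10 mB BI t20 Bt HB.
apply: (null_sub (B := exceeds t2 (visits B))); last first.
  apply/nullP; last exact: exceeds_visits_null.
  by apply: measurable_exceeds; have [_ _ _] := superadditive_visits mB.
move=> x [xI H]; split=> //; exists 0%N => n; apply: contrapT => nH; apply: H.
exists n => N nN; apply: le_trans (superadditive_growth Wp t10 HB N xI).
rewrite ler_wpM2l// lerB//; apply: contrapT => /negP; rewrite -ltNge => lt.
by apply: nH; exists N => //; rewrite addr0 ltW.
Qed.

(** The subadditive ergodic theorem for the multivalued map sending a point to its
    remainders: limit superior and limit inferior agree almost everywhere. *)
Lemma superadditive_ergodic c W t t' : superadditive c W -> 0 <= t' < t ->
  leb (exceeds t W) != 0%E ->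
  null [set x | inI x /\ ~ exists N0, forall N, (N0 <= N)%N ->
     t' * N%:R <= W N x].
Proof.
move=> Wp /andP[t'0 t't] En0; have [_ _ _ mW] := Wp.
have t0 : 0 < t by exact: le_lt_trans t't.
have [t1 [t't1 t1t]] : exists t1, t' < t1 /\ t1 < t.
  by exists ((t' + t) / 2); split; lra.
have t10 : 0 < t1 by exact: le_lt_trans t't1.
have [t2 t2E] : exists t2, t2 = (t1 - t') / (2 * t1) by eexists.
have t20 : 0 < t2 by rewrite t2E divr_gt0 ?subr_gt0// mulr_gt0.
have C0 : 0 < C by apply: lt_le_trans (remainder_bound_ge1 beta1 betam delta0).
have [||||K K0 HK] := @leb_slow t1 c W (Iset `\` exceeds t W) (t2 * kap / C) mW.
- by apply: measurableD => //; exact: measurable_exceeds.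
- exact: exceeds_full Wp (ltW t0) En0.
- by move=> y yI; apply: exceeds_slow Wp _ yI; rewrite (ltW t10).
- by rewrite divr_gt0// mulr_gt0.
have mB := measurable_slow t1 c K mW.
have BI : slow t1 c W K `<=` Iset by move=> x [].
have := superadditive_eventual_growth Wp (ltW t10) mB BI t20.
have bfin := fin_num_leb_sub mB BI.
move: HK; rewrite -(fineK bfin) -EFinM !lte_fin ltr_pdivlMr// mulrC => HK /(_ K HK).
have HB y : inI y -> ~ slow t1 c W K y ->
    exists k, [/\ (0 < k)%N, (k <= K)%N & t1 * k%:R + c <= W k y].
  move=> yI nB; apply: contrapT => H; apply: nB; split=> // k /andP[k0 kK].
  by rewrite ltNge; apply/negP => Wk; apply: H; exists k.
move=> /(_ HB); apply: null_sub => x [xI H]; split=> // -[N0 HN0]; apply: H.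
exists (N0 + Num.truncn (t1 * K%:R / (t1 * (1 - t2) - t'))).+1 => N NN.
apply: le_trans (HN0 N _); last by rewrite (leq_trans _ NN)// leqW// leq_addr.
have : t1 * K%:R / (t1 * (1 - t2) - t') < N%:R.
  apply: lt_le_trans (truncnS_gt _) _; rewrite ler_nat.
  by apply: leq_trans NN; rewrite ltnS leq_addl.
rewrite ltr_pdivrMr; first by lra.
rewrite (_ : _ - t' = (t1 - t') / 2) ?divr_gt0 ?subr_gt0//.
by rewrite t2E; field; rewrite gt_eqF.
Qed.

End processes.

(** * Growth of the number of prefixes *)

Lemma borel_cantelli_geometric (R : realType) (F : nat -> set R) (K q : R) :
  (forall n, measurable (F n)) -> 0 <= K -> 0 <= q < 1 ->
  (forall n, (@lebesgue_measure R (F n) <= (K * q ^+ n)%:E)%E) ->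
  null [set x | forall n, exists2 k, (n <= k)%N & F k x].
Proof.
move=> mF K0 q01 HF.
apply: (null_sub (B := lim_sup_set F)).
  by move=> x H n _; have [k nk Fk] := H n; exists k.
apply/nullP.
  by apply: bigcapT_measurable => n; apply: bigcup_measurable => k _; exact: mF.
apply: lim_sup_set_cvg0 => //.
apply: le_lt_trans (_ : (K / (1 - q))%:E < +oo)%E; last by rewrite ltry.
apply: lime_le; first by apply: is_cvg_nneseries => n _ _; exact: measure_ge0.
apply: nearW => n; apply: (@le_trans _ _ (\sum_(0 <= k < n) (K * q ^+ k)%:E)%E).
  by apply: lee_sum => k _; exact: HF.
rewrite sumEFin lee_fin -mulr_sumr ler_wpM2l// big_mkord.
exact: geometric_sum_le.
Qed.

Lemma cauchy_schwarz_step (R : rcfType) (u v w n : R) : 0 <= u -> 0 <= v -> 0 <= w -> 0 <= n ->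
  u ^+ 2 <= n * v -> (w + u) ^+ 2 <= (n + 1) * (w ^+ 2 + v).
Proof.
move=> u0 v0 w0 n0 H.
suff : 2 * (w * u) <= n * w ^+ 2 + v by move=> H2; move: (H); rewrite !expr2 in H H2 *; lra.
have [n00|n00] := eqVneq n 0.
  move: H; rewrite n00 mul0r => H; have : u ^+ 2 = 0 by apply/eqP; rewrite eq_le H sqr_ge0.
  by move=> /eqP; rewrite sqrf_eq0 => /eqP ->; rewrite mulr0 mulr0 mul0r add0r.
have np : 0 < n by rewrite lt0r n00.
rewrite -(ler_pM2l np); have := sqr_ge0 (n * w - u); rewrite !expr2 in H *; lra.
Qed.

(** The Cauchy--Schwarz inequality for the vectors $(1)$ and $(\sqrt{f(x)})$. *)
Lemma sum_sqrt_le (R : rcfType) (T : Type) (l : seq T) (f : T -> R) :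
  (forall x, 0 <= f x) ->
  \sum_(x <- l) Num.sqrt (f x) <= Num.sqrt ((size l)%:R * \sum_(x <- l) f x).
Proof.
move=> f0; have S0 : 0 <= \sum_(x <- l) f x by apply: sumr_ge0.
have sq : forall l : seq T, (\sum_(x <- l) Num.sqrt (f x)) ^+ 2 <= (size l)%:R * \sum_(x <- l) f x.
  elim=> [|a l' IH]; first by rewrite !big_nil expr0n mulr0.
  rewrite !big_cons /= -natr1 -[X in _ <= _ * (X + _)](sqr_sqrtr (f0 a)).
  by apply: cauchy_schwarz_step; rewrite ?sqrtr_ge0 ?sumr_ge0.
rewrite -[leLHS]ger0_norm ?sumr_ge0// -sqrtr_sqr ler_sqrt//.
  by rewrite mulr_ge0.
Qed.

Section growth.
Context (R : realType) (beta : R) (m : nat) (delta : R).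
Hypotheses (beta1 : 1 < beta) (betam : beta < m%:R).
Hypotheses (delta0 : 0 < delta) (sep : sums_separated beta m delta).

Local Notation X := (digit_sums beta m).
Local Notation kap := (I_len beta m).
Local Notation inI := (inI beta m).
Local Notation Iset := (Iset beta m).
Local Notation leb := (@lebesgue_measure R).
Local Notation C := (remainder_bound beta m delta).
Local Notation prefixes := (prefixes beta m).
Local Notation exceeds := (exceeds beta m).

Let beta0 : 0 < beta. Proof. exact: lt_trans beta1. Qed.
Let betan0 n : 0 < beta ^+ n. Proof. exact: exprn_gt0. Qed.
Let kap0 : 0 < kap := I_len_gt0 beta1 betam.
Let mI := measurable_Iset beta m.
Let C0 : 0 < C. Proof. exact: lt_le_trans (remainder_bound_ge1 beta1 betam delta0). Qed.

Definition ln_prefixes n x : R := ln (prefixes n x)%:R.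

Lemma measurable_prefixes n : measurable_fun setT (fun x => (prefixes n x)%:R : R).
Proof.
rewrite (_ : (fun _ => _) = fun x => \sum_(s <- X n) \1_[set x | Iset (beta ^+ n * x - s)] x).
  apply: measurable_sum => s; apply: measurable_indic.
  exact: measurable_affine_preimage.
apply/funext => x; rewrite /prefixes -sum1_count big_mkcond natr_sum.
apply: eq_bigr => s _; rewrite indicE; case: ifPn => sI; first by rewrite mem_set.
by rewrite memNset//; exact/negP.
Qed.

(** Follow the remainder of the most frequent integer part: each expansion of this
    remainder continues all the words having that integer part. *)
Lemma superadditive_ln_prefixes : superadditive beta m (ln C) ln_prefixes.
Proof.
have N1 n x : inI x -> 1 <= (prefixes n x)%:R :> R.
  by move=> xI; rewrite ler1n; exact: prefixes_gt0.
have N0 n x : inI x -> 0 < (prefixes n x)%:R :> R.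
  by move=> xI; rewrite (lt_le_trans ltr01)// N1.
split.
- by move=> n x xI; rewrite ln_ge0// N1.
- move=> n x xI; have [s [sX sI sN]] := exists_heavy_prefix beta1 betam delta0 sep n xI.
  exists s; split=> // k; have Ny := N0 k _ sI.
  have cs : 0 < (count_mem s (X n))%:R :> R by rewrite ltr0n -has_count has_pred1.
  have Nx := N0 n _ xI; have Nnk := N0 (n + k)%N _ xI.
  rewrite lerBlDr /ln_prefixes -!lnM ?posrE// ler_ln ?posrE ?mulr_gt0//.
  apply: le_trans (_ : C * (count_mem s (X n))%:R * (prefixes k (beta ^+ n * x - s))%:R <= _).
    by rewrite ler_wpM2r.
  by rewrite -mulrA mulrC ler_wpM2r ?(ltW C0)// -natrM ler_nat prefixesD_ge.
- move=> k x i im yI; rewrite ler_ln ?posrE ?N0//; last exact: inI_of_digit yI.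
  by rewrite ler_nat prefixesS.
- by move=> k; apply: measurableT_comp => //; exact: measurable_prefixes.
Qed.

Lemma le_ln_prefixes n k x : inI x -> (n <= k)%N -> ln_prefixes n x <= ln_prefixes k x.
Proof.
move=> xI nk; rewrite ler_ln ?posrE ?ltr0n ?prefixes_gt0// ler_nat.
exact: leq_prefixes.
Qed.

(** Since $m > \beta$, two digits are possible on an interval of positive length;
    both remainders having $2^j$ expansions of some length, the point has $2^{j+1}$. *)
Lemma prefixes_unbounded j :
  leb (Iset `\` [set x | exists k, (2 ^ j <= prefixes k x)%N]) = 0%E.
Proof.
pose E j := [set x | inI x /\ exists k, (2 ^ j <= prefixes k x)%N].
have mE i : measurable (E i).
  rewrite (_ : E i = Iset `&` \bigcup_k [set x | (2 ^ i)%:R <= (prefixes k x)%:R :> R]).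
    apply: measurableI => //; apply: bigcupT_measurable => k.
    by apply: measurable_ge_set; exact: measurable_prefixes.
  apply/seteqP; split=> x [xI].
    by move=> [k kx]; split=> //; exists k => //=; rewrite ler_nat.
  by move=> [k _ /=]; rewrite ler_nat => kx; split=> //; exists k.
have -> : Iset `\` [set x | exists k, (2 ^ j <= prefixes k x)%N] = Iset `\` E j.
  by apply/seteqP; split=> x [xI H]; split=> // H'; apply: H; [case: H'|split].
elim: j => [|j IH].
  rewrite (_ : _ `\` _ = set0) ?measure0//; apply/seteqP; split=> x // [xI]; apply.
  by split=> //; exists 0%N; rewrite expn0 prefixes_gt0.
apply: (zero_one_law beta1 betam) => //; first by move=> x [].
  move=> x i im [yI [k kx]]; split; first exact: inI_of_digit yI.
  by exists k.+1; apply: leq_trans kx _; exact: prefixesS.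
pose U : set R := `[beta^-1, kap / beta]%classic.
have m2 : (1 < m)%N by rewrite -(ltr_nat R) (lt_trans beta1).
pose V i := [set x | (Iset `\` E j) (beta * x - i)].
have mV i : measurable (V i).
  by apply: measurable_affine_preimage; exact: measurableD.
have V0 i : leb (V i) = 0%E.
  by rewrite (lebesgue_measure_affine _ beta0) ?IH ?mule0//; exact: measurableD.
have UV : U `<=` E j.+1 `|` (V 0 `|` V 1).
  move=> x; rewrite /U /= in_itv/= ler_pdivlMr// => /andP[x0 xk].
  have bi : beta^-1 * beta = 1 by rewrite mulVf// gt_eqF.
  have x0' : 1 <= x * beta by rewrite -bi ler_pM2r.
  have y0 : inI (beta * x - 0) by rewrite /(inI _) subr0 mulrC xk andbT; lra.
  have y1 : inI (beta * x - 1) by rewrite /(inI _) mulrC; apply/andP; split; lra.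
  have [|n0] := pselect (V 0 x); first by right; left.
  have [|n1] := pselect (V 1 x); first by right; right.
  left; have H i : inI (beta * x - i) -> ~ V i x ->
      exists k, (2 ^ j <= prefixes k (beta * x - i))%N.
    by move=> yI nV; apply: contrapT => nE; apply: nV; split=> // -[].
  have [[k0 Hk0] [k1 Hk1]] := (H _ y0 n0, H _ y1 n1).
  split; first by apply: (@inI_of_digit _ _ _ beta1 _ 1%N).
  exists (maxn k0 k1).+1; rewrite -[(maxn k0 k1).+1]add1n prefixesD.
  have -> : X 1 = [seq i%:R | i <- iota 0 m].
    by rewrite /= cats0; apply: eq_map => i; rewrite mulr0 add0r.
  have -> : iota 0 m = [:: 0, 1 & iota 2 m.-2]%N by case: (m) m2 => [|[|m']].
  rewrite !big_cons /= expr1 addnA; apply: leq_trans (leq_addr _ _).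
  rewrite expnS mul2n -addnn leq_add//.
    exact: leq_trans Hk0 (leq_prefixes _ _ _ (leq_maxl _ _)).
  exact: leq_trans Hk1 (leq_prefixes _ _ _ (leq_maxr _ _)).
have U0 : (0 < leb U)%E.
  rewrite lebesgue_measure_itv/= lte_fin -(ltr_pM2r beta0).
  rewrite mulVf ?gt_eqF// mulfVK ?gt_eqF// I_len_gt1// -EFinB lte_fin subr_gt0.
  by rewrite -(ltr_pM2r beta0) mulVf ?gt_eqF// mulfVK ?gt_eqF// I_len_gt1.
apply/eqP => E0; move: U0; rewrite ltNge => /negP; apply.
have mU : measurable U by exact: measurable_itv.
have mV01 : measurable (V 0 `|` V 1) by exact: measurableU.
have mW : measurable (E j.+1 `|` (V 0 `|` V 1)) by exact: measurableU.
apply: (@le_trans _ _ (leb (E j.+1 `|` (V 0 `|` V 1)))); first by rewrite le_measure ?inE.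
apply: le_trans (measureU2 _ _ _) _ => /=; [exact: mE|exact: mV01|].
rewrite [X in (X + _)%E]E0 add0e.
apply: le_trans (measureU2 _ _ _) _ => /=; [exact: mV|exact: mV|].
by rewrite !V0 adde0.
Qed.

(** Off a set B of small measure, every point has so many expansions of some length at
    most K that their logarithm exceeds the loss $\ln C$ of superadditivity by 1. Such
    blocks can be concatenated, and B is visited less than half of the time. *)
Lemma prefixes_exponential : exists2 t, 0 < t & leb (exceeds t ln_prefixes) != 0%E.
Proof.
have Wp := superadditive_ln_prefixes; have [W0 _ _ mW] := Wp.
have eps0 : 0 < kap / (2 * C) by rewrite divr_gt0// mulr_gt0.
pose j := (Num.truncn (expR (ln C + 1))).+1.
have [||||K K0 HK] := @leb_slow _ beta m beta1 betam 0 (ln C + 1) ln_prefixes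
  (Iset `\` [set x | exists k, (2 ^ j <= prefixes k x)%N]) (kap / (2 * C)) mW.
- apply: measurableD => //.
  rewrite (_ : [set x | _] = \bigcup_k [set x | (2 ^ j)%:R <= (prefixes k x)%:R :> R]).
    apply: bigcupT_measurable => k.
    by apply: measurable_ge_set; exact: measurable_prefixes.
  by apply/seteqP; split=> x [k]; rewrite /= ?ler_nat => kx; exists k => //=; rewrite ?ler_nat.
- exact: prefixes_unbounded.
- move=> y yI slowy; split=> // -[k jk]; have := slowy k.+1 (ltn0Sn _).
  rewrite mul0r add0r ltNge => /negP; apply.
  apply: le_trans (le_ln_prefixes yI (leqnSn k)).
  rewrite -[leLHS]expRK ler_ln ?posrE ?expR_gt0 ?ltr0n ?prefixes_gt0//.
  apply: le_trans (_ : (2 ^ j)%:R <= _); last by rewrite ler_nat.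
  apply: ltW (lt_trans (truncnS_gt _) _); rewrite -/j ltr_nat; exact: ltn_expl.
- by [].
set B := slow _ _ _ _ _ _ in HK.
have mB : measurable B by exact: measurable_slow.
have BI : B `<=` Iset by move=> x [].
have bfin := fin_num_leb_sub beta1 betam mB BI.
have BC : (C%:E * leb B < (2^-1 * kap)%:E)%E.
  move: HK; rewrite -(fineK bfin) -EFinM !lte_fin ltr_pdivlMr ?mulr_gt0//; lra.
have Ki : K%:R * K%:R^-1 = 1 :> R by rewrite mulfV// pnatr_eq0 -lt0n.
have Ki0 : 0 < K%:R^-1 :> R by rewrite invr_gt0 ltr0n.
have HB y : inI y -> ~ B y -> exists k, [/\ (0 < k)%N, (k <= K)%N &
    K%:R^-1 * k%:R + ln C <= ln_prefixes k y].
  move=> yI nB; apply: contrapT => H; apply: nB; split=> // k /andP[k0 kK].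
  rewrite mul0r add0r ltNge; apply/negP => Wk; apply: H; exists k; split=> //.
  apply: le_trans Wk; rewrite addrC lerD2l.
  apply: le_trans (_ : K%:R^-1 * K%:R <= _); last by rewrite mulrC Ki.
  by rewrite ler_wpM2l ?(ltW Ki0)// ler_nat.
have h0 : 0 < 2^-1 :> R by [].
have growth := superadditive_eventual_growth beta1 betam delta0 sep Wp (ltW Ki0) mB BI h0 BC HB.
exists (3^-1 * K%:R^-1); first by rewrite mulr_gt0.
apply/eqP => E0.
have : null Iset; last first.
  by rewrite nullP// (leb_Iset beta1 betam) => -[] /eqP; rewrite gt_eqF.
have nE : null (exceeds (3^-1 * K%:R^-1) ln_prefixes).
  by apply/nullP => //; exact: measurable_exceeds.
apply: null_sub (nullU nE growth) => x xI.
have [[N0 HN]|nN] := pselect (exists N0, forall N, (N0 <= N)%N ->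
  K%:R^-1 * (N%:R - K%:R - 2^-1 * N%:R) <= ln_prefixes N x); last by right.
left; split=> //; exists 1%N => n; exists (maxn n N0); first exact: leq_maxl.
have := HN _ (leq_maxr n N0); set N := maxn n N0.
have : 0 <= K%:R^-1 * N%:R :> R by rewrite mulr_ge0// ltW.
by rewrite !mulrBr [K%:R^-1 * K%:R]mulrC Ki [_ * (2^-1 * _)]mulrCA; lra.
Qed.

(** Up to constants, the integral over $I_\beta$ of the square root of the number of
    prefixes. It depends on the multiplicities only, and is submultiplicative. *)
Definition half_moment n : R :=
  (beta ^+ n)^-1 * \sum_(s <- undup (X n)) Num.sqrt (count_mem s (X n))%:R.

(** A point with T prefixes has one integer part s of multiplicity at least T / C.
    There are at most $\sqrt{C/T}\sum_s\sqrt{c_n(s)}$ of these s, where $c_n(s)$ is the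
    multiplicity, and each concerns an interval of length $\kappa\beta^{-n}$. *)
Lemma leb_many_prefixes n T : 0 < T ->
  (leb (Iset `&` [set x | (T <= (prefixes n x)%:R)%R]) <=
   (kap * Num.sqrt (C / T) * half_moment n)%:E)%E.
Proof.
move=> T0.
pose l := [seq s <- undup (X n) | T / C <= (count_mem s (X n))%:R].
pose V s := [set x | Iset (beta ^+ n * x - s)].
apply: (@le_trans _ _ (leb (\big[setU/set0]_(s <- l) V s))).
  rewrite le_measure ?inE//.
  - apply: measurableI => //; apply: measurable_ge_set; exact: measurable_prefixes.
  - by apply: bigsetU_measurable => s _; exact: measurable_affine_preimage.
  move=> x [xI Tx]; have [s [sX sI sN]] := exists_heavy_prefix beta1 betam delta0 sep n xI.
  rewrite -bigcup_seq; exists s => //=.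
  rewrite mem_filter mem_undup sX andbT ler_pdivrMr// mulrC.
  exact: le_trans sN.
apply: (@le_trans _ _ ((size l)%:R * ((beta ^+ n)^-1 * kap))%:E).
  elim: (l) => [|s l' IH]; first by rewrite big_nil measure0 mul0r.
  rewrite big_cons; apply: le_trans (measureU2 _ _ _) _ => /=.
  - exact: measurable_affine_preimage.
  - by apply: bigsetU_measurable => t _; exact: measurable_affine_preimage.
  rewrite (lebesgue_measure_affine s (betan0 n) mI) (leb_Iset beta1 betam) -EFinM.
  by rewrite -natr1 mulrDl mul1r [in leRHS]addrC EFinD leeD2l.
rewrite lee_fin mulrCA /half_moment [leRHS]mulrCA ler_wpM2l ?invr_ge0 ?(ltW (betan0 n))//.
rewrite -[leRHS]mulrA [leLHS]mulrC.
rewrite ler_wpM2l ?(ltW kap0)// mulr_sumr.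
have lE : (size l)%:R = \sum_(s <- undup (X n) | T / C <= (count_mem s (X n))%:R) (1 : R).
  rewrite -big_filter -/l big_const_seq count_predT.
  by elim: (size l) => //= k <-; rewrite -natr1 addrC.
rewrite lE big_mkcond; apply: ler_sum => s _; case: ifPn => [Ts|_]; last first.
  by rewrite mulr_ge0.
have CT0 : 0 < C / T by rewrite divr_gt0.
rewrite -(sqrtrM _ (ltW CT0)) -[leLHS]sqrtr1 ler_wsqrtr//.
apply: le_trans (_ : C / T * (T / C) <= _); last by rewrite ler_wpM2l// ltW.
by rewrite mulrA mulfVK ?gt_eqF// mulfV ?gt_eqF.
Qed.

(** By Borel--Cantelli, the points with at least $e^{tn}$ prefixes of length n having
    measure of order $(\theta^2e^{-t})^{n/2}$. *)
Lemma exceeds_null_of_half_moment A theta t : 0 <= A -> 0 < theta ->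
  (forall n, half_moment n <= A * theta ^+ n) -> theta ^+ 2 < expR t ->
  leb (exceeds t ln_prefixes) = 0%E.
Proof.
move=> A0 th0 HA tht.
have mE : measurable (exceeds t ln_prefixes).
  by apply: measurable_exceeds; have [_ _ _] := superadditive_ln_prefixes.
apply/nullP => //.
pose F (a : nat) n := Iset `&` [set x | expR (t * n%:R - a%:R) <= (prefixes n x)%:R].
have mF a n : measurable (F a n).
  by apply: measurableI => //; apply: measurable_ge_set; exact: measurable_prefixes.
apply: null_sub (_ : null (\bigcup_a [set x | forall n, exists2 k, (n <= k)%N & F a k x])).
  move=> x [xI [a Ha]]; exists a => // n; have [k nk Hk] := Ha n; exists k => //; split=> //=.
  rewrite -[leRHS]lnK ?posrE ?ltr0n ?prefixes_gt0// ler_expR.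
  by rewrite lerBlDr.
apply: null_bigcup => a.
pose q := theta / expR (t / 2).
have e0 : 0 < expR (t / 2) := expR_gt0 _.
have q01 : 0 <= q < 1.
  rewrite divr_ge0 ?ltW//= ltr_pdivrMr// mul1r -(ltr_pXn2r (n := 2))// ?nnegrE ?ltW//.
  by rewrite -expRM_natl mulrC mulfVK.
apply: (@borel_cantelli_geometric _ (F a) (kap * Num.sqrt (C * expR a%:R) * A) q) => //.
- exact: mulr_ge0 (mulr_ge0 (ltW kap0) (sqrtr_ge0 _)) A0.
move=> n; apply: le_trans (leb_many_prefixes _ (expR_gt0 _)) _; rewrite lee_fin.
apply: le_trans (_ : kap * Num.sqrt (C / expR (t * n%:R - a%:R)) * (A * theta ^+ n) <= _).
  by rewrite ler_wpM2l// mulr_ge0 ?sqrtr_ge0// ltW.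
rewrite le_eqVlt; apply/orP; left; apply/eqP.
have -> : C / expR (t * n%:R - a%:R) = (C * expR a%:R) * (expR (t / 2) ^- n) ^+ 2.
  have -> : t * n%:R - a%:R = 2%:R * (n%:R * (t / 2)) - a%:R by field.
  rewrite expRD expRM_natl expRM_natl expRN; field.
  by rewrite expf_neq0 gt_eqF ?expR_gt0.
rewrite sqrtrM ?mulr_ge0 ?(ltW C0) ?expR_ge0// sqrtr_sqr ger0_norm ?invr_ge0 ?exprn_ge0 ?(ltW e0)//.
by rewrite /q expr_div_n; ring.
Qed.

(** By Cauchy--Schwarz and the bound on the number of distinct digit sums. *)
Lemma half_moment_le n : half_moment n <= Num.sqrt C * Num.sqrt (m%:R / beta) ^+ n.
Proof.
have cs := @sum_sqrt_le R _ (undup (X n)) (fun s => (count_mem s (X n))%:R).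
rewrite /half_moment ler_pdivrMl//; apply: le_trans (cs _) _ => //.
have -> : \sum_(s <- undup (X n)) (count_mem s (X n))%:R = (m ^ n)%:R :> R.
  rewrite -(size_digit_sums beta) -sum1_size natr_sum [RHS]big_undup_count.
  by [].
have mb : 0 <= m%:R / beta by rewrite divr_ge0// ltW.
have r0 : 0 <= beta ^+ n * (Num.sqrt C * Num.sqrt (m%:R / beta) ^+ n).
  by rewrite !mulr_ge0 ?exprn_ge0 ?sqrtr_ge0// ltW.
rewrite -[leRHS](ger0_norm r0) -sqrtr_sqr ler_wsqrtr//.
rewrite !exprMn (sqr_sqrtr (ltW C0)) [Num.sqrt (m%:R / beta) ^+ n ^+ 2]exprAC.
rewrite (sqr_sqrtr mb) expr_div_n natrX.
have -> : beta ^+ n ^+ 2 * (C * (m%:R ^+ n / beta ^+ n)) = C * beta ^+ n * m%:R ^+ n.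
  by field; rewrite gt_eqF.
by rewrite ler_wpM2r ?exprn_ge0// (size_distinct_sums beta1 betam delta0 sep).
Qed.

(** The multiplicity of u is the sum of the products of the multiplicities of s and t
    over the decompositions $u = \beta^k s + t$, and the square root is subadditive. *)
Lemma half_momentD n k : half_moment (n + k) <= half_moment n * half_moment k.
Proof.
rewrite /half_moment exprD invfM mulrACA ler_wpM2l ?mulr_ge0 ?invr_ge0 ?(ltW (betan0 _))//.
pose c j s : R := (count_mem s (X j))%:R.
have cE u : c (n + k)%N u = \sum_(s <- undup (X n)) \sum_(t <- undup (X k))
    (beta ^+ k * s + t == u)%:R * (c n s * c k t).
  rewrite /c -sum1_count big_mkcond natr_sum big_digit_sumsD (big_undup_count _ _ (fun s => _)).
  apply: eq_bigr => s _; rewrite (big_undup_count _ _ (fun t => _)) -[LHS]mulr_natr mulr_suml.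
  apply: eq_bigr => t _; rewrite -[X in X * _]mulr_natr mulrAC -mulrA.
  by congr (_ * _) => /=; case: (_ == _).
have sqrt_sum (T : Type) (l : seq T) (f : T -> R) : (forall x, 0 <= f x) ->
    Num.sqrt (\sum_(x <- l) f x) <= \sum_(x <- l) Num.sqrt (f x).
  move=> f0; elim: l => [|a l IH]; first by rewrite !big_nil sqrtr0.
  rewrite !big_cons; apply: le_trans (_ : Num.sqrt (f a) + Num.sqrt (\sum_(x <- l) f x) <= _).
    have r0 := addr_ge0 (sqrtr_ge0 (f a)) (sqrtr_ge0 (\sum_(x <- l) f x)).
    rewrite -[leRHS](ger0_norm r0) -sqrtr_sqr ler_wsqrtr// sqrrD !sqr_sqrtr ?sumr_ge0//.
    by rewrite lerD2r lerDl mulrn_wge0// mulr_ge0.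
  by rewrite lerD2l.
apply: (@le_trans _ _ (\sum_(u <- undup (X (n + k))) \sum_(s <- undup (X n))
    \sum_(t <- undup (X k)) (beta ^+ k * s + t == u)%:R * (Num.sqrt (c n s) * Num.sqrt (c k t)))).
  apply: ler_sum => u _; rewrite -/(c _ _) cE.
  apply: le_trans (sqrt_sum _ _ _ _) _.
    by move=> s; apply: sumr_ge0 => t _; rewrite !mulr_ge0.
  apply: ler_sum => s _; apply: le_trans (sqrt_sum _ _ _ _) _ => [t|].
    by rewrite !mulr_ge0.
  apply: ler_sum => t _; rewrite sqrtrM// sqrtrM//.
  by case: eqP => _; rewrite ?sqrtr1 ?sqrtr0.
rewrite exchange_big mulr_suml; apply: ler_sum => s _.
rewrite exchange_big mulr_sumr; apply: ler_sum => t _.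
rewrite -mulr_suml ler_piMl ?mulr_ge0 ?sqrtr_ge0//.
have -> : \sum_(u <- undup (X (n + k))) (beta ^+ k * s + t == u)%:R =
    (count_mem (beta ^+ k * s + t) (undup (X (n + k))))%:R :> R.
  rewrite -sum1_count [in RHS]big_mkcond natr_sum; apply: eq_bigr => u _.
  by rewrite /= eq_sym; case: (_ == u).
by rewrite count_uniq_mem ?undup_uniq//; case: (_ \in _).
Qed.

End growth.

(** * The almost sure growth rate *)

Section growth_rate.
Context (R : realType) (beta : R) (m : nat) (delta : R).
Hypotheses (beta1 : 1 < beta) (betam : beta < m%:R).
Hypotheses (delta0 : 0 < delta) (sep : sums_separated beta m delta).

Local Notation inI := (inI beta m).
Local Notation leb := (@lebesgue_measure R).
Local Notation C := (remainder_bound beta m delta).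
Local Notation exceeds := (exceeds beta m).
Local Notation ln_prefixes := (ln_prefixes beta m).
Local Notation half_moment := (half_moment beta m).

Let beta0 : 0 < beta. Proof. exact: lt_trans beta1. Qed.
Let mb1 : 1 < m%:R / beta. Proof. by rewrite ltr_pdivlMr// mul1r. Qed.
Let mb0 : 0 < m%:R / beta. Proof. exact: lt_trans mb1. Qed.

Lemma half_moment_gt0 n : 0 < half_moment n.
Proof.
rewrite mulr_gt0 ?invr_gt0 ?exprn_gt0//.
have I0 : inI 0 by rewrite /(inI _) lexx ltW// I_len_gt0.
have [s sX _] := inI_digit_sums beta1 betam n I0.
rewrite (big_rem s) ?mem_undup//= ltr_pwDl//; last by apply: sumr_ge0.
by rewrite sqrtr_gt0 ltr0n -has_count has_pred1.
Qed.

(** Fekete's argument: by submultiplicativity a single good k decides the rate. *)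
Lemma half_moment_geometric k : (0 < k)%N -> half_moment k ^+ 2 < (m%:R / beta) ^+ k ->
  exists A theta, [/\ 0 <= A, 0 < theta, theta ^+ 2 < m%:R / beta &
    forall n, half_moment n <= A * theta ^+ n].
Proof.
move=> k0 hk; pose theta := expR (ln (half_moment k) / k%:R).
have th0 : 0 < theta := expR_gt0 _.
have thk : theta ^+ k = half_moment k.
  by rewrite -expRM_natl mulrC mulfVK ?pnatr_eq0 -?lt0n// lnK// posrE half_moment_gt0.
exists (\sum_(r < k) half_moment r / theta ^+ r), theta; split=> //.
- by apply: sumr_ge0 => r _; rewrite divr_ge0 ?exprn_ge0 ?ltW// half_moment_gt0.
- by rewrite -(ltr_pXn2r k0) ?nnegrE ?exprn_ge0 ?(ltW mb0) ?(ltW th0)// -exprM mulnC exprM thk.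
move=> n; have mul j r : half_moment (j * k + r) <= theta ^+ (j * k) * half_moment r.
  elim: j => [|j IH]; first by rewrite mul0n expr0 mul1r.
  rewrite mulSn -addnA exprD thk -mulrA.
  apply: le_trans (half_momentD m beta1 k (j * k + r)) _.
  by rewrite ler_wpM2l// ltW// half_moment_gt0.
rewrite {1}(divn_eq n k); apply: le_trans (mul _ _) _.
rewrite [in leRHS](divn_eq n k) exprD [leRHS]mulrCA ler_wpM2l ?exprn_ge0 ?(ltW th0)//.
rewrite -ler_pdivrMr ?exprn_gt0//.
have nk : (n %% k < k)%N by rewrite ltn_mod.
rewrite (bigD1 (Ordinal nk))//= lerDl; apply: sumr_ge0 => r _.
by rewrite divr_ge0 ?exprn_ge0 ?ltW// half_moment_gt0.
Qed.

(** The rate is the supremum of those that are exceeded on a set of positive measure.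
    Lower rates are eventually exceeded almost everywhere, by the ergodic theorem;
    higher ones almost nowhere, by definition; and the half moments bound it. *)
Lemma prefixes_growth_rate : exists gamma : R,
  [/\ 0 < gamma, gamma <= ln (m%:R / beta),
    (exists2 k, (0 < k)%N & half_moment k ^+ 2 < (m%:R / beta) ^+ k) ->
      gamma < ln (m%:R / beta)
  & null [set x | inI x /\ ~ forall eps : R, 0 < eps -> exists N0, forall N, (N0 <= N)%N ->
      `|ln_prefixes N x - gamma * N%:R| <= eps * N%:R] ].
Proof.
have Wp := superadditive_ln_prefixes beta1 betam delta0 sep; have [W0 _ _ mW] := Wp.
pose T : set R := [set t | 0 <= t /\ leb (exceeds t ln_prefixes) != 0%E].
have [t0 t00 Tt0] := prefixes_exponential beta1 betam delta0 sep.
have T0 : T t0 by split=> //; exact: ltW.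
have ubT A theta : 0 <= A -> 0 < theta -> (forall n, half_moment n <= A * theta ^+ n) ->
    ubound T (ln (theta ^+ 2)).
  move=> A0 th0 HA t [_ Tt]; rewrite leNgt; apply/negP => lt; move/eqP : Tt; apply.
  apply: (exceeds_null_of_half_moment beta1 betam delta0 sep A0 th0 HA).
  by rewrite -[ltLHS]lnK ?ltr_expR// posrE exprn_gt0.
have ubT1 : ubound T (ln (m%:R / beta)).
  have := ubT (Num.sqrt C) (Num.sqrt (m%:R / beta)) (sqrtr_ge0 _) _ _.
  rewrite sqr_sqrtr ?(ltW mb0)//; apply; first by rewrite sqrtr_gt0.
  exact: half_moment_le.
have supT : has_sup T by split; [exists t0|exists (ln (m%:R / beta))].
have leT t : leb (exceeds t ln_prefixes) != 0%E -> 0 <= t -> t <= sup T.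
  by move=> Et t0'; apply: ub_le_sup; [have [] := supT|].
exists (sup T); split.
- exact: lt_le_trans t00 (leT _ Tt0 (ltW t00)).
- by apply: ge_sup => //; exists t0.
- move=> [k k0 hk]; have [A [theta [A0 th0 th1 HA]]] := half_moment_geometric k0 hk.
  apply: le_lt_trans (_ : ln (theta ^+ 2) < _).
    by apply: ge_sup; [exists t0|exact: ubT HA].
  by rewrite ltr_ln ?posrE ?exprn_gt0.
have supT0 : 0 < sup T by exact: lt_le_trans t00 (leT _ Tt0 (ltW t00)).
pose L j := Num.max 0 (sup T - j.+1%:R^-1).
pose U j := sup T + j.+1%:R^-1.
pose B j := [set x | inI x /\ ~ exists N0, forall N, (N0 <= N)%N -> L j * N%:R <= ln_prefixes N x].
have j0 j : 0 < j.+1%:R^-1 :> R by rewrite invr_gt0.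
have nB j : null (B j).
  have [|t Tt Lt] := @sup_adherent _ T ((sup T - L j) / 2) _ supT.
    by rewrite divr_gt0// subr_gt0 gt_max supT0/= gtrBl.
  have LsT : L j < sup T by rewrite gt_max supT0/= gtrBl.
  apply: (superadditive_ergodic beta1 betam delta0 sep Wp _ (proj2 Tt)).
  by rewrite le_max lexx/=; lra.
have nU j : null (exceeds (U j) ln_prefixes).
  apply/nullP; first exact: measurable_exceeds.
  apply/eqP/negPn/negP => E0; have U0 : 0 <= U j by rewrite addr_ge0// ltW.
  by have := leT _ E0 U0; rewrite leNgt ltrDl j0.
apply: null_sub (nullU (null_bigcup nB) (null_bigcup nU)) => x [xI H].
apply: contrapT => nx; apply: H => eps eps0.
pose j := Num.truncn eps^-1.
have jeps : j.+1%:R^-1 < eps by rewrite invf_plt ?posrE// truncnS_gt.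
have [N1 HN1] : exists N0, forall N, (N0 <= N)%N -> L j * N%:R <= ln_prefixes N x.
  by apply: contrapT => H; apply: nx; left; exists j.
have [N2 HN2] : exists N0, forall N, (N0 <= N)%N -> ln_prefixes N x <= U j * N%:R.
  apply: contrapT => H; apply: nx; right; exists j => //; split=> //.
  exists 0%N => n; apply: contrapT => H'; apply: H; exists n => N nN.
  by rewrite leNgt; apply/negP => lt; apply: H'; exists N => //; rewrite addr0 ltW.
exists (maxn N1 N2) => N; rewrite geq_max => /andP[/HN1 h1 /HN2 h2].
have NN0 : 0 <= N%:R :> R by [].
have hL : (sup T - j.+1%:R^-1) * N%:R <= L j * N%:R by rewrite ler_wpM2r// le_max lexx orbT.
have hj : j.+1%:R^-1 * N%:R <= eps * N%:R by rewrite ler_wpM2r// ltW.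
have := le_trans hL h1; move: h2 hj; rewrite ler_norml /U mulrDl mulrBl.
move: (ln_prefixes N x) (sup T * N%:R) (_^-1 * N%:R) (eps * N%:R) => a b c d ? ? ?.
by apply/andP; split; lra.
Qed.

End growth_rate.

(** * Trigonometric sums over the digits *)

Section trigonometry.
Context (R : realType).
Implicit Types x y t : R.

Lemma cos_lipschitz x y : `|cos x - cos y| <= `|x - y|.
Proof.
wlog xy : x y / x <= y.
  move=> H; have [/H //|/ltW/H] := leP x y.
  by rewrite distrC [leRHS]distrC.
have [|c _ cE] := @MVT_segment R cos (fun z => - sin z) x y xy _ _.
- by apply: continuous_subspaceT => z; exact: continuous_cos.
rewrite distrC cE normrM normrN [leRHS]distrC -[leRHS]mul1r ler_wpM2r//.
exact: sin_max.
Qed.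

Lemma cosD_natpi x k : cos (x + k%:R * pi) = (-1) ^+ k * cos x.
Proof.
elim: k => [|k IH]; first by rewrite mul0r addr0 expr0 mul1r.
by rewrite -natr1 mulrDl mul1r addrA cosDpi IH exprS mulN1r mulNr.
Qed.

Lemma sinD_natpi x k : sin (x + k%:R * pi) = (-1) ^+ k * sin x.
Proof.
elim: k => [|k IH]; first by rewrite mul0r addr0 expr0 mul1r.
by rewrite -natr1 mulrDl mul1r addrA sinDpi IH exprS mulN1r mulNr.
Qed.

Lemma sin_pi_eq0 x : 0 <= x -> sin (pi * x) = 0 -> exists k : nat, x = k%:R.
Proof.
move=> x0; have /andP[l u] := truncn_itv x0; set k := Num.truncn x in l u *.
have -> : pi * x = pi * (x - k%:R) + k%:R * pi by ring.
rewrite sinD_natpi => /eqP; rewrite mulf_eq0 signr_eq0/= => /eqP s0.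
exists k; apply/eqP; rewrite eq_le l andbT leNgt; apply/negP => kx.
have : 0 < sin (pi * (x - k%:R)).
  apply: sin_gt0_pi; rewrite mulr_gt0 ?pi_gt0 ?subr_gt0//=.
  by rewrite -[ltRHS]mulr1 ltr_pM2l ?pi_gt0// ltrBlDr addrC natr1.
by rewrite s0 ltxx.
Qed.

(** The digits are centred at $h = (m-1)/2$ to make the Fourier transform real. *)
Definition centered_cos_sum m t : R :=
  \sum_(0 <= i < m) cos (2 * pi * t * (i%:R - (m%:R - 1) / 2)).
Local Notation psi := centered_cos_sum.

Lemma centered_sin_sum m t :
  \sum_(0 <= i < m) sin (2 * pi * t * (i%:R - (m%:R - 1) / 2)) = 0.
Proof.
set S := \sum_(_ <= _ < _) _; suff : S = - S.
  by move=> /eqP; rewrite -addr_eq0 -mulr2n mulrn_eq0 => /eqP.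
rewrite {1}/S big_nat_rev /= /S -sumrN; apply: eq_big_nat => i /andP[_ im].
by rewrite add0n natrB// -natr1 -sinN; congr (sin _); field.
Qed.

Lemma sum_centered_cosD m t y :
  \sum_(0 <= i < m) cos (y + 2 * pi * t * (i%:R - (m%:R - 1) / 2)) = cos y * psi m t.
Proof.
under eq_bigr do rewrite cosD.
by rewrite sumrB -!mulr_sumr centered_sin_sum mulr0 subr0.
Qed.

(** An integral shift of t changes each phase by an integer multiple of $\pi$ whose
    parity is the same for all the digits. *)
Lemma norm_centered_cos_sumD m z t : `|psi m (z%:R + t)| = `|psi m t|.
Proof.
have -> : psi m (z%:R + t) = (-1) ^+ (m.-1 * z) * psi m t; last first.
  by rewrite normrM normrX normrN1 expr1n mul1r.
rewrite mulr_sumr; apply: eq_big_nat => i /andP[_ im].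
have m0 : (0 < m)%N by exact: leq_ltn_trans im.
set y := 2 * pi * t * _.
have <- : cos (y - (m.-1 * z)%:R * pi) = (-1) ^+ (m.-1 * z) * cos y.
  rewrite -[in RHS](subrK ((m.-1 * z)%:R * pi) y) [in RHS]cosD_natpi.
  by rewrite mulrA -exprMn mulrNN mulr1 expr1n mul1r.
have even (u : R) : cos (u + (2 * (i * z))%:R * pi) = cos u.
  by rewrite cosD_natpi exprM sqrrN !expr1n mul1r.
by rewrite -[RHS]even; congr (cos _); rewrite /y -subn1 !natrM natrB//; field.
Qed.

Lemma centered_cos_sum_le m t : `|psi m t| <= m%:R.
Proof.
apply: le_trans (ler_norm_sum _ _ _) _.
apply: le_trans (_ : \sum_(0 <= i < m) (1 : R) <= _).
  by apply: ler_sum => i _; exact: cos_max.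
by rewrite sumr_const_nat subn0.
Qed.

Lemma centered_cos_sum_ge m t : (0 < m)%N ->
  m%:R * (1 - 2 * pi * m%:R * `|t|) <= psi m t.
Proof.
move=> m0; have -> : m%:R * (1 - 2 * pi * m%:R * `|t|) =
    \sum_(0 <= i < m) (1 - 2 * pi * m%:R * `|t|).
  by rewrite sumr_const_nat subn0 mulr_natl.
rewrite /psi; apply: ler_sum_nat => i /andP[_ im].
set u := i%:R - _; have um : `|u| <= m%:R.
  have iR : i%:R <= m%:R - 1 :> R by rewrite lerBrDr natr1 ler_nat.
  have i0 : 0 <= i%:R :> R by [].
  by rewrite /u ler_norml; apply/andP; split; lra.
have := cos_lipschitz 0 (2 * pi * t * u); rewrite cos0 sub0r normrN => H.
have {}H := le_trans (ler_norm _) H.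
suff : `|2 * pi * t * u| <= 2 * pi * m%:R * `|t| by move: H; lra.
rewrite !normrM ger0_norm// (ger0_norm (pi_ge0 R)) -!mulrA.
by do 2 rewrite ler_wpM2l ?pi_ge0//; rewrite mulrC ler_wpM2r.
Qed.

Lemma centered_cos_sum_sin m t : psi m t * sin (pi * t) = sin (pi * (m%:R * t)).
Proof.
have tel : psi m t * sin (pi * t) * 2 = \sum_(0 <= i < m)
    (sin (pi * t * (2 * i.+1%:R - m%:R)) - sin (pi * t * (2 * i%:R - m%:R))).
  rewrite /psi !mulr_suml; apply: eq_bigr => i _.
  have -> : pi * t * (2 * i.+1%:R - m%:R) = 2 * pi * t * (i%:R - (m%:R - 1) / 2) + pi * t.
    by rewrite -natr1; field.
  have -> : pi * t * (2 * i%:R - m%:R) = 2 * pi * t * (i%:R - (m%:R - 1) / 2) - pi * t.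
    by field.
  by rewrite sinD sinB; ring.
apply: (mulIf (_ : (2 : R) != 0)) => //; rewrite tel telescope_sumr//.
have -> : pi * t * (2 * m%:R - m%:R) = pi * (m%:R * t) by ring.
have -> : pi * t * (2 * 0%:R - m%:R) = - (pi * (m%:R * t)) by ring.
by rewrite sinN opprK; ring.
Qed.

(** By the previous identity, as $\sin(\pi mt)$ vanishes only if mt is an integer. *)
Lemma centered_cos_sum_neq0 m t : (0 < m)%N -> 0 <= t ->
  (forall k : nat, m%:R * t != k%:R) -> psi m t != 0.
Proof.
move=> m0 t0 mt; apply/negP => /eqP p0; have := centered_cos_sum_sin m t.
rewrite p0 mul0r => /esym /sin_pi_eq0 [|k /eqP]; first exact: mulr_ge0.
by apply/negP.
Qed.

Lemma norm_centered_cos_sum_nat m k : `|psi m k%:R| = m%:R.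
Proof.
rewrite -[k%:R]addr0 norm_centered_cos_sumD /psi.
under eq_bigr do rewrite mulr0 mul0r cos0.
by rewrite sumr_const_nat subn0 ger0_norm.
Qed.

End trigonometry.

(** Beyond some L the deficits $1-a_l$ have sum at most 1/2, and the product of numbers
    of the unit interval is at least 1 minus the sum of their deficits. *)
Lemma prod_ge_geometric (R : realType) (a : nat -> R) (D r : R) :
  0 <= D -> 0 <= r < 1 -> (forall l, 0 < a l <= 1) ->
  (forall l, 1 - D * r ^+ l <= a l) ->
  exists2 c, 0 < c & forall n, c <= \prod_(0 <= l < n) a l.
Proof.
move=> D0 /andP[r0 r1] a01 ar.
have prod_ge (u : nat -> R) (s : seq nat) : (forall l, 0 <= u l <= 1) ->
    1 - \sum_(l <- s) (1 - u l) <= \prod_(l <- s) u l <= 1.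
  move=> u01; elim: s => [|l s /andP[IH1 IH2]]; first by rewrite !big_nil subr0 lexx.
  rewrite !big_cons; have /andP[u0 u1] := u01 l; apply/andP; split; last first.
    by apply: mulr_ile1 => //; apply: prodr_ge0 => i _; case/andP: (u01 i).
  set S := \sum_(_ <- _) _ in IH1 *; set P := \prod_(_ <- _) _ in IH1 IH2 *.
  have S0 : 0 <= S by apply: sumr_ge0 => i _; rewrite subr_ge0; case/andP: (u01 i).
  have : u l * (1 - S) <= u l * P by rewrite ler_wpM2l.
  have : u l * S <= S by rewrite ler_piMl.
  by rewrite mulrBr; lra.
have [L HL] : exists L, D * r ^+ L / (1 - r) <= 2^-1.
  have rr : 0 < 1 - r by rewrite subr_gt0.
  have [r00|rn0] := eqVneq r 0; first by exists 1%N; rewrite r00 expr1 mulr0 mul0r invr_ge0.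
  have rp : 0 < r by rewrite lt0r rn0.
  have ri : 1 < r^-1 by rewrite invf_gt1.
  have [L HL] := exists_expr_gt (2 * D / (1 - r)) ri; exists L.
  move: HL; rewrite ltr_pdivrMr// exprVn [ltRHS]mulrC ltr_pdivlMr ?exprn_gt0// => HL.
  by rewrite ler_pdivrMr//; move: HL; lra.
exists (\prod_(0 <= l < L) a l * 2^-1).
  by rewrite mulr_gt0// prodr_gt0// => l _; case/andP: (a01 l).
move=> n; have a01' l : 0 <= a l <= 1 by case/andP: (a01 l) => /ltW -> ->.
have [nL|Ln] := leqP n L.
  rewrite (big_cat_nat (leq0n n) nL) /= -mulrA ler_piMr//.
    by apply: prodr_ge0 => l _; case/andP: (a01' l).
  have /andP[P0 P1] : 0 <= \prod_(n <= l < L) a l <= 1.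
    rewrite prodr_ge0//=; last by move=> l _; case/andP: (a01' l).
    by have /andP[] := prod_ge a (index_iota n L) a01'.
  by move: P0 P1; lra.
rewrite (big_cat_nat (leq0n L) (ltnW Ln)) /= ler_wpM2l//.
  by apply: prodr_ge0 => l _; case/andP: (a01' l).
have /andP[H _] := prod_ge a (index_iota L n) a01'; apply: le_trans H.
have rr : 0 < 1 - r by rewrite subr_gt0.
have : \sum_(L <= l < n) (1 - a l) <= D * r ^+ L / (1 - r); last by move: HL; lra.
apply: le_trans (_ : \sum_(L <= l < n) D * r ^+ l <= _).
  by apply: ler_sum => l _; have := ar l; lra.
rewrite -mulr_sumr -mulrA ler_wpM2l// -{1}[L]add0n big_addn big_mkord.
under eq_bigr do rewrite exprD.
by rewrite -mulr_suml mulrC ler_wpM2l ?exprn_ge0// geometric_sum_le// r0 r1.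
Qed.

(** * The Fourier transform of the law of the digit sums *)

Section fourier.
Context (R : realType) (beta : R) (m : nat).
Hypotheses (pis : pisot beta) (betam : beta < m%:R).
Hypothesis ndiv : ~ (exists2 b : nat, beta = b%:R & (b %| m)%N).

Local Notation X := (digit_sums beta m).
Local Notation kap := (I_len beta m).
Local Notation psi := (@centered_cos_sum R m).

Let beta1 : 1 < beta. Proof. by case: pis. Qed.
Let beta0 : 0 < beta. Proof. exact: lt_trans beta1. Qed.
Let betan0 n : 0 < beta ^+ n. Proof. exact: exprn_gt0. Qed.
Let m0 : (0 < m)%N. Proof. by rewrite -(ltr_nat R) (lt_trans beta0). Qed.
Let mR0 : 0 < m%:R :> R. Proof. by rewrite ltr0n. Qed.

(** Half the length of the range $[0,\kappa(\beta^k-1)]$ of the digit sums; subtracting it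
    centres each digit. *)
Definition digit_sums_mean k : R := kap / 2 * (beta ^+ k - 1).
Local Notation mean := digit_sums_mean.

(** The digits being independent, the Fourier transform of the law factorises. *)
Lemma sum_cos_digit_sums w k :
  \sum_(s <- X k) cos (2 * pi * w * (s - mean k)) = \prod_(0 <= j < k) psi (w * beta ^+ j).
Proof.
elim: k w => [|k IH] w.
  by rewrite big_seq1 /mean expr0 subrr mulr0 subr0 mulr0 cos0 big_geq.
rewrite big_nat_recl// expr0 mulr1 /= big_allpairs_dep.
under eq_bigr => s _.
  rewrite (_ : iota 0 m = index_iota 0 m); last by rewrite /index_iota subn0.
  under eq_bigr => i _.
    have -> : 2 * pi * w * (beta * s + i%:R - mean k.+1) =
       2 * pi * (w * beta) * (s - mean k) + 2 * pi * w * (i%:R - (m%:R - 1) / 2).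
      have E := I_lenE m beta1; rewrite /mean exprS.
      have -> : m%:R - 1 = beta * kap - kap by rewrite E; ring.
      by field.
    over.
  rewrite sum_centered_cosD; over.
rewrite -mulr_suml IH mulrC; congr (_ * _).
by apply: eq_bigr => j _; rewrite exprS mulrA.
Qed.

(** A zero t of the trigonometric sum has $mt\in\mathbb Z$. For $t = \beta^{\pm l}$ this
    contradicts irrationality of the powers of $\beta$ if $\beta$ is not an integer; if
    it is, $t = \beta^{-l}$ with $mt\in\mathbb Z$ would make $\beta$ divide m. *)
Lemma centered_cos_sum_power_neq0 l : psi (beta ^+ l) != 0 /\ psi (beta ^- l.+1) != 0.
Proof.
have natP (k : nat) : psi k%:R != 0.
  by rewrite -normr_gt0 norm_centered_cos_sum_nat.
have [[b bE]|nb] := pselect (exists b : nat, beta = b%:R).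
  split; first by rewrite bE -natrX.
  apply: centered_cos_sum_neq0 => // [|k]; first by rewrite invr_ge0 ltW.
  apply/negP => /eqP mk; apply: ndiv; exists b => //.
  have : m%:R = (k * b ^ l.+1)%:R :> R.
    by rewrite natrM natrX -bE -mk mulfVK// gt_eqF.
  by move=> /eqP; rewrite eqr_nat => /eqP ->; rewrite expnS mulnCA dvdn_mulr.
split.
  case: l => [|l]; first by rewrite expr0 -[1]/(1%:R).
  apply: centered_cos_sum_neq0 => // [|k]; first exact: ltW.
  by rewrite !pmulrn; apply: pisot_power_irrational => //; rewrite -lt0n.
apply: centered_cos_sum_neq0 => // [|k]; first by rewrite invr_ge0 ltW.
apply/negP => /eqP mk.
have mE : k%:R * beta ^+ l.+1 = m%:R by rewrite -mk mulfVK// gt_eqF.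
have k0 : k%:Z != 0.
  by apply/eqP => -[k00]; move: mE mR0; rewrite k00 mul0r => <-; rewrite ltxx.
have := @pisot_power_irrational _ _ pis nb l.+1 m%:Z k%:Z (ltn0Sn _) k0.
by rewrite -!pmulrn mE eqxx.
Qed.

(** Erdos' argument: the powers of $\beta$ are exponentially close to integers, so the
    factors of the Fourier transform at these frequencies are close to m in modulus,
    fast enough for their product over $m^k$ not to tend to 0. *)
Lemma fourier_lower_bound : exists2 c : R, 0 < c & forall n k, (n <= k)%N ->
  c * m%:R ^+ k <= `|\sum_(s <- X k) cos (2 * pi * (beta ^+ n / beta ^+ k) * (s - mean k))|.
Proof.
have [D [r [D0 /andP[r0 r1] Dr]]] := pisot_powers_near_integers pis.
have near l : exists k : nat, `|beta ^+ l - k%:R| <= D * r ^+ l.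
  have [z zl] := Dr l; case: z zl => z zl; first by exists z.
  exists 0%N; apply: le_trans zl; rewrite subr0 NegzE rmorphN /= opprK.
  have h : 0 <= beta ^+ l by exact: ltW.
  by rewrite (ger0_norm h) ger0_norm ?lerDl ?addr_ge0// ler0z.
pose a l := `|psi (beta ^+ l)| / m%:R.
pose b l := `|psi (beta ^- l.+1)| / m%:R.
have bd (f : R) : f != 0 -> `|f| <= m%:R -> 0 < `|f| / m%:R <= 1.
  by move=> f0 fm; rewrite divr_gt0 ?normr_gt0//= ler_pdivrMr// mul1r.
have pi0 := pi_ge0 R.
have [c1 c10 Hc1] : exists2 c, 0 < c & forall n, c <= \prod_(0 <= l < n) a l.
  apply: (@prod_ge_geometric _ _ (2 * pi * m%:R * D) r).
  - by rewrite !mulr_ge0.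
  - by rewrite r0 r1.
  - by move=> l; apply: bd; [have [] := centered_cos_sum_power_neq0 l|exact: centered_cos_sum_le].
  move=> l; have [k kl] := near l; rewrite /a ler_pdivlMr//.
  have -> : beta ^+ l = k%:R + (beta ^+ l - k%:R) by ring.
  rewrite norm_centered_cos_sumD; apply: le_trans (ler_norm _).
  apply: le_trans (centered_cos_sum_ge _ m0); rewrite mulrC ler_pM2l// lerB//.
  by rewrite -!mulrA !ler_wpM2l.
have [c2 c20 Hc2] : exists2 c, 0 < c & forall n, c <= \prod_(0 <= l < n) b l.
  apply: (@prod_ge_geometric _ _ (2 * pi * m%:R) beta^-1).
  - by rewrite !mulr_ge0.
  - by rewrite invr_ge0 ltW//= invf_lt1.
  - by move=> l; apply: bd; [have [] := centered_cos_sum_power_neq0 l|exact: centered_cos_sum_le].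
  move=> l; rewrite /b ler_pdivlMr//; apply: le_trans (ler_norm _).
  apply: le_trans (centered_cos_sum_ge _ m0); rewrite mulrC ler_pM2l// lerB//.
  rewrite ler_wpM2l ?mulr_ge0// ger0_norm ?invr_ge0 ?(ltW (betan0 _))// exprVn.
  by rewrite lef_pV2 ?posrE// ler_weXn2l// ltW.
exists (c2 * c1); first exact: mulr_gt0.
move=> n k nk; rewrite sum_cos_digit_sums normr_prod.
rewrite (eq_bigr (fun j => m%:R * (`|psi (beta ^+ n / beta ^+ k * beta ^+ j)| / m%:R))); last first.
  by move=> j _; rewrite [RHS]mulrC divfK// gt_eqF.
rewrite big_split /= prodr_const_nat subn0 mulrC ler_pM2l ?exprn_gt0//.
rewrite (big_cat_nat (leq0n (k - n)) (leq_subr _ _)) /=.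
have kb : beta ^+ k = beta ^+ (k - n) * beta ^+ n by rewrite -exprD subnK.
apply: ler_pM; rewrite ?(ltW c10) ?(ltW c20)//.
  rewrite big_nat_rev /=; apply: le_trans (Hc2 (k - n)%N) _.
  rewrite le_eqVlt; apply/orP; left; apply/eqP; apply: eq_big_nat => l /andP[_ lk].
  rewrite /b add0n kb; congr (`|psi _| / _).
  have -> : beta ^+ (k - n) = beta ^+ l.+1 * beta ^+ (k - n - l.+1).
    by rewrite -exprD subnKC.
  by field; rewrite !gt_eqF.
rewrite -{1}[(k - n)%N]add0n big_addn subKn//.
apply: le_trans (Hc1 n) _; rewrite le_eqVlt; apply/orP; left; apply/eqP.
apply: eq_bigr => l _; rewrite /a; congr (`|psi _| / _).
by rewrite exprD kb; field; rewrite !gt_eqF.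
Qed.

End fourier.

(** * Lacunary sums in mean square *)

Section primitive.
Context (R : realType).
Implicit Types (x w : R) (f F : R -> R).

Lemma integral_primitive f F (a b : R) : a < b ->
  (forall x, is_derive x 1 F (f x)) -> continuous f ->
  (\int[@lebesgue_measure R]_(x in `[a, b]) (f x)%:E = (F b - F a)%:E)%E.
Proof.
move=> ab dF cf.
have cF : continuous F.
  by move=> x; apply: differentiable_continuous; apply/derivable1_diffP; exact: ex_derive.
rewrite EFinB; apply: continuous_FTC2 => //.
- exact: continuous_subspaceT.
- split; first by move=> x _; exact: ex_derive.
    by apply: cvg_at_right_filter; exact: cF.
  by apply: cvg_at_left_filter; exact: cF.
- by move=> x _; rewrite derive1E derive_val.
Qed.

Lemma sin_lipschitz (x y : R) : `|sin x - sin y| <= `|x - y|.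
Proof.
by rewrite -!cosBpihalf; apply: le_trans (cos_lipschitz _ _) _; rewrite opprB addrA subrK.
Qed.

(** A primitive of $\cos(w(x - x_0))$. *)
Definition cos_primitive (x0 w x : R) : R :=
  if w == 0 then x else sin (w * (x - x0)) / w.

Lemma is_derive_cos_primitive x0 w x :
  is_derive x 1 (cos_primitive x0 w) (cos (w * (x - x0))).
Proof.
rewrite /cos_primitive; have [->|w0] := eqVneq w 0.
  by rewrite mul0r cos0; exact: is_derive_id.
have dl : is_derive x (1 : R) (fun z => w * (z - x0)) w.
  by apply: is_derive_eq; rewrite subr0 -[RHS]mulr1.
have ds : is_derive x (1 : R) (fun z => sin (w * (z - x0))) (cos (w * (x - x0)) * w).
  by apply: is_derive1_comp.
have -> : (fun z => sin (w * (z - x0)) / w) = w^-1 *: (fun z => sin (w * (z - x0))).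
  by apply/funext => z; rewrite /= mulrC.
by apply: is_derive_eq; rewrite /GRing.scale /= mulrC mulfK.
Qed.

Lemma cos_primitive_le x0 w (a b : R) :
  `|cos_primitive x0 w b - cos_primitive x0 w a| <= `|b - a|.
Proof.
rewrite /cos_primitive; case: eqVneq => // w0.
rewrite -mulrBl normrM normfV ler_pdivrMr ?normr_gt0//.
apply: le_trans (sin_lipschitz _ _) _.
by rewrite -mulrBr normrM mulrC opprB addrA subrK.
Qed.

Lemma cos_primitive_le_inv x0 w (a b : R) : w != 0 ->
  `|cos_primitive x0 w b - cos_primitive x0 w a| <= 2 / `|w|.
Proof.
move=> w0; rewrite /cos_primitive (negbTE w0) -mulrBl normrM normfV.
rewrite ler_pM2r ?invr_gt0 ?normr_gt0//.
apply: le_trans (ler_normB _ _) _.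
by rewrite -[leRHS]/(1 + 1); apply: lerD; exact: sin_max.
Qed.

End primitive.

Section lacunary.
Context (R : realType) (beta : R).
Hypothesis beta1 : 1 < beta.
Let beta0 : 0 < beta. Proof. exact: lt_trans beta1. Qed.

Definition lacunary (N : nat) (sigma : nat -> R) (x0 x : R) : R :=
  \sum_(n < N) sigma n * cos (2 * pi * beta ^+ n * (x - x0)).

Lemma continuous_lacunary N sigma x0 : continuous (lacunary N sigma x0).
Proof.
elim: N => [|N IH] x.
  rewrite (_ : lacunary 0 sigma x0 = cst 0); first exact: cvg_cst.
  by apply/funext => z; rewrite /lacunary big_ord0.
rewrite (_ : lacunary N.+1 sigma x0 = fun z => lacunary N sigma x0 z +
    sigma N * cos (2 * pi * beta ^+ N * (z - x0))).
  apply: cvgD; first exact: IH.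
  apply: cvgMr; apply: (@continuous_comp _ _ _ (fun z => 2 * pi * beta ^+ N * (z - x0)) cos).
    by apply: cvgMr; apply: cvgB; [exact: cvg_id|exact: cvg_cst].
  exact: continuous_cos.
by apply/funext => z; rewrite /lacunary big_ord_recr.
Qed.

Let u : R := Num.sqrt beta^-1.

Let u01 : 0 <= u < 1.
Proof.
rewrite sqrtr_ge0 /= -[ltRHS]sqrtr1 ltr_sqrt ?ltr01//.
by rewrite invf_lt1.
Qed.

(** The frequencies $\beta^n$ being lacunary, the off-diagonal terms of the square
    have a bounded total. *)
Lemma lacunary_off_diagonal n l : n != l ->
  `|beta ^+ n - beta ^+ l|^-1 <= beta / (beta - 1) * (u ^+ n * u ^+ l).
Proof.
wlog nl : n l / (l < n)%N.
  move=> H nl; have [ln|] := ltnP l n; first exact: H.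
  rewrite leq_eqVlt (negbTE nl) /= => /H; rewrite distrC mulrC [u ^+ l * _]mulrC mulrC.
  by apply; rewrite eq_sym.
move=> _; have bn : beta ^+ l <= beta ^+ n / beta.
  rewrite ler_pdivlMr// -exprSr ler_eXn2l//.
have b1 : 0 < beta - 1 by rewrite subr_gt0.
have bn0 : 0 < beta ^+ n by exact: exprn_gt0.
have d0 : beta ^+ n * ((beta - 1) / beta) <= beta ^+ n - beta ^+ l.
  have -> : beta ^+ n * ((beta - 1) / beta) = beta ^+ n - beta ^+ n / beta.
    by field; rewrite gt_eqF.
  by rewrite lerB.
have e0 : 0 < beta ^+ n * ((beta - 1) / beta) by rewrite mulr_gt0// divr_gt0.
have d1 := lt_le_trans e0 d0.
rewrite gtr0_norm//; apply: le_trans (_ : (beta ^+ n * ((beta - 1) / beta))^-1 <= _).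
  by rewrite lef_pV2 ?posrE.
rewrite invfM invf_div mulrC ler_wpM2l ?divr_ge0 ?(ltW b1) ?(ltW beta0)//.
have /andP[u0 u1] := u01.
have -> : (beta ^+ n)^-1 = u ^+ n * u ^+ n.
  by rewrite -expr2 exprAC sqr_sqrtr ?exprVn// invr_ge0 ltW.
by rewrite ler_wpM2l ?exprn_ge0// ler_wiXn2l ?(ltW u1)// ltnW.
Qed.

Definition lacunary_const : R := beta / (beta - 1) / (1 - u) ^+ 2.

(** Expand the square. The diagonal contributes at most NL, and the integrals of the
    other products of cosines, of order $1/|\beta^n-\beta^l|$, have a bounded sum. *)
Lemma integral_lacunary (N : nat) (sigma : nat -> R) (x0 L : R) :
  (forall n, `|sigma n| <= 1) -> 0 < L ->
  (\int[@lebesgue_measure R]_(x in `[0%R, L]) ((lacunary N sigma x0 x) ^+ 2)%R%:E <=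
    (N%:R * L + lacunary_const)%R%:E)%E.
Proof.
move=> s1 L0; pose w n : R := 2 * pi * beta ^+ n.
pose c n l : R := sigma n * sigma l / 2.
pose F x := \sum_(n < N) \sum_(l < N) c n l *
  (cos_primitive x0 (w n - w l) x + cos_primitive x0 (w n + w l) x).
have dF (x : R) : is_derive x (1 : R) F (lacunary N sigma x0 x ^+ 2).
  have dP (a : R) : is_derive x (1 : R) (cos_primitive x0 a) (cos (a * (x - x0))).
    exact: is_derive_cos_primitive.
  have -> : F = \sum_(n < N) \sum_(l < N) (c n l *:
      (cos_primitive x0 (w n - w l) + cos_primitive x0 (w n + w l))).
    by apply/funext => z; rewrite fct_sumE; apply: eq_bigr => n _; rewrite fct_sumE.
  apply: is_derive_eq.
  rewrite expr2 /lacunary big_distrlr /=; apply: eq_bigr => n _; apply: eq_bigr => l _.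
  rewrite /GRing.scale /= mulrBl mulrDl cosB cosD /c -/(w n) -/(w l). by field.
have cf : continuous (fun x => lacunary N sigma x0 x ^+ 2).
  by move=> y; under eq_fun do rewrite expr2; apply: cvgM; exact: continuous_lacunary.
rewrite (integral_primitive L0 dF cf) lee_fin.
have {}dF : F L - F 0 = \sum_(n < N) \sum_(l < N) c n l *
  ((cos_primitive x0 (w n - w l) L - cos_primitive x0 (w n - w l) 0) +
   (cos_primitive x0 (w n + w l) L - cos_primitive x0 (w n + w l) 0)).
  rewrite -sumrB; apply: eq_bigr => n _; rewrite -sumrB; apply: eq_bigr => l _.
  by rewrite -mulrBr opprD addrACA.
have pi2 : 2 <= pi :> R := pi_ge2 R.
have bnd n l : c n l *
  ((cos_primitive x0 (w n - w l) L - cos_primitive x0 (w n - w l) 0) +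
   (cos_primitive x0 (w n + w l) L - cos_primitive x0 (w n + w l) 0)) <=
   (n == l)%:R * L + beta / (beta - 1) * (u ^+ n * u ^+ l).
  set A := cos_primitive _ _ L - _; set B := cos_primitive _ _ L - _.
  have c2 : `|c n l| <= 2^-1.
    have h2 : `|2^-1 : R| = 2^-1 by rewrite ger0_norm.
    by rewrite /c !normrM h2 -[leRHS]mul1r ler_wpM2r// mulr_ile1.
  apply: le_trans (ler_norm _) _; rewrite normrM.
  have : `|A + B| <= 2 * ((n == l)%:R * L + beta / (beta - 1) * (u ^+ n * u ^+ l)); last first.
    move=> AB; apply: le_trans (_ : 2^-1 * `|A + B| <= _); first by rewrite ler_wpM2r.
    by move: AB; lra.
  apply: le_trans (ler_normD _ _) _.
  have /andP[u0 u1] := u01; have b1 : 0 < beta - 1 by rewrite subr_gt0.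
  have [nl|nl] := eqVneq n l.
    have uu0 : 0 <= beta / (beta - 1) * (u ^+ n * u ^+ l).
      by rewrite mulr_ge0 ?divr_ge0 ?mulr_ge0 ?exprn_ge0 ?(ltW beta0) ?(ltW b1).
    have A1 : `|A| <= L by rewrite -[leRHS](gtr0_norm L0) -[L in leRHS]subr0 cos_primitive_le.
    have B1 : `|B| <= L by rewrite -[leRHS](gtr0_norm L0) -[L in leRHS]subr0 cos_primitive_le.
    by rewrite /= mul1r; move: A1 B1 uu0; lra.
  rewrite /= mul0r add0r; have off := lacunary_off_diagonal nl.
  have d0 : 0 < `|beta ^+ n - beta ^+ l|.
    by rewrite normr_gt0 subr_eq0; apply: contra nl => /eqP /(ieexprIn beta0) ->//; rewrite gt_eqF.
  have key (v : R) : 2 * `|beta ^+ n - beta ^+ l| <= `|v| ->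
      2 / `|v| <= `|beta ^+ n - beta ^+ l|^-1.
    move=> h; have v0 : 0 < `|v| by apply: lt_le_trans h; rewrite mulr_gt0.
    rewrite ler_pdivrMr// mulrC ler_pdivlMr//.
  have v1 : 2 * `|beta ^+ n - beta ^+ l| <= `|w n - w l|.
    rewrite /w -mulrBr normrM ger0_norm ?mulr_ge0 ?pi_ge0// ler_wpM2r//; lra.
  have v2 : 2 * `|beta ^+ n - beta ^+ l| <= `|w n + w l|.
    rewrite /w -mulrDr normrM ger0_norm ?mulr_ge0 ?pi_ge0//; apply: ler_pM => //; first by lra.
    have bn : 0 < beta ^+ n by exact: exprn_gt0.
    have bl : 0 < beta ^+ l by exact: exprn_gt0.
    by rewrite [leRHS]gtr0_norm ?addr_gt0// ler_norml; apply/andP; split; lra.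
  have nz (v : R) : 2 * `|beta ^+ n - beta ^+ l| <= `|v| -> v != 0.
    by move=> h; rewrite -normr_gt0; apply: lt_le_trans h; rewrite mulr_gt0.
  have A1 := le_trans (cos_primitive_le_inv x0 0 L (nz _ v1)) (key _ v1).
  have B1 := le_trans (cos_primitive_le_inv x0 0 L (nz _ v2)) (key _ v2).
  by rewrite -/A in A1; rewrite -/B in B1; lra.
rewrite dF; apply: (@le_trans _ _ (\sum_(n < N) \sum_(l < N)
    (((n : nat) == l)%:R * L + beta / (beta - 1) * (u ^+ n * u ^+ l)))).
  by apply: ler_sum => n _; apply: ler_sum => l _; exact: bnd.
under eq_bigr do rewrite big_split /= -mulr_suml -!mulr_sumr.
rewrite big_split /= -mulr_suml; apply: lerD.
  rewrite ler_wpM2r ?(ltW L0)//.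
  apply: le_trans (_ : \sum_(n < N) 1 <= _); last by rewrite sumr_const card_ord.
  apply: ler_sum => n _; rewrite (bigD1 n)//= eqxx big1 ?addr0// => l ln.
  by rewrite eq_sym -[_ == _]/(l == n) (negbTE ln).
rewrite -mulr_sumr -mulr_suml /lacunary_const.
have b1 : 0 < beta - 1 by rewrite subr_gt0.
rewrite ler_wpM2l ?divr_ge0 ?(ltW beta0) ?(ltW b1)//.
have su := geometric_sum_le N u01; have /andP[u0 u1] := u01.
have s0 : 0 <= \sum_(n < N) u ^+ n by apply: sumr_ge0 => n _; exact: exprn_ge0.
by rewrite -exprVn expr2 ler_pM.
Qed.

End lacunary.

(** * Concentrated laws have small half moments *)

Lemma lacunary_lipschitz (R : realType) (beta : R) (N : nat) (sigma : nat -> R) (x0 x y : R) :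
  1 < beta -> (forall n, `|sigma n| <= 1) ->
  `|lacunary beta N sigma x0 x - lacunary beta N sigma x0 y| <=
    N%:R * (2 * pi * beta ^+ N) * `|x - y|.
Proof.
move=> beta1 s1; rewrite /lacunary -sumrB; apply: le_trans (ler_norm_sum _ _ _) _.
have beta0 : 0 <= beta by rewrite ltW// (lt_trans ltr01).
have -> : N%:R * (2 * pi * beta ^+ N) * `|x - y| =
    \sum_(n < N) (2 * pi * beta ^+ N * `|x - y|).
  by rewrite sumr_const card_ord -mulrA mulr_natl.
apply: ler_sum => n _; rewrite -mulrBr normrM -[leRHS]mul1r.
apply: ler_pM => //; apply: le_trans (cos_lipschitz _ _) _.
rewrite -mulrBr opprB addrA subrK normrM ler_wpM2r//.
rewrite ger0_norm; last by rewrite !mulr_ge0 ?pi_ge0 ?exprn_ge0.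
rewrite ler_wpM2l ?mulr_ge0 ?pi_ge0// ler_weXn2l//; [exact: ltW|exact: ltnW].
Qed.

Section singularity.
Context (R : realType) (beta : R) (m : nat) (delta : R).
Hypotheses (beta1 : 1 < beta) (betam : beta < m%:R).
Hypotheses (delta0 : 0 < delta) (sep : sums_separated beta m delta).

Local Notation X := (digit_sums beta m).
Local Notation kap := (I_len beta m).
Local Notation leb := (@lebesgue_measure R).
Local Notation C := (remainder_bound beta m delta).
Local Notation half_moment := (half_moment beta m).

Let beta0 : 0 < beta. Proof. exact: lt_trans beta1. Qed.
Let betan0 n : 0 < beta ^+ n. Proof. exact: exprn_gt0. Qed.
Let kap0 : 0 < kap := I_len_gt0 beta1 betam.
Let C0 : 0 < C. Proof. exact: lt_le_trans (remainder_bound_ge1 beta1 betam delta0). Qed.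
Let m0 : (0 < m)%N. Proof. by rewrite -(ltr_nat R) (lt_trans beta0). Qed.
Let mR0 : 0 < m%:R :> R. Proof. by rewrite ltr0n. Qed.

(** A large sieve inequality: the points $s\beta^{-k}$ are separated by
    $\delta\beta^{-k}$, so that a sum over them compares with an integral. *)
Lemma sum_sqr_lacunary : exists2 K : R, 0 < K & forall N, (0 < N)%N ->
  exists k0, forall k sigma x0, (k0 <= k)%N -> (forall n, `|sigma n| <= 1) ->
  \sum_(s <- undup (X k)) lacunary beta N sigma x0 (s / beta ^+ k) ^+ 2 <= K * N%:R * beta ^+ k.
Proof.
pose L := kap + delta; have L0 : 0 < L by rewrite addr_gt0.
have b1 : 0 < beta - 1 by rewrite subr_gt0.
have K00 : 0 <= lacunary_const beta.
  by rewrite /lacunary_const !divr_ge0 ?sqr_ge0// ltW.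
exists (2 * (2 * L + lacunary_const beta) / delta).
  by rewrite divr_gt0// mulr_gt0// ltr_wpDr// mulr_gt0.
move=> N N0; have [k0 Hk0] := exists_expr_gt (N%:R * (2 * pi * beta ^+ N) * delta) beta1.
exists k0 => k sigma x0 kk0 s1; set A := lacunary beta N sigma x0.
have bk1 : 1 <= beta ^+ k by rewrite exprn_ege1// ltW.
pose J s : set R := `[s / beta ^+ k, (s + delta) / beta ^+ k[%classic.
have JP s x : J s x -> s <= x * beta ^+ k < s + delta.
  by rewrite /J /= in_itv/= ler_pdivrMr// ltr_pdivlMr.
have Aclose s x : J s x -> A (s / beta ^+ k) ^+ 2 / 2 <= A x ^+ 2 + 1.
  move=> /JP /andP[x1 x2].
  have : `|A (s / beta ^+ k) - A x| <= 1.
    apply: le_trans (@lacunary_lipschitz R beta N sigma x0 _ _ beta1 s1) _.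
    have d : `|s / beta ^+ k - x| <= delta / beta ^+ k.
      have -> : s / beta ^+ k - x = (s - x * beta ^+ k) / beta ^+ k by field; rewrite gt_eqF.
      rewrite normrM normfV (gtr0_norm (betan0 k)) ler_pM2r ?invr_gt0// ler_norml.
      by apply/andP; split; move: delta0; lra.
    apply: le_trans (_ : N%:R * (2 * pi * beta ^+ N) * (delta / beta ^+ k) <= _).
      by rewrite ler_wpM2l// !mulr_ge0 ?pi_ge0 ?exprn_ge0 ?(ltW beta0).
    rewrite mulrA ler_pdivrMr// mul1r (le_trans (ltW Hk0))//.
    by rewrite ler_weXn2l// ltW.
  rewrite ler_norml => /andP[h1 h2].
  set a := A _ in h1 h2 *; set b := A x in h1 h2 *.
  have : (a - b) ^+ 2 <= 1 by rewrite -[leLHS]real_normK ?num_real// expr_le1// ler_norml h1 h2.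
  have := sqr_ge0 (a - 2 * b); rewrite !expr2; lra.
have Jdisj s t x : s \in X k -> t \in X k -> J s x -> J t x -> s = t.
  move=> sX tX /JP/andP[? ?] /JP/andP[? ?]; apply: contrapT => /eqP st.
  have := sep sX tX st; rewrite leNgt ltr_norml => /negP; apply.
  by apply/andP; split; lra.
have mJ s : measurable (J s) by exact: measurable_itv.
have JL s x : s \in X k -> J s x -> 0 <= x <= L.
  move=> /(digit_sums_itv beta1) /andP[s0 sk] /JP/andP[x1 x2].
  have x0' : 0 <= x by rewrite -(pmulr_lge0 _ (betan0 k)) (le_trans s0).
  rewrite x0' /= -(ler_pM2r (betan0 k)) (le_trans (ltW x2))//.
  have : delta <= delta * beta ^+ k by rewrite ler_peMr// ltW.
  by rewrite /L mulrDl; move: sk; rewrite mulrBr mulr1; move: kap0; lra.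
pose f x := \sum_(s <- undup (X k)) (A (s / beta ^+ k) ^+ 2 / 2) * \1_(J s) x.
have fA x : f x <= A x ^+ 2 + 1.
  have [[s sX Jx]|nJ] := pselect (exists2 s, s \in X k & J s x); last first.
    rewrite /f big1_seq ?addr_ge0 ?sqr_ge0// => s /andP[_]; rewrite mem_undup => sX.
    by rewrite indicE memNset ?mulr0// => Jx; apply: nJ; exists s.
  rewrite /f (bigD1_seq s) ?undup_uniq ?mem_undup//= big1_seq ?addr0.
    by rewrite indicE mem_set// mulr1 Aclose.
  move=> t /andP[ts]; rewrite mem_undup => tX.
  by rewrite indicE memNset ?mulr0// => Jt; move/eqP: ts; apply; exact: Jdisj Jt Jx.
have int : (\int[leb]_(x in `[0%R, L]) (f x)%:E <=
    \int[leb]_(x in `[0%R, L]) ((A x ^+ 2)%:E + 1))%E.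
  apply: ge0_le_integral => //.
  - by move=> x _; rewrite lee_fin; apply: sumr_ge0 => s _; rewrite mulr_ge0// divr_ge0 ?sqr_ge0//.
  - apply/measurable_EFinP; apply: measurable_sum => s; apply: measurable_funM => //.
    by apply: measurable_indic; exact: mJ.
  - apply/measurable_EFinP; apply: measurable_funD => //; apply: measurable_funX.
    by apply: measurable_funTS; apply: continuous_measurable_fun; exact: continuous_lacunary.
  - by move=> x _; rewrite -EFinD lee_fin fA.
move: int; rewrite ge0_integralD//=; last 2 first.
- by move=> x _; rewrite lee_fin sqr_ge0.
- apply/measurable_EFinP; apply: measurable_funX.
  by apply: measurable_funTS; apply: continuous_measurable_fun; exact: continuous_lacunary.
rewrite integral_cst//= lebesgue_measure_itv/= lte_fin L0 -EFinB subr0 mul1e => int.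
have := le_trans int (leeD2r _ (integral_lacunary beta1 N x0 s1 L0)).
under eq_integral => x _ do rewrite /f -sumEFin.
rewrite ge0_integral_sum//=; last 2 first.
- move=> s; apply/measurable_EFinP; apply: measurable_funM => //.
  by apply: measurable_indic; exact: mJ.
- by move=> s x _; rewrite lee_fin mulr_ge0// divr_ge0 ?sqr_ge0.
rewrite (eq_big_seq (fun s => (A (s / beta ^+ k) ^+ 2 / 2 * (delta / beta ^+ k))%:E)); last first.
  move=> s; rewrite mem_undup => sX.
  under eq_integral do rewrite EFinM.
  rewrite ge0_integralZl//=; last 2 first.
  - by apply/measurable_EFinP; apply: measurable_indic; exact: mJ.
  - by rewrite lee_fin divr_ge0 ?sqr_ge0.
  rewrite integral_indic//; last exact: mJ.
  have -> : J s `&` `[0%R, L]%classic = J s.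
    by apply/seteqP; split=> x [] // Jx; split=> //=; rewrite in_itv/=; exact: JL Jx.
  rewrite /= /J lebesgue_measure_itv/= lte_fin ltr_pM2r ?invr_gt0// ltrDl delta0 -EFinB -EFinM.
  by congr (_ * _)%:E; field; rewrite gt_eqF.
rewrite sumEFin -EFinD lee_fin -mulr_suml -mulr_suml.
set S := \sum_(_ <- _) _ => H.
have N1 : 1 <= N%:R :> R by rewrite ler1n.
have H2 : S / 2 * (delta / beta ^+ k) <= N%:R * (2 * L + lacunary_const beta).
  have h1 : lacunary_const beta <= N%:R * lacunary_const beta by rewrite ler_peMl.
  have h2 : L <= N%:R * L by rewrite ler_peMl// ltW.
  by apply: le_trans H _; move: h1 h2; lra.
have -> : S = S / 2 * (delta / beta ^+ k) * (2 / delta * beta ^+ k).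
  by field; rewrite !gt_eqF.
have -> : 2 * (2 * L + lacunary_const beta) / delta * N%:R * beta ^+ k =
  N%:R * (2 * L + lacunary_const beta) * (2 / delta * beta ^+ k).
  by field; rewrite gt_eqF.
by rewrite ler_wpM2r// mulr_ge0 ?divr_ge0 ?ltW.
Qed.

(** How singular the law of the digit sums is at one scale: as there are at most
    $C\beta^k$ digit sums, this is restrictive when eta is small against C. *)
Definition concentrated (eta q : R) := exists2 k, (0 < k)%N & exists2 Q : pred R,
  (count Q (undup (X k)))%:R <= eta * beta ^+ k &
  (count (predC Q) (X k))%:R <= q * m%:R ^+ k.

(** Independence of two successive blocks squares the proportion that is missed. *)
Lemma concentrated_double eta q : 0 <= eta -> concentrated eta q ->
  concentrated (2 * C * eta) (q ^+ 2).
Proof.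
move=> eta0 [k k0 [Q Qk nQ]]; exists (k + k)%N; first by rewrite addn_gt0 k0.
pose S := undup (X k).
pose f s t := beta ^+ k * s + t.
pose SQ := [seq s <- S | Q s].
pose l := [seq f s t | s <- SQ, t <- S] ++ [seq f s t | s <- S, t <- SQ].
have lP s t : s \in X k -> t \in X k -> Q s || Q t -> f s t \in l.
  move=> sX tX /orP[Qs|Qt]; rewrite mem_cat; apply/orP; [left|right].
    by apply: allpairs_f; rewrite ?mem_filter ?Qs mem_undup.
  by apply: allpairs_f; rewrite ?mem_filter ?Qt mem_undup.
exists (mem l).
  apply: le_trans (_ : (size l)%:R <= _).
    rewrite ler_nat -size_filter; apply: uniq_leq_size; first by rewrite filter_uniq ?undup_uniq.
    by move=> u; rewrite mem_filter => /andP[].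
  rewrite size_cat !size_allpairs size_filter -/S natrD !natrM.
  have SC := size_distinct_sums beta1 betam delta0 sep k; rewrite -/S in Qk SC.
  have b0 : 0 <= beta ^+ k by exact: ltW.
  have QS : (count Q S)%:R * (size S)%:R <= (eta * beta ^+ k) * (C * beta ^+ k).
    by apply: ler_pM.
  by rewrite [(size S)%:R * _]mulrC exprD; move: QS; lra.
rewrite -sum1_count big_mkcond natr_sum big_digit_sumsD.
have -> : q ^+ 2 * m%:R ^+ (k + k) = (q * m%:R ^+ k) * (q * m%:R ^+ k).
  by rewrite exprD expr2; ring.
apply: le_trans (_ : (count (predC Q) (X k))%:R * (count (predC Q) (X k))%:R <= _); last first.
  by apply: ler_pM.
rewrite -sum1_count [in leRHS]big_mkcond natr_sum mulr_suml !big_seq.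
apply: ler_sum => s sX; rewrite mulr_sumr !big_seq; apply: ler_sum => t tX.
rewrite -natrM ler_nat /=; case: ifPn => // nl.
have := contra (lP s t sX tX) nl; rewrite negb_or => /andP[-> ->] //.
Qed.

(** A concentrated law has a small half moment, by Cauchy--Schwarz on both parts. *)
Lemma half_moment_concentrated eta q : 0 <= eta -> 0 <= q -> eta <= 16^-1 -> C * q <= 16^-1 ->
  concentrated eta q ->
  exists2 k, (0 < k)%N & half_moment k ^+ 2 < (m%:R / beta) ^+ k.
Proof.
move=> eta0 q0 eta1 q1 [k k0 [Q Qk nQ]]; exists k => //.
pose c s : R := (count_mem s (X k))%:R.
have cs (P : pred R) : \sum_(s <- undup (X k) | P s) Num.sqrt (c s) <=
    Num.sqrt ((count P (undup (X k)))%:R * (count P (X k))%:R).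
  rewrite -big_filter; apply: le_trans (@sum_sqrt_le _ _ _ c _) _ => //.
  rewrite ler_wsqrtr// size_filter big_filter ler_wpM2l//.
  rewrite -[in leRHS]sum1_count natr_sum [leRHS](big_undup_count (X k) P (fun=> 1)).
  by apply: ler_sum.
have sq16 : Num.sqrt (16^-1 : R) = 4^-1.
  have -> : (16^-1 : R) = 4^-1 ^+ 2 by field.
  by rewrite sqrtr_sqr ger0_norm.
pose T : R := beta ^+ k * m%:R ^+ k.
have T0 : 0 <= T by rewrite mulr_ge0 ?exprn_ge0 ?ltW.
have bound (x : R) : x <= 16^-1 * T -> Num.sqrt x <= 4^-1 * Num.sqrt T.
  by move=> xT; rewrite -sq16 -sqrtrM// ler_wsqrtr.
have size_m : (size (X k))%:R = m%:R ^+ k :> R by rewrite size_digit_sums natrX.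
have p1 : \sum_(s <- undup (X k) | Q s) Num.sqrt (c s) <= 4^-1 * Num.sqrt T.
  apply: le_trans (cs Q) _; apply: bound; rewrite /T mulrA; apply: ler_pM => //.
    by apply: le_trans Qk _; rewrite ler_wpM2r// ltW.
  by rewrite -size_m ler_nat count_size.
have p2 : \sum_(s <- undup (X k) | ~~ Q s) Num.sqrt (c s) <= 4^-1 * Num.sqrt T.
  apply: le_trans (cs (predC Q)) _; apply: bound.
  apply: (@le_trans _ _ (C * beta ^+ k * (q * m%:R ^+ k))).
    apply: ler_pM => //; apply: le_trans (size_distinct_sums beta1 betam delta0 sep k).
    by rewrite ler_nat count_size.
  rewrite (_ : C * beta ^+ k * _ = (C * q) * T); last by rewrite /T; ring.
  by rewrite ler_wpM2r.
have hm : half_moment k <= 2^-1 * (Num.sqrt T / beta ^+ k).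
  rewrite /half_moment (bigID Q) /= mulrC ler_pdivrMr// -mulrA mulfVK ?gt_eqF//.
  by move: p1 p2; rewrite /c; lra.
have h0 : 0 <= half_moment k.
  by rewrite mulr_ge0 ?invr_ge0 ?(ltW (betan0 k))//; apply: sumr_ge0.
have mb0 : 0 < (m%:R / beta) ^+ k by rewrite exprn_gt0// divr_gt0.
apply: le_lt_trans (_ : (2^-1 * (Num.sqrt T / beta ^+ k)) ^+ 2 < _).
  by rewrite lerXn2r// nnegrE (le_trans h0).
rewrite !exprMn sqr_sqrtr// !exprVn.
have -> : T * (beta ^+ k) ^- 2 = (m%:R / beta) ^+ k.
  by rewrite /T expr_div_n; field; rewrite gt_eqF.
by rewrite -expr_div_n gtr_pMl// expr2; lra.
Qed.

(** Doubling often enough makes the missed proportion negligible; as this number of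
    doublings depends on q alone, the set can be chosen small enough beforehand. *)
Lemma half_moment_small q : 0 <= q < 1 -> (forall eta, 0 < eta -> concentrated eta q) ->
  exists2 k, (0 < k)%N & half_moment k ^+ 2 < (m%:R / beta) ^+ k.
Proof.
move=> /andP[q0 q1] conc.
have iter j eta : 0 <= eta -> concentrated eta q ->
    concentrated ((2 * C) ^+ j * eta) (q ^+ (2 ^ j)).
  move=> eta0 c0; elim: j => [|j IH]; first by rewrite expr0 mul1r.
  rewrite exprS -[X in concentrated X _]mulrA expnSr exprM; apply: concentrated_double IH.
  by rewrite mulr_ge0 ?exprn_ge0 ?mulr_ge0 ?(ltW C0).
have [j Hj] : exists j, C * q ^+ (2 ^ j) <= 16^-1.
  have [q00|qn0] := eqVneq q 0.
    by exists 0%N; rewrite q00 expr1 mulr0.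
  have qp : 0 < q by rewrite lt0r qn0.
  have qi : 1 < q^-1 by rewrite invf_gt1.
  have [n Hn] := exists_expr_gt (16 * C) qi.
  exists n; apply: le_trans (_ : C * q ^+ n <= _).
    by rewrite ler_wpM2l ?(ltW C0)// ler_wiXn2l ?(ltW q1)// ltnW// ltn_expl.
  by move: Hn; rewrite exprVn -[ltRHS]mul1r ltr_pdivlMr ?exprn_gt0//; lra.
have CC0 : 0 < (2 * C) ^+ j by rewrite exprn_gt0// mulr_gt0.
pose eta : R := 16^-1 / (2 * C) ^+ j; have eta0 : 0 < eta by rewrite divr_gt0.
apply: (@half_moment_concentrated ((2 * C) ^+ j * eta) (q ^+ (2 ^ j))) => //.
- by rewrite mulr_ge0 ?(ltW CC0) ?(ltW eta0).
- exact: exprn_ge0.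
- by rewrite /eta mulrC mulfVK ?gt_eqF.
- by apply: iter (conc _ eta0); exact: ltW.
Qed.

End singularity.

(** * Concentration in the Pisot case *)

Section strict.
Context (R : realType) (beta : R) (m : nat) (delta : R).
Hypotheses (pis : pisot beta) (betam : beta < m%:R).
Hypotheses (delta0 : 0 < delta) (sep : sums_separated beta m delta).
Hypothesis ndiv : ~ (exists2 b : nat, beta = b%:R & (b %| m)%N).

Local Notation X := (digit_sums beta m).
Local Notation C := (remainder_bound beta m delta).
Local Notation half_moment := (half_moment beta m).

Let beta1 : 1 < beta. Proof. by case: pis. Qed.
Let beta0 : 0 < beta. Proof. exact: lt_trans beta1. Qed.
Let betan0 n : 0 < beta ^+ n. Proof. exact: exprn_gt0. Qed.
Let m0 : (0 < m)%N. Proof. by rewrite -(ltr_nat R) (lt_trans beta0). Qed.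
Let mR0 : 0 < m%:R :> R. Proof. by rewrite ltr0n. Qed.

(** If no small set carried a proportion c/2 of the words, the law of the digit
    sums would up to mass c/2 have bounded density, and the averages of the cosines
    of frequencies $\beta^n$, which tend to 0 in mean square for Lebesgue measure,
    could not keep a mean of modulus c. *)
Lemma pisot_concentrated : exists2 q, 0 <= q < 1 &
  forall eta, 0 < eta -> concentrated beta m eta q.
Proof.
have [c c0 Hc] := fourier_lower_bound pis betam ndiv.
have c1 : c <= 1.
  have := Hc 0%N 0%N isT; rewrite expr0 mulr1 big_seq1 => /le_trans; apply.
  exact: cos_max.
exists (1 - c / 2); first by apply/andP; split; lra.
move=> eta eta0; have [K K0 HK] := sum_sqr_lacunary beta1 betam delta0 sep.
have e0 : 0 < eta * c / 2 by rewrite divr_gt0// mulr_gt0.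
pose N := (Num.truncn (C * K / (eta * c / 2) ^+ 2)).+1.
have NR0 : 0 < N%:R :> R by rewrite ltr0n.
have NP : C * K * N%:R <= (N%:R * (eta * c / 2)) ^+ 2.
  have H : C * K <= N%:R * (eta * c / 2) ^+ 2.
    by rewrite -ler_pdivrMr ?exprn_gt0//; exact: ltW (truncnS_gt _).
  rewrite (_ : (N%:R * _) ^+ 2 = N%:R * (eta * c / 2) ^+ 2 * N%:R); last by ring.
  by rewrite ler_pM2r.
have [k0 Hk0] := HK N (ltn0Sn _).
pose k := (maxn k0 N).+1; exists k => //.
pose E n := \sum_(s <- X k) cos (2 * pi * (beta ^+ n / beta ^+ k) * (s - digit_sums_mean beta m k)).
pose sigma n : R := if 0 <= E n then 1 else -1.
have sigma1 n : `|sigma n| <= 1 by rewrite /sigma; case: ifP; rewrite ?normrN1 ?normr1.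
pose x0 := digit_sums_mean beta m k / beta ^+ k.
pose A s := lacunary beta N sigma x0 (s / beta ^+ k).
have sumA : N%:R * (c * m%:R ^+ k) <= \sum_(s <- X k) A s.
  rewrite /A /lacunary exchange_big /=.
  rewrite (_ : N%:R * _ = \sum_(n < N) (c * m%:R ^+ k)); last first.
    by rewrite sumr_const card_ord mulr_natl.
  apply: ler_sum => n _; rewrite -mulr_sumr.
  have nk : (n <= k)%N by rewrite ltnW// ltnS (leq_trans (ltnW (ltn_ord n)))// leq_maxr.
  apply: le_trans (Hc n k nk) _; rewrite -/(E n).
  have -> : \sum_(s <- X k) cos (2 * pi * beta ^+ n * (s / beta ^+ k - x0)) = E n.
    apply: eq_bigr => s _; congr (cos _); rewrite /x0; field.
    by rewrite gt_eqF.
  rewrite /sigma; case: ifPn => [En|]; first by rewrite ger0_norm// mul1r.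
  by rewrite -ltNge => En; rewrite ltr0_norm// mulN1r.
have A1 s : `|A s| <= N%:R.
  apply: le_trans (ler_norm_sum _ _ _) _.
  apply: le_trans (_ : \sum_(n < N) (1 : R) <= _); last by rewrite sumr_const card_ord.
  apply: ler_sum => n _; rewrite normrM -[leRHS]mulr1; apply: ler_pM => //; exact: cos_max.
pose cs s : R := (count_mem s (X k))%:R.
pose lev := m%:R ^+ k / (eta * beta ^+ k).
have mk0 : 0 < m%:R ^+ k :> R by rewrite exprn_gt0.
have lev0 : 0 < lev by rewrite divr_gt0// mulr_gt0.
have size_m : (size (X k))%:R = m%:R ^+ k :> R by rewrite size_digit_sums natrX.
pose Q : pred R := fun s => lev < cs s.
have QX : (count Q (X k))%:R = \sum_(s <- undup (X k) | Q s) cs s :> R.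
  by rewrite -sum1_count natr_sum big_undup_count.
exists Q.
  have : (count Q (undup (X k)))%:R * lev <= m%:R ^+ k.
    apply: (@le_trans _ _ (count Q (X k))%:R); last by rewrite -size_m ler_nat count_size.
    rewrite QX -sum1_count natr_sum mulr_suml; apply: ler_sum => s Qs.
    by rewrite mul1r ltW.
  rewrite -ler_pdivlMr// => /le_trans; apply.
  by rewrite /lev invf_div mulrCA mulfV ?gt_eqF// mulr1.
have sumS : \sum_(s <- undup (X k)) `|A s| <= beta ^+ k * (N%:R * (eta * c / 2)).
  have rt s : `|A s| = Num.sqrt (A s ^+ 2) by rewrite sqrtr_sqr.
  under eq_bigr do rewrite rt.
  apply: le_trans (@sum_sqrt_le _ _ _ (fun s => A s ^+ 2) _) _; first by move=> s; exact: sqr_ge0.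
  have r0 : 0 <= beta ^+ k * (N%:R * (eta * c / 2)).
    exact: mulr_ge0 (ltW (betan0 k)) (mulr_ge0 (ltW NR0) (ltW e0)).
  rewrite -[leRHS](ger0_norm r0) -sqrtr_sqr ler_wsqrtr// exprMn.
  have kk0 : (k0 <= k)%N by rewrite ltnW// ltnS leq_maxl.
  have SC := size_distinct_sums beta1 betam delta0 sep k.
  have SA := Hk0 k sigma x0 kk0 sigma1.
  apply: (@le_trans _ _ ((C * beta ^+ k) * (K * N%:R * beta ^+ k))).
    apply: ler_pM; [by []| |exact: SC|exact: SA].
    by apply: sumr_ge0 => s _; exact: sqr_ge0.
  rewrite (_ : _ * _ = beta ^+ k ^+ 2 * (C * K * N%:R)); last by ring.
  by rewrite ler_wpM2l// sqr_ge0.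
have main : N%:R * (c * m%:R ^+ k) <=
    N%:R * (count Q (X k))%:R + lev * (beta ^+ k * (N%:R * (eta * c / 2))).
  apply: le_trans sumA _; rewrite (bigID Q) /=; apply: lerD.
    rewrite -sum1_count natr_sum mulr_sumr; apply: ler_sum => s _.
    by rewrite mulr1; exact: le_trans (ler_norm _) (A1 s).
  apply: (@le_trans _ _ (\sum_(s <- undup (X k) | ~~ Q s) lev * `|A s|)).
    rewrite big_undup_count; apply: ler_sum => s; rewrite -leNgt => sl.
    rewrite -mulr_natl; apply: le_trans (ler_wpM2l _ (ler_norm _)) _ => //.
    by rewrite ler_wpM2r.
  rewrite -mulr_sumr ler_wpM2l ?(ltW lev0)//; apply: le_trans sumS.
  by rewrite [leRHS](bigID Q)/= lerDr sumr_ge0.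
have cnt : (count (predC Q) (X k))%:R = m%:R ^+ k - (count Q (X k))%:R :> R.
  by rewrite -size_m -(count_predC Q (X k)) natrD addrC addKr.
rewrite cnt; move: main.
have -> : lev * (beta ^+ k * (N%:R * (eta * c / 2))) = N%:R * (m%:R ^+ k * c / 2).
  by rewrite /lev; field; rewrite !gt_eqF.
by rewrite -mulrDr ler_pM2l//; lra.
Qed.

Lemma pisot_half_moment : exists2 k, (0 < k)%N & half_moment k ^+ 2 < (m%:R / beta) ^+ k.
Proof.
by have [q q01] := pisot_concentrated; exact: half_moment_small delta0 sep _ q01.
Qed.

End strict.

(** * The law of the integer parts *)

Section law_of_prefixes.
Context (R : realType) (beta : R) (m : nat).
Hypotheses (beta1 : 1 < beta) (betam : beta < m%:R).

Local Notation X := (digit_sums beta m).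
Local Notation kap := (I_len beta m).
Local Notation inI := (inI beta m).
Local Notation P := (uniform_product R m).

Let beta0 : 0 < beta. Proof. exact: lt_trans beta1. Qed.
Let betan0 n : 0 < beta ^+ n. Proof. exact: exprn_gt0. Qed.
Let kap0 : 0 < kap := I_len_gt0 beta1 betam.

Let m_gt0 : (0 < m)%N.
Proof. by rewrite -(ltr_nat R) (lt_trans beta0). Qed.

Let mE : m.-1.+1 = m. Proof. exact: prednK. Qed.

Fixpoint int_part n (w : nat -> 'I_m.-1.+1) : R :=
  if n is n'.+1 then beta * int_part n' w + (w n')%:R else 0.

Lemma eq_int_part n (w a : nat -> 'I_m.-1.+1) :
  (forall i, (i < n)%N -> w i = a i) -> int_part n w = int_part n a.
Proof.
elim: n => //= n IH wa; rewrite wa// IH// => i ni; exact/wa/ltnW.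
Qed.

Lemma sum_digit_sums1 (F : R -> nat) :
  (\sum_(t <- X 1) F t = \sum_(i < m.-1.+1) F i%:R)%N.
Proof.
rewrite /= cats0 big_map (big_nth 0%N) size_iota -(big_mkord xpredT (fun i => F i%:R)) mE.
by rewrite big_nat [RHS]big_nat; apply: eq_bigr => i /andP[_ im]; rewrite nth_iota// mulr0 add0r.
Qed.

(** Splitting a cylinder according to the next digit makes the induction work, which
    is why the claim is relative to a cylinder. *)
Lemma prob_cylinder_int_part (Q : pred R) k n (a : nat -> 'I_m.-1.+1) :
  let A := [set w : digit_seq m | cylinder n a w /\ Q (int_part (n + k) w)] in
  measurable A /\
  P A = ((count (fun t => Q (beta ^+ k * int_part n a + t)) (X k))%:R * m%:R^-1 ^+ (n + k))%:E.
Proof.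
elim: k n a => [|k IH] n a A; rewrite {}/A.
  rewrite /= expr0 mul1r addr0 !addn0.
  have [Qa|Qa] := boolP (Q (int_part n a)).
    rewrite (_ : [set w | _] = cylinder n a); last first.
      by apply/seteqP; split=> [w []//|w wa]; split=> //; rewrite (eq_int_part wa).
    split; first exact: measurable_cylinder.
    by rewrite uniform_productP mE /= mul1r.
  rewrite (_ : [set w | _] = set0); first by rewrite measure0 mul0r.
  by apply/seteqP; split=> // w [wa]; rewrite (eq_int_part wa) (negPf Qa).
pose b i j := if j == n then i else a j.
have b_lt i j : (j < n)%N -> b i j = a j by rewrite /b => /ltn_eqF ->.
pose B i := [set w : digit_seq m | cylinder n.+1 (b i) w /\ Q (int_part (n.+1 + k) w)].
have AE : [set w | cylinder n a w /\ Q (int_part (n + k.+1) w)] =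
    \big[setU/set0]_(i < m.-1.+1) B i.
  rewrite -bigcup_seq addnS -addSn; apply/seteqP; split=> w.
    move=> [wa Qw]; exists (w n); first by rewrite /= mem_index_enum.
    split=> // j; rewrite ltnS leq_eqVlt => /predU1P[->|jn]; first by rewrite /b eqxx.
    by rewrite b_lt// wa.
  move=> [i _ [wb Qw]]; split=> // j jn.
  by rewrite wb ?b_lt// ltnS ltnW.
have mB i : measurable (B i) := proj1 (IH n.+1 (b i)).
rewrite AE; split; first by apply: bigsetU_measurable.
rewrite measure_bigsetU_ord//; last first.
  apply/trivIsetP => i j _ _ ij; apply/seteqP; split=> // w.
  move=> [[/(_ n (ltnSn n)) + _] [/(_ n (ltnSn n)) + _]].
  by rewrite /b eqxx => -> /eqP; rewrite (negPf ij).
rewrite (eq_bigr _ (fun i _ => proj2 (IH n.+1 (b i)))).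
rewrite sumEFin -mulr_suml addnS -addSn -natr_sum; congr ((_%:R * _)%:E).
rewrite -sum1_count [RHS]big_mkcond -[k.+1]add1n [RHS]big_digit_sumsD (sum_digit_sums1 (fun s =>
   \sum_(t <- X k) (if Q (beta ^+ (1 + k) * int_part n a + (beta ^+ k * s + t))%R
     then 1 else 0))%N).
apply: eq_bigr => i _; rewrite -sum1_count [LHS]big_mkcond; apply: eq_bigr => t _.
have bi : b i n = i by rewrite /b eqxx.
congr (if Q _ then _ else _); rewrite /= bi.
rewrite (@eq_int_part n (b i) a) ?exprD ?expr1; first by ring.
by move=> j; exact: b_lt.
Qed.

Lemma prob_int_part (Q : pred R) n :
  measurable [set w : digit_seq m | Q (int_part n w)] /\
  P [set w | Q (int_part n w)] = ((count Q (X n))%:R * m%:R^-1 ^+ n)%:E.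
Proof.
have := prob_cylinder_int_part Q n 0 (fun=> ord0) => /=.
rewrite add0n (_ : [set w | _ /\ _] = [set w | Q (int_part n w)]); last first.
  by apply/seteqP; split=> [w []|w].
by rewrite (@eq_count _ _ Q)// => t; rewrite mulr0 add0r.
Qed.

(** The partial sums increase to the sum of the series, and decrease to it when the
    largest possible tail $\kappa\beta^{-n}$ is added. *)
Lemma inI_tail n (w : digit_seq m) :
  inI (beta ^+ n * digit_sum R beta m w - int_part n w).
Proof.
pose u := series (fun k => (w k)%:R * beta ^- k.+1).
have uE j : u j = int_part j w / beta ^+ j.
  rewrite /u /series /=; elim: j => [|j IH]; first by rewrite big_geq// mul0r.
  rewrite big_nat_recr//= IH mulrDl exprS; congr (_ + _).
  by rewrite invfM mulrACA mulfV ?gt_eqF// mul1r.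
have cu : cvgn u by exact: is_cvg_digit_sum.
have u_nd : nondecreasing_seq u.
  by apply: nondecreasing_series => k _ _; rewrite mulr_ge0// invr_ge0 ltW.
have uk : forall k, u (n + k)%N + kap / beta ^+ (n + k) <= u n + kap / beta ^+ n.
  elim=> [|k]; first by rewrite addn0.
  apply: le_trans; rewrite addnS /u /series /= big_nat_recr//= -addrA lerD2l -mulrDl.
  have -> : kap / beta ^+ (n + k) = beta * kap / beta ^+ (n + k).+1.
    by rewrite exprS invfM mulrACA mulfV ?gt_eqF// mul1r.
  rewrite ler_pM2r ?invr_gt0// I_lenE// addrC lerD2l lerBrDr natr1 ler_nat.
  by rewrite -[X in (_ <= X)%N]mE ltn_ord.
have lo : u n <= digit_sum R beta m w by apply: nondecreasing_cvgn_le.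
have hi : digit_sum R beta m w <= u n + kap / beta ^+ n.
  apply: limr_le => //; exists n => // j /= nj.
  apply: le_trans (uk (j - n)%N); rewrite subnKC// lerDl.
  by rewrite divr_ge0 ?ltW.
rewrite /(inI _); apply/andP; split.
  by rewrite subr_ge0 -ler_pdivrMl// mulrC -uE.
by rewrite lerBlDr addrC mulrC -ler_pdivlMr// mulrDl -uE.
Qed.

End law_of_prefixes.

(** * The mass of small intervals *)

Section ball_measure.
Context (R : realType) (beta : R) (m : nat) (delta : R).
Hypotheses (beta1 : 1 < beta) (betam : beta < m%:R).
Hypotheses (delta0 : 0 < delta) (sep : sums_separated beta m delta).

Local Notation X := (digit_sums beta m).
Local Notation kap := (I_len beta m).
Local Notation inI := (inI beta m).
Local Notation hits := (hits beta m).
Local Notation leb := (@lebesgue_measure R).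
Local Notation C := (remainder_bound beta m delta).
Local Notation prefixes := (prefixes beta m).
Local Notation mu := (bernoulli_convolution beta m).

Let beta0 : 0 < beta. Proof. exact: lt_trans beta1. Qed.
Let betan0 n : 0 < beta ^+ n. Proof. exact: exprn_gt0. Qed.

Let m_gt0 : (0 < m)%N.
Proof. by rewrite -(ltr_nat R) (lt_trans beta0). Qed.

Let mu_itv_measurable a b :
  measurable (digit_sum R beta m @^-1` [set` `[a, b]] : set (digit_seq m)).
Proof.
by rewrite -[X in measurable X]setTI; apply: measurable_digit_sum => //; exact: measurable_itv.
Qed.

Lemma mem_int_part n (w : digit_seq m) : int_part beta n w \in X n.
Proof.
elim: n => [|n IH]; first by rewrite inE.
apply: (allpairs_f (fun s i => beta * s + i%:R)) => //.
by rewrite mem_iota /= -[X in (_ < X)%N](prednK m_gt0).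
Qed.

(** The sums whose word of length n is a prefix of an expansion of x are within
    $\kappa\beta^{-n}$ of x. *)
Lemma conv_ball_ge n x r : kap / beta ^+ n <= r ->
  (((prefixes n x)%:R * m%:R^-1 ^+ n)%:E <= mu [set` `[x - r, x + r]%R])%E.
Proof.
move=> rn; have [mA PA] := prob_int_part beta1 betam (fun s => inI (beta ^+ n * x - s)) n.
rewrite -PA /bernoulli_convolution /pushforward le_measure ?inE//.
move=> w /= /andP[y0 yk]; rewrite in_itv /=.
have /andP[z0 zk] := inI_tail beta1 betam n w.
have {}rn : kap <= beta ^+ n * r by rewrite mulrC -ler_pdivrMr.
rewrite -(ler_pM2l (betan0 n) (x - r)) -(ler_pM2l (betan0 n) _ (x + r)) !(mulrBr, mulrDr).
by apply/andP; split; lra.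
Qed.

(** A point none of whose remainders of level n lies here has the same prefixes of
    length n as the points within $\beta^{-(n+l)}$ of it, or more. *)
Definition collar l : set R :=
  `[- beta ^- l, 0[%classic `|` `]kap, kap + beta ^- l]%classic.

Lemma measurable_collar l : measurable (collar l).
Proof. by apply: measurableU; exact: measurable_itv. Qed.

Lemma leb_collar l : (leb (collar l) <= (2 * beta^-1 ^+ l)%:E)%E.
Proof.
apply: le_trans (measureU2 _ _ _) _ => /=; [exact: measurable_itv|exact: measurable_itv|].
have bl : 0 < beta ^- l by rewrite invr_gt0.
rewrite !lebesgue_measure_itv/= !lte_fin oppr_lt0 bl ltrDl bl -!EFinB -EFinD lee_fin exprVn.
by rewrite le_eqVlt; apply/orP; left; apply/eqP; ring.
Qed.

(** If the sum for w is close to x, then the remainder of x for the word of length n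
    of w is close to a point of $I_\beta$; not being in the collar it lies in $I_\beta$. *)
Lemma conv_ball_le n l x r : ~ hits n (collar l) x -> r <= beta ^- (n + l) ->
  (mu [set` `[x - r, x + r]%R] <= ((prefixes n x)%:R * m%:R^-1 ^+ n)%:E)%E.
Proof.
move=> xB rn; have [mA PA] := prob_int_part beta1 betam (fun s => inI (beta ^+ n * x - s)) n.
rewrite -PA /bernoulli_convolution /pushforward le_measure ?inE//.
move=> w /=; rewrite in_itv /=.
rewrite -(ler_pM2l (betan0 n) (x - r)) -(ler_pM2l (betan0 n) _ (x + r)).
rewrite !(mulrBr, mulrDr) => /andP[w0 w1].
have /andP[z0 zk] := inI_tail beta1 betam n w.
have {}rn : beta ^+ n * r <= beta ^- l.
  by rewrite -ler_pdivlMl// -invfM -exprD.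
have xw : ~ collar l (beta ^+ n * x - int_part beta n w).
  by move=> xw; apply: xB; exists (int_part beta n w) => //; exact: mem_int_part.
apply: contra_notT xw; rewrite negb_and -!ltNge /collar => H.
by case/orP : H => H; [left|right]; rewrite /= in_itv /=; apply/andP; split; lra.
Qed.

(** The collars have summable measure along any arithmetic progression of levels. *)
Lemma collar_null j : null [set x | forall n, exists2 l, (n <= l)%N &
  hits (j * l) (collar l) x].
Proof.
apply: (@borel_cantelli_geometric R (fun l => hits (j * l) (collar l)) (C * 2) beta^-1).
- by move=> l; apply: measurable_hits; exact: measurable_collar.
- by rewrite mulr_ge0// (le_trans ler01)// remainder_bound_ge1.
- by rewrite invr_ge0 ltW//= invf_lt1.
- move=> l; apply: le_trans (leb_hits beta1 betam delta0 sep _ (measurable_collar l)) _.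
  rewrite -mulrA EFinM lee_wpmul2l ?leb_collar// lee_fin (le_trans ler01)// remainder_bound_ge1//.
Qed.

End ball_measure.

(** * Local dimension *)

Section local_dimension.
Context (R : realType) (beta : R) (m : nat).
Hypotheses (beta1 : 1 < beta) (betam : beta < m%:R).

Local Notation kap := (I_len beta m).
Local Notation inI := (inI beta m).
Local Notation hits := (hits beta m).
Local Notation ln_prefixes := (ln_prefixes beta m).
Local Notation mu := (bernoulli_convolution beta m).
Local Notation ball_mu x r := (fine (mu [set` `[x - r, x + r]%R])).

Let beta0 : 0 < beta. Proof. exact: lt_trans beta1. Qed.
Let betan0 n : 0 < beta ^+ n. Proof. exact: exprn_gt0. Qed.
Let m_gt0 : 0 < m%:R :> R. Proof. exact: lt_trans betam. Qed.
Let lnb0 : 0 < ln beta. Proof. exact: ln_gt0. Qed.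

Let fin_mu a b : mu [set` `[a, b]%R] \is a fin_num.
Proof.
rewrite /bernoulli_convolution /pushforward fin_num_measure//.
by rewrite -[X in measurable X]setTI; apply: measurable_digit_sum => //; exact: measurable_itv.
Qed.

Let ln_words n x : inI x ->
  0 < (prefixes beta m n x)%:R * m%:R^-1 ^+ n :> R /\
  ln ((prefixes beta m n x)%:R * m%:R^-1 ^+ n) = ln_prefixes n x - n%:R * ln m%:R.
Proof.
move=> xI; have N0 : 0 < (prefixes beta m n x)%:R :> R by rewrite ltr0n prefixes_gt0.
split; first by rewrite mulr_gt0// exprn_gt0// invr_gt0.
rewrite lnM ?posrE ?exprn_gt0 ?invr_gt0// lnXn ?invr_gt0// lnV ?posrE//.
by rewrite mulNrn mulr_natl.
Qed.

Lemma ln_ball_ge n x r : inI x -> ln kap - ln r <= n%:R * ln beta -> 0 < r ->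
  0 < ball_mu x r /\ ln_prefixes n x - n%:R * ln m%:R <= ln (ball_mu x r).
Proof.
move=> xI rn r0; have kap0 : 0 < kap := I_len_gt0 beta1 betam.
have [p0 <-] := ln_words n xI.
have : kap / beta ^+ n <= r.
  rewrite -ler_ln ?posrE ?(divr_gt0 kap0 (betan0 n))// ln_div ?posrE ?betan0//.
  by rewrite lnXn// -mulr_natl; lra.
move=> /(conv_ball_ge beta1 betam x); rewrite -[X in (_ <= X)%E]fineK// lee_fin => le.
have q0 : 0 < ball_mu x r := lt_le_trans p0 le.
by split=> //; rewrite ler_ln ?posrE.
Qed.

Lemma ln_ball_le n l x r : inI x -> ~ hits n (collar beta m l) x -> 0 < r ->
  (n + l)%:R * ln beta <= - ln r -> 0 < ball_mu x r ->
  ln (ball_mu x r) <= ln_prefixes n x - n%:R * ln m%:R.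
Proof.
move=> xI xB r0 rn q0; have [p0 <-] := ln_words n xI.
have : r <= beta ^- (n + l).
  by rewrite -ler_ln ?posrE ?invr_gt0 ?betan0// lnV ?posrE ?betan0// lnXn// -mulr_natl; lra.
move=> /(conv_ball_le beta1 betam xB); rewrite -[X in (X <= _)%E]fineK// lee_fin => le.
by rewrite ler_ln ?posrE.
Qed.

(** Once the collars are avoided at the levels j l, the mass of the interval of
    radius r is squeezed between the proportions of prefixes at two levels whose
    quotient is about (j + 1) / j. *)
Lemma local_dimension_of_growth gamma x : gamma <= ln (m%:R / beta) -> inI x ->
  (forall eps, 0 < eps -> exists N0, forall N, (N0 <= N)%N ->
     `|ln_prefixes N x - gamma * N%:R| <= eps * N%:R) ->
  (forall j, exists l0, forall l, (l0 <= l)%N -> ~ hits (j * l) (collar beta m l) x) ->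
  is_local_dimension mu x ((ln m%:R - gamma) / ln beta)%:E.
Proof.
move=> gle xI grow avoid; set D := _ / _.
have lnk0 : 0 <= ln kap by rewrite ln_ge0// ltW// I_len_gt1.
have bE : D * ln beta = ln m%:R - gamma by rewrite mulfVK// gt_eqF.
have D0 : 0 < D.
  rewrite divr_gt0// subr_gt0; apply: le_lt_trans gle _.
  by by rewrite ln_div ?posrE// gtrBl.
clearbody D.
suff key (eps : R) : 0 < eps -> exists M : R, forall r : R, 0 < r -> M <= - ln r ->
    [/\ 0 < ball_mu x r, (D - eps) * - ln r <= - ln (ball_mu x r)
      & - ln (ball_mu x r) <= (D + eps) * - ln r].
  have small M : \forall r \near 0^'+, M <= - ln r.
    near=> r; rewrite lerNr -[leRHS]expRK ler_ln ?posrE ?expR_gt0//.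
    near: r; apply: nbhs_right_le; exact: expR_gt0.
  have val r : 0 < ball_mu x r ->
      lne (mu [set` `[x - r, x + r]%R]) = (ln (ball_mu x r))%:E.
    by move=> q0; rewrite -lne_EFin// fineK.
  apply: cvg_EFin.
    have [M HM] := key 1 ltr01.
      near=> r; have r0 : 0 < r by near: r; exact: nbhs_right_gt.
    have Mr : M <= - ln r by near: r; exact: small.
    by have [q0 _ _] := HM r r0 Mr; rewrite val.
  apply/cvgrPdist_le => eps eps0.
  have [M HM] := key eps eps0.
  near=> r; have r0 : 0 < r by near: r; exact: nbhs_right_gt.
  have Mr : M <= - ln r by near: r; exact: small.
  have [q0 lo hi] := HM r r0 Mr.
  have rho0 : 0 < - ln r.
    by apply: lt_le_trans ltr01 _; near: r; exact: small.
  have v0 : ln r < 0 by rewrite -oppr_gt0.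
  rewrite /= val//= ler_distlC ler_ndivlMr// ler_ndivrMr//.
  by apply/andP; split; lra.
move=> eps0; pose b := ln beta; pose K := ln kap.
(* j makes the relative loss 1 / (j + 1) negligible; then rho = - ln r has to be
   large for n and j * l to be beyond N0 and for the bounded errors to be absorbed. *)
pose j := (Num.truncn (4 * D / eps)).+1.
have jP : 4 * D < eps * j.+1%:R.
  rewrite [eps * _]mulrC -ltr_pdivrMr//; apply: lt_trans (truncnS_gt _) _.
  by rewrite ltr_nat.
have [|N0 HN] := grow (b * (eps / 4)); first by rewrite mulr_gt0// divr_gt0.
have [l0 Hl] := avoid j.
pose L := maxn N0 l0.
pose M1 := L%:R * (j.+1%:R * b); pose M2 := 2 * (K + b) * (D + eps / 4) / eps.
pose M3 := 4 * (D * (j%:R * b)) / eps.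
have b0 : 0 < b := lnb0.
have K0 : 0 <= K := lnk0.
have De : 0 <= D + eps / 4 by rewrite addr_ge0 ?divr_ge0 ?(ltW D0) ?(ltW eps0).
have Kb : 0 <= K + b by rewrite addr_ge0 ?(ltW b0).
have M1_ge0 : 0 <= M1 by rewrite !mulr_ge0 ?(ltW b0).
have M2_ge0 : 0 <= M2 by rewrite divr_ge0 ?(ltW eps0)// !mulr_ge0.
have M3_ge0 : 0 <= M3 by rewrite divr_ge0 ?(ltW eps0)// !mulr_ge0 ?(ltW b0) ?(ltW D0).
exists (1 + M1 + M2 + M3) => r r0; set rho := - ln r => rhoM.
have rho0 : 0 < rho by lra.
have c1 : L%:R * (j.+1%:R * b) <= rho by rewrite -/M1; lra.
have c2 : 2 * (K + b) * (D + eps / 4) <= rho * eps by rewrite -ler_pdivrMr// -/M2; lra.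
have c3 : 4 * (D * (j%:R * b)) <= rho * eps by rewrite -ler_pdivrMr// -/M3; lra.
clear M1 M2 M3 M1_ge0 M2_ge0 M3_ge0 rhoM.
have L0 : 0 <= L%:R :> R by [].
have LN : N0%:R <= L%:R :> R by rewrite ler_nat leq_maxl.
have j0 : 0 < j%:R :> R by rewrite ltr0n.
have jS : j.+1%:R = j%:R + 1 :> R by rewrite -natr1.
(* The first level at which the interval of a prefix has length at most r. *)
pose n := (Num.truncn ((K + rho) / b)).+1.
have Kr0 : 0 <= (K + rho) / b by rewrite divr_ge0 ?addr_ge0// ltW.
have /andP[] := truncn_itv Kr0; rewrite -/n ler_pdivlMr// ltr_pdivrMr// => n_lo n_hi.
have {}n_lo : n%:R * b <= K + rho + b by rewrite /n -natr1 mulrDl mul1r lerD2r.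
have nN0 : (N0 <= n)%N.
  rewrite -(ler_nat R) -(ler_pM2r b0); apply: le_trans (ltW n_hi).
  have : N0%:R * b <= L%:R * (j.+1%:R * b); last by lra.
  by rewrite mulrA ler_pM2r// (le_trans LN)// ler_peMr// ler1n.
(* The last l such that r is at most beta to the - (j * l + l). *)
pose l := Num.truncn (rho / (j.+1%:R * b)).
have jb0 : 0 < j.+1%:R * b by rewrite mulr_gt0.
have rj0 : 0 <= rho / (j.+1%:R * b) by rewrite divr_ge0// ltW.
have /andP[] := truncn_itv rj0; rewrite -/l ler_pdivlMr// ltr_pdivrMr// => l_lo l_hi.
have Ll : (L <= l)%N.
  by rewrite -ltnS -(ltr_nat R) -(ltr_pM2r jb0); apply: le_lt_trans l_hi.
have n_lvl : ln kap - ln r <= n%:R * ln beta by rewrite -/rho; exact: ltW.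
have [q0 lo] := ln_ball_ge xI n_lvl r0.
have l_lvl : (j * l + l)%:R * ln beta <= - ln r.
  by rewrite -mulSnr natrM mulrAC mulrC.
have hi := ln_ball_le xI (Hl _ (leq_trans (leq_maxr _ _) Ll)) r0 l_lvl q0.
have jlN0 : (N0 <= j * l)%N.
  by rewrite (leq_trans (leq_maxl _ l0))// (leq_trans Ll)// leq_pmull.
move: (HN _ nN0) (HN _ jlN0); rewrite !ler_norml => /andP[g_lo _] /andP[_ g_hi].
have gE : ln m%:R = gamma + D * b by rewrite bE; ring.
have re0 : 0 <= rho * eps by rewrite mulr_ge0 ?(ltW eps0) ?(ltW rho0).
split=> //.
  rewrite -/rho.
  pose t := (j * l)%:R * b; pose q := rho / j.+1%:R.
  have tE : t = j%:R * (l%:R * b) by rewrite /t natrM mulrA.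
  have qE : q * j.+1%:R = rho by rewrite mulfVK// gt_eqF.
  have q_ge0 : 0 <= q by rewrite divr_ge0// ltW.
  have t_lo : rho - q - j%:R * b <= t.
    have : j%:R * q <= j%:R * (l.+1%:R * b).
      by rewrite ler_pM2l// /q ler_pdivrMr// -mulrA [b * _]mulrC ltW.
    by rewrite tE -qE jS -natr1; lra.
  have t_hi : t <= rho.
    have lb0 : 0 <= l%:R * b by rewrite mulr_ge0 ?(ltW b0).
    by move: l_lo; rewrite tE jS; lra.
  have lo1 : t * (D - eps / 4) <= - ln (ball_mu x r).
    by move: hi g_hi; rewrite gE /t; lra.
  have Dq : 4 * D * q <= eps * rho.
    by rewrite -qE [leRHS]mulrCA [leLHS]mulrC ler_wpM2l// ltW.
  have tD : D * (rho - q - j%:R * b) <= D * t by rewrite ler_pM2l.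
  have te : t * eps <= rho * eps by rewrite ler_pM2r.
  lra.
rewrite -/rho.
have hi1 : - ln (ball_mu x r) <= n%:R * b * (D + eps / 4).
  by move: lo g_lo; rewrite gE; lra.
apply: le_trans hi1 _; apply: le_trans (_ : (K + rho + b) * (D + eps / 4) <= _).
  by rewrite ler_wpM2r// addr_ge0 ?divr_ge0// ltW.
lra.
Unshelve. all: end_near.
Qed.

End local_dimension.

(** * Dimension at almost every point *)

Theorem proposition1p4 (R : realType) (beta : R) (m : nat)
    (hbeta : pisot beta) (hm : beta < m%:R) :
  exists D : R,
    [/\ 1 <= D, D < ln m%:R / ln beta,
        {ae lebesgue_measure, forall x : R,
           x \in `[0, (m%:R - 1) / (beta - 1)] ->
           is_local_dimension (bernoulli_convolution beta m) x D%:E}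
      & ~ (exists2 b : nat, beta = b%:R & (b %| m)%N) -> 1 < D].
Proof.
have [beta1 _ _] := hbeta.
have [delta delta0 sep] := pisot_separated m hbeta.
have [gamma [gamma0 gle glt gnull]] := prefixes_growth_rate beta1 hm delta0 sep.
have beta0 : 0 < beta := lt_trans ltr01 beta1.
have m0 : 0 < m%:R :> R := lt_trans beta0 hm.
have lnb0 : 0 < ln beta by exact: ln_gt0.
rewrite ln_div ?posrE// in gle glt.
exists ((ln m%:R - gamma) / ln beta); split.
- by rewrite ler_pdivlMr// mul1r lerBrDr addrC -lerBrDr.
- by rewrite ltr_pM2r ?invr_gt0// gtrBl.
- have : null ([set x | inI beta m x /\ ~ forall eps : R, 0 < eps -> exists N0,
      forall N, (N0 <= N)%N -> `|ln_prefixes beta m N x - gamma * N%:R| <= eps * N%:R] `|`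
      \bigcup_j [set x | forall n, exists2 l, (n <= l)%N &
        hits beta m (j * l) (collar beta m l) x]).
    by apply: nullU => //; apply: null_bigcup => j; exact: (collar_null beta1 hm delta0 sep).
  apply: null_sub => x /= /not_implyP[]; rewrite in_itv /= => xI.
  apply: contra_notP => /not_orP[grow avoid].
  apply: (local_dimension_of_growth beta1 hm) => //.
  + by rewrite ln_div ?posrE.
  + by apply: contra_notP grow => grow; split.
  + move=> j; apply: contra_notP avoid => /forallNP avoid; exists j => //= n.
    by have /existsNP[l /not_implyP[nl /contrapT lx]] := avoid n; exists l.
- move=> /(pisot_half_moment hbeta hm delta0 sep) /glt; rewrite ltr_pdivlMr// mul1r; lra.
Qed.
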